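(* Let $n\ge5$. There exists a constant $\bar\theta=\bar\theta(n)>0$ such that: for every $\sigma\in(0,2]$ and every $\theta\in[0,\bar\theta]$ the cone $\mathcal C_{\sigma,\theta}$ is invariant under the Hamilton ODE; and for every $\sigma\in(0,1)\cup(1,2)$ and every $\theta\in(0,\bar\theta)$ the cone $\mathcal C_{\sigma,\theta}$ is transversally invariant away from $0$.
   Context: An algebraic curvature tensor on $\mathbb{R}^n$ is a tensor $R=(R_{ijkl})$ with $R_{ijkl}=-R_{jikl}=R_{klij}$ and $R_{ijkl}+R_{jkil}+R_{kijl}=0$; the unit round sphere has $R_{ijkl}=\delta_{ik}\delta_{jl}-\delta_{il}\delta_{jk}$. We write $\mathrm{Ric}(R)_{ik}=\sum_j R_{ijkj}$, $\mathrm{scal}(R)=\sum_i\mathrm{Ric}(R)_{ii}$, $\mathrm{Ric}_0(R)=\mathrm{Ric}(R)-\frac1n\mathrm{scal}(R)\,\mathrm{id}$. For symmetric bilinear forms $A,B$, $(A\odot B)_{ijkl}=A_{ik}B_{jl}-A_{il}B_{jk}-A_{jk}B_{il}+A_{jl}B_{ik}$; $\mathrm{id}=(\delta_{ij})$. The PIC2 cone is the set of algebraic curvature tensors $R$ with $R(z,w,\bar z,\bar w)\ge0$ for all $z,w\in\mathbb{C}^n$ ($R$ extended complex-multilinearly). For $\sigma\in(0,2]$ and $\theta\ge0$, $\mathcal{C}_{\sigma,\theta}$ denotes the set of algebraic curvature tensors $R$ that can be written $R=S+H\odot\mathrm{id}$, where $S$ is an algebraic curvature tensor in the PIC2 cone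 with $\mathrm{Ric}_0(S)=0$ and $H$ is a symmetric bilinear form with $\mathrm{tr}(H)\,\mathrm{id}-(n-2\sigma)H$ positive semidefinite and $\mathrm{tr}(H)-\theta\,\mathrm{scal}(S)\ge0$. For algebraic curvature tensors $S,T$ let $B(S,T)_{ijkl}=\frac12\sum_{p,q}(S_{ijpq}T_{klpq}+S_{klpq}T_{ijpq})+\sum_{p,q}(S_{ipkq}T_{jplq}-S_{iplq}T_{jpkq}-S_{jpkq}T_{iplq}+S_{jplq}T_{ipkq})$ and $Q(R)=B(R,R)$. The Hamilton ODE is $\frac{d}{dt}R=Q(R)$. A set $F$ of algebraic curvature tensors is invariant under the Hamilton ODE if every solution $R(t)$ with $R(0)\in F$ satisfies $R(t)\in F$ for all $t\ge0$ in its interval of existence. A closed convex cone $\mathcal C$ is transversally invariant away from $0$ if for every $R\in\partial\mathcal C\setminus\{0\}$, $Q(R)$ lies in the interior of the tangent cone of $\mathcal C$ at $R$. *)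

(* Defs.v *)
From Stdlib Require Import Reals Lra Lia.
Open Scope R_scope.

(* Tensors on R^n are represented by functions of nat indices; only indices
   i < n are ever inspected, all sums run over 0..n-1. *)
Definition Tensor := nat -> nat -> nat -> nat -> R.
Definition Form := nat -> nat -> R.

Fixpoint rsum (n : nat) (f : nat -> R) : R :=
  match n with
  | O => 0
  | S m => rsum m f + f m
  end.

Definition kdelta (i j : nat) : R := if Nat.eqb i j then 1 else 0.
Definition idf : Form := kdelta.

Definition is_act (n : nat) (Rm : Tensor) : Prop :=
  forall i j k l, (i < n)%nat -> (j < n)%nat -> (k < n)%nat -> (l < n)%nat ->
    Rm i j k l = - Rm j i k l /\ Rm i j k l = Rm k l i j /\
    Rm i j k l + Rm j k i l + Rm k i j l = 0.

Definition teq (n : nat) (A B : Tensor) : Prop :=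
  forall i j k l, (i < n)%nat -> (j < n)%nat -> (k < n)%nat -> (l < n)%nat ->
    A i j k l = B i j k l.

Definition Ric (n : nat) (Rm : Tensor) : Form :=
  fun i k => rsum n (fun j => Rm i j k j).
Definition scal (n : nat) (Rm : Tensor) : R := rsum n (fun i => Ric n Rm i i).
Definition Ric0 (n : nat) (Rm : Tensor) : Form :=
  fun i k => Ric n Rm i k - / INR n * scal n Rm * kdelta i k.

Definition kn (A B : Form) : Tensor :=
  fun i j k l => A i k * B j l - A i l * B j k - A j k * B i l + A j l * B i k.

Definition tr (n : nat) (H : Form) : R := rsum n (fun i => H i i).

Definition is_sym (n : nat) (H : Form) : Prop :=
  forall i j, (i < n)%nat -> (j < n)%nat -> H i j = H j i.

Definition psd (n : nat) (A : Form) : Prop :=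
  forall x : nat -> R, 0 <= rsum n (fun i => rsum n (fun j => A i j * x i * x j)).

(* R(z,w,zbar,wbar) for z = x + i y, w = u + i v, written via real and
   imaginary parts of sum_{ijkl} R_ijkl z_i w_j conj(z_k) conj(w_l). *)
Definition sum4 (n : nat) (F : nat -> nat -> nat -> nat -> R) : R :=
  rsum n (fun i => rsum n (fun j => rsum n (fun k => rsum n (fun l => F i j k l)))).

Definition pic2_re (n : nat) (Rm : Tensor) (x y u v : nat -> R) : R :=
  sum4 n (fun i j k l => Rm i j k l *
    ((x i * x k + y i * y k) * (u j * u l + v j * v l)
     - (y i * x k - x i * y k) * (v j * u l - u j * v l))).
Definition pic2_im (n : nat) (Rm : Tensor) (x y u v : nat -> R) : R :=
  sum4 n (fun i j k l => Rm i j k l *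
    ((x i * x k + y i * y k) * (v j * u l - u j * v l)
     + (y i * x k - x i * y k) * (u j * u l + v j * v l))).

Definition PIC2 (n : nat) (Rm : Tensor) : Prop :=
  is_act n Rm /\
  forall x y u v : nat -> R, pic2_im n Rm x y u v = 0 /\ 0 <= pic2_re n Rm x y u v.

Definition Ccone (n : nat) (sigma theta : R) (Rm : Tensor) : Prop :=
  is_act n Rm /\
  exists (S : Tensor) (H : Form),
    is_act n S /\ PIC2 n S /\
    (forall i k, (i < n)%nat -> (k < n)%nat -> Ric0 n S i k = 0) /\
    is_sym n H /\
    psd n (fun i j => tr n H * idf i j - (INR n - 2 * sigma) * H i j) /\
    0 <= tr n H - theta * scal n S /\
    teq n Rm (fun i j k l => S i j k l + kn H idf i j k l).

Definition Bop (n : nat) (S T : Tensor) : Tensor :=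
  fun i j k l =>
    / 2 * rsum n (fun p => rsum n (fun q => S i j p q * T k l p q + S k l p q * T i j p q))
    + rsum n (fun p => rsum n (fun q =>
        S i p k q * T j p l q - S i p l q * T j p k q
        - S j p k q * T i p l q + S j p l q * T i p k q)).
Definition Qop (n : nat) (Rm : Tensor) : Tensor := Bop n Rm Rm.

Definition hamilton_solution (n : nat) (Rt : R -> Tensor) (T : R) : Prop :=
  (forall t, 0 < t < T ->
     forall i j k l, (i < n)%nat -> (j < n)%nat -> (k < n)%nat -> (l < n)%nat ->
       derivable_pt_lim (fun s => Rt s i j k l) t (Qop n (Rt t) i j k l)) /\
  (forall t, 0 <= t < T ->
     forall i j k l, (i < n)%nat -> (j < n)%nat -> (k < n)%nat -> (l < n)%nat ->
       forall eps, 0 < eps -> exists delta, 0 < delta /\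
         forall s, 0 <= s < T -> Rabs (s - t) < delta ->
           Rabs (Rt s i j k l - Rt t i j k l) < eps).

Definition ode_invariant (n : nat) (F : Tensor -> Prop) : Prop :=
  forall (T : R) (Rt : R -> Tensor), 0 < T -> hamilton_solution n Rt T ->
    F (Rt 0) -> forall t, 0 <= t < T -> F (Rt t).

Definition dist2 (n : nat) (A B : Tensor) : R :=
  sum4 n (fun i j k l => (A i j k l - B i j k l) ^ 2).

Definition interior (n : nat) (F : Tensor -> Prop) (X : Tensor) : Prop :=
  exists eps, 0 < eps /\
    forall Y, is_act n Y -> dist2 n X Y < eps -> F Y.

Definition closure (n : nat) (F : Tensor -> Prop) (X : Tensor) : Prop :=
  forall eps, 0 < eps -> exists Y, F Y /\ dist2 n X Y < eps.

Definition boundary (n : nat) (F : Tensor -> Prop) (X : Tensor) : Prop :=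
  is_act n X /\ closure n F X /\ ~ interior n F X.

Definition tangent_cone (n : nat) (F : Tensor -> Prop) (X : Tensor) : Tensor -> Prop :=
  fun V => is_act n V /\
    closure n (fun W => exists S lam, F S /\ 0 <= lam /\
                 teq n W (fun i j k l => lam * (S i j k l - X i j k l))) V.

Definition is_zero (n : nat) (X : Tensor) : Prop := teq n X (fun _ _ _ _ => 0).

Definition transversally_invariant (n : nat) (F : Tensor -> Prop) : Prop :=
  forall X, boundary n F X -> ~ is_zero n X ->
    interior n (tangent_cone n F X) (Qop n X).

(* Main.v *)
Require Import Defs.
From Stdlib Require Import Reals Lra Lia Arith List Classical ClassicalEpsilon.
Open Scope R_scope.

(* Write a point of the cone as [R = T + H . id], with [h = tr H], [a = h / (n - 2 sigma)],
   [A = a id - H] (positive semidefinite, of trace [t = 2 sigma a]) and [Ric T = lambda id].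
   Since [B (T, H . id) = Ric T . H + (T * H) . id], one finds [Q R = T' + H' . id] with
   [T' = Q T + (n - 2) A . A - K . id], where [K] makes [T'] Einstein up to a free multiple [k] of
   the identity. In an eigenbasis of [A], with eigenvalues [alpha_i], the error term of [T'] is a
   nonnegative curvature operator as soon as [k >= u (t - u) - (n - 4) alpha_i alpha_j] for
   [u = alpha_i + alpha_j] and all [i <> j], whereas the condition on [tr H id - (n - 2 sigma) H]
   is preserved as soon as [sigma^2 k <= t^2 - sigma (2 - sigma) |A|^2]. Both can be met, with a gain
   of order [t^2] unless [sigma] is 1 or 2. The condition [h >= theta scal T] is preserved for
   small [theta], because [h' - theta scal T' = 2 lambda h + O (h^2)] when [h = theta scal T].
   That [Q T] points into the PIC2 cone at [T] is Wilking's second variation argument, and the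
   passage to the ODE is Nagumo's theorem for closed sets. *)

(** The decomposition of [R] is not unique: a multiple of [id . id] may be moved between the two
    summands, and this is the freedom [k]. Raising [k] helps [T'] and hurts the condition on [H'],
    so [k] is taken as large as the latter permits, less [c t^2]. Put [y = u (t - u)], so that
    [0 <= 4 y <= t^2]. From [|A|^2 <= t^2 - 2 y - 2 alpha_i alpha_j], the room between the two
    conditions, times [sigma^2], is at least [(t^2 - 4 y) (1 - sigma)^2 + 4 y (1 - sigma/2)^2]. This
    interpolates between two squares and can vanish for [t > 0] only if [sigma = 1] (with [y = 0])
    or [sigma = 2] (with [4 y = t^2]), which is the origin of the exceptional values. The obstacle
    in passing to the ODE is that all inequalities are of first order and hold only at null vectors,
    whereas a step of positive length must stay in the cone. Compactness gives such a step when the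
    inequalities are strict, so a small multiple of a fixed tensor pointing inwards is added; both
    the distance estimate for the ODE and the closure in the definition of the tangent cone absorb
    it. *)

(** * Finite sums and Kronecker deltas *)

Lemma rsum_ext n f g : (forall i, (i < n)%nat -> f i = g i) -> rsum n f = rsum n g.
Proof.
  intros E; induction n as [|n IH]; simpl; auto.
  rewrite IH, E; auto with arith.
Qed.

Lemma rsum_ext2 n f g : (forall i j, (i < n)%nat -> (j < n)%nat -> f i j = g i j) ->
  rsum n (fun i => rsum n (fun j => f i j)) = rsum n (fun i => rsum n (fun j => g i j)).
Proof. intros E; apply rsum_ext; intros; apply rsum_ext; auto. Qed.

Lemma rsum_plus n f g : rsum n (fun i => f i + g i) = rsum n f + rsum n g.
Proof. induction n as [|n IH]; simpl; rewrite ?IH; ring. Qed.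

Lemma rsum_minus n f g : rsum n (fun i => f i - g i) = rsum n f - rsum n g.
Proof. induction n as [|n IH]; simpl; rewrite ?IH; ring. Qed.

Lemma rsum_opp n f : rsum n (fun i => - f i) = - rsum n f.
Proof. induction n as [|n IH]; simpl; rewrite ?IH; ring. Qed.

Lemma rsum_scal_l n c f : rsum n (fun i => c * f i) = c * rsum n f.
Proof. induction n as [|n IH]; simpl; rewrite ?IH; ring. Qed.

Lemma rsum_scal_r n c f : rsum n (fun i => f i * c) = rsum n f * c.
Proof. induction n as [|n IH]; simpl; rewrite ?IH; ring. Qed.

Lemma rsum_0 n f : (forall i, (i < n)%nat -> f i = 0) -> rsum n f = 0.
Proof.
  intros E; rewrite (rsum_ext n f (fun _ => 0)); auto.
  clear E; induction n as [|n IH]; simpl; rewrite ?IH; ring.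
Qed.

Lemma rsum_const n c : rsum n (fun _ => c) = INR n * c.
Proof. induction n as [|n IH]; [simpl; ring|]. rewrite S_INR; simpl rsum; rewrite IH; ring. Qed.

Lemma rsum_swap n m f :
  rsum n (fun i => rsum m (fun j => f i j)) = rsum m (fun j => rsum n (fun i => f i j)).
Proof.
  induction n as [|n IH]; simpl.
  - symmetry; apply rsum_0; auto.
  - rewrite IH, rsum_plus; reflexivity.
Qed.

Lemma rsum_mult n m f g :
  rsum n f * rsum m g = rsum n (fun i => rsum m (fun j => f i * g j)).
Proof.
  rewrite <- rsum_scal_r; apply rsum_ext; intros; rewrite rsum_scal_l; reflexivity.
Qed.

Lemma rsum_le n f g : (forall i, (i < n)%nat -> f i <= g i) -> rsum n f <= rsum n g.
Proof.
  intros E; induction n as [|n IH]; simpl; [lra|].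
  apply Rplus_le_compat; auto with arith.
Qed.

Lemma rsum_nonneg n f : (forall i, (i < n)%nat -> 0 <= f i) -> 0 <= rsum n f.
Proof.
  intros E; replace 0 with (rsum n (fun _ => 0)).
  - apply rsum_le; auto.
  - apply rsum_0; auto.
Qed.

Lemma rsum_ge_term n f i : (forall j, (j < n)%nat -> 0 <= f j) -> (i < n)%nat ->
  f i <= rsum n f.
Proof.
  intros E; induction n as [|n IH]; intros Hi; [lia|]; simpl.
  destruct (Nat.eq_dec i n) as [->|ne].
  - assert (0 <= rsum n f) by (apply rsum_nonneg; auto with arith). lra.
  - assert (f i <= rsum n f) by (apply IH; auto with arith; lia).
    specialize (E n (Nat.lt_succ_diag_r n)). lra.
Qed.

Lemma rsum_eq0 n f i : (forall j, (j < n)%nat -> 0 <= f j) -> rsum n f <= 0 -> (i < n)%nat ->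
  f i = 0.
Proof.
  intros E Z Hi; pose proof (rsum_ge_term n f i E Hi); pose proof (E i Hi); lra.
Qed.

Lemma rsum_Rabs n f : Rabs (rsum n f) <= rsum n (fun i => Rabs (f i)).
Proof.
  induction n as [|n IH]; simpl; [rewrite Rabs_R0; lra|].
  pose proof (Rabs_triang (rsum n f) (f n)); lra.
Qed.

Lemma kdelta_same i : kdelta i i = 1.
Proof. unfold kdelta; rewrite Nat.eqb_refl; reflexivity. Qed.

Lemma kdelta_diff i j : i <> j -> kdelta i j = 0.
Proof. intros H; unfold kdelta; destruct (Nat.eqb_spec i j); congruence. Qed.

Lemma kdelta_sym i j : kdelta i j = kdelta j i.
Proof. unfold kdelta; rewrite Nat.eqb_sym; reflexivity. Qed.

Lemma rsum_delta_l n i f : (i < n)%nat -> rsum n (fun p => kdelta i p * f p) = f i.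
Proof.
  induction n as [|n IH]; intros Hi; [lia|]; simpl.
  destruct (Nat.eq_dec i n) as [->|ne].
  - rewrite kdelta_same, rsum_0; [ring|].
    intros p Hp; rewrite kdelta_diff by lia; ring.
  - rewrite IH, kdelta_diff by lia; ring.
Qed.

Lemma rsum_delta_r n i f : (i < n)%nat -> rsum n (fun p => f p * kdelta p i) = f i.
Proof.
  intros Hi; rewrite <- (rsum_delta_l n i f Hi); apply rsum_ext; intros.
  rewrite kdelta_sym; ring.
Qed.

Lemma rsum_add n m f : rsum (n + m) f = rsum n f + rsum m (fun i => f (n + i)%nat).
Proof.
  induction m as [|m IH]; simpl.
  - rewrite Nat.add_0_r; ring.
  - rewrite Nat.add_succ_r; simpl; rewrite IH; ring.
Qed.

(** Lets a block matrix be treated as an ordinary one, entry [i] of block [b] sitting at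
    [b n + i]. *)
Lemma rsum_flatten m n f :
  rsum (m * n) f = rsum m (fun b => rsum n (fun i => f (b * n + i)%nat)).
Proof.
  induction m as [|m IH]; [reflexivity|].
  replace (S m * n)%nat with (m * n + n)%nat by lia.
  rewrite rsum_add, IH; reflexivity.
Qed.

Lemma choice {A B : Type} (P : A -> B -> Prop) :
  (forall x, exists y, P x y) -> exists f : A -> B, forall x, P x (f x).
Proof.
  intros H; exists (fun x => proj1_sig (constructive_indefinite_description _ (H x))).
  intros x; apply proj2_sig.
Qed.

(** * Convergence of sequences of finite families *)

Definition strictly_increasing (phi : nat -> nat) : Prop := forall m, (phi m < phi (S m))%nat.

Lemma strictly_increasing_ge phi : strictly_increasing phi -> forall m, (m <= phi m)%nat.
Proof. intros I m; induction m as [|m IH]; [lia|]. specialize (I m); lia. Qed.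

Lemma strictly_increasing_comp phi psi : strictly_increasing phi -> strictly_increasing psi ->
  strictly_increasing (fun m => phi (psi m)).
Proof.
  intros I J m.
  assert (mono : forall a b, (a < b)%nat -> (phi a < phi b)%nat).
  { intros a b Hab; induction Hab; [apply I|]. specialize (I m0); lia. }
  apply mono, J.
Qed.

Lemma Un_cv_subseq u l phi : strictly_increasing phi -> Un_cv u l -> Un_cv (fun m => u (phi m)) l.
Proof.
  intros I C eps He; destruct (C eps He) as [N HN]; exists N; intros m Hm.
  apply HN; pose proof (strictly_increasing_ge phi I m); lia.
Qed.

Lemma Un_cv_const c : Un_cv (fun _ => c) c.
Proof. intros eps He; exists O; intros; rewrite Rdist_eq; lra. Qed.

Lemma Un_cv_ext u v l : (forall m, u m = v m) -> Un_cv u l -> Un_cv v l.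
Proof.
  intros E C eps He; destruct (C eps He) as [N HN]; exists N; intros m Hm.
  rewrite <- E; auto.
Qed.

Lemma Un_cv_le u v l l' : (forall m, u m <= v m) -> Un_cv u l -> Un_cv v l' -> l <= l'.
Proof.
  intros E C C'; apply Rnot_lt_le; intros L.
  destruct (C ((l - l') / 2)) as [N HN]; [lra|].
  destruct (C' ((l - l') / 2)) as [N' HN']; [lra|].
  specialize (HN (N + N')%nat ltac:(lia)); specialize (HN' (N + N')%nat ltac:(lia)).
  unfold Rdist in *; apply Rabs_def2 in HN; apply Rabs_def2 in HN'.
  specialize (E (N + N')%nat); lra.
Qed.

Lemma Un_cv_rsum n (u : nat -> nat -> R) l :
  (forall i, (i < n)%nat -> Un_cv (fun m => u m i) (l i)) ->
  Un_cv (fun m => rsum n (u m)) (rsum n l).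
Proof.
  induction n as [|n IH]; intros H; simpl.
  - apply Un_cv_const.
  - apply (CV_plus (fun m => rsum n (u m)) (fun m => u m n)); auto with arith.
Qed.

Lemma Un_cv_inv_succ : Un_cv (fun m => / (INR m + 1)) 0.
Proof.
  intros eps He; destruct (archimed_cor1 eps He) as [N [H1 H2]].
  exists N; intros m Hm; unfold Rdist; rewrite Rminus_0_r.
  assert (0 < INR N) by (apply lt_0_INR; lia).
  assert (INR N <= INR m) by (apply le_INR; lia).
  rewrite Rabs_right by (left; apply Rlt_gt, Rinv_0_lt_compat; lra).
  apply Rle_lt_trans with (/ INR N); auto.
  apply Rinv_le_contravar; lra.
Qed.

Lemma bolzano_weierstrass_real u M : (forall m, Rabs (u m) <= M) ->
  exists phi l, strictly_increasing phi /\ Un_cv (fun m => u (phi m)) l.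
Proof.
  intros B.
  destruct (Bolzano_Weierstrass u (fun x => - M <= x <= M)) as [l Hl].
  - apply compact_P3.
  - intros m; specialize (B m); pose proof (Rle_abs (u m)); pose proof (Rle_abs (- u m)).
    rewrite Rabs_Ropp in *; lra.
  (* A state is a pair of the last index used and the precision wanted next; the cluster value
     supplies a later index within that precision. *)
  - assert (next : forall p : nat * nat, exists q, (fst p < q)%nat /\
        Rabs (u q - l) < / (INR (snd p) + 1)).
    { intros [p k]; simpl.
      assert (pos : 0 < / (INR k + 1)).
      { apply Rinv_0_lt_compat; pose proof (pos_INR k); lra. }
      destruct (Hl (disc l (mkposreal _ pos)) (S p)) as [q [H1 H2]].
      - exists (mkposreal _ pos); intros x Hx; exact Hx.
      - exists q; split; [lia|exact H2]. }
    apply choice in next; destruct next as [nx Hnx].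
    set (phi := fix phi m := match m with O => nx (O, O) | S k => nx (phi k, S k) end).
    exists phi, l; split.
    + intros m; simpl; apply (Hnx (phi m, S m)).
    + assert (close : forall m, Rabs (u (phi m) - l) < / (INR m + 1)).
      { intros [|m]; [exact (proj2 (Hnx (O, O)))|exact (proj2 (Hnx (phi m, S m)))]. }
      intros eps He; destruct (Un_cv_inv_succ eps He) as [N HN].
      exists N; intros m Hm; specialize (HN m Hm); unfold Rdist in *.
      rewrite Rminus_0_r in HN; pose proof (Rle_abs (/ (INR m + 1))).
      specialize (close m); lra.
Qed.

Lemma bolzano_weierstrass (A : Type) (L : list A) (u : nat -> A -> R) M :
  (forall m a, In a L -> Rabs (u m a) <= M) ->
  exists phi (l : A -> R), strictly_increasing phi /\
    forall a, In a L -> Un_cv (fun m => u (phi m) a) (l a).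
Proof.
  intros B.
  (* One subsequence is refined for each coordinate in turn. The limits are only claimed to exist
     here; they are collected into one function afterwards, with the default 0 off [L]. *)
  assert (weak : exists phi, strictly_increasing phi /\
     forall a, In a L -> exists l, Un_cv (fun m => u (phi m) a) l).
  { induction L as [|a L IH].
    - exists (fun m => m); split; [intros m; lia|]. intros a [].
    - destruct IH as [phi [I C]]; [intros; apply B; simpl; auto|].
      destruct (bolzano_weierstrass_real (fun m => u (phi m) a) M) as [psi [l [J Cl]]].
      { intros; apply B; simpl; auto. }
      exists (fun m => phi (psi m)); split; [apply strictly_increasing_comp; auto|].
      intros b [<-|Hb]; [exists l; exact Cl|].
      destruct (C b Hb) as [l' Hl']; exists l'.
      apply (Un_cv_subseq (fun m => u (phi m) b)); auto. }
  destruct weak as [phi [I C]].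
  destruct (choice (fun a l => In a L -> Un_cv (fun m => u (phi m) a) l)) as [l Hl].
  { intros a; destruct (classic (In a L)) as [Ha|Ha].
    - destruct (C a Ha) as [l Hl]; exists l; auto.
    - exists 0; tauto. }
  exists phi, l; auto.
Qed.

Lemma bolzano_weierstrass_vec n (u : nat -> nat -> R) M :
  (forall m i, (i < n)%nat -> Rabs (u m i) <= M) ->
  exists phi (l : nat -> R), strictly_increasing phi /\
    forall i, (i < n)%nat -> Un_cv (fun m => u (phi m) i) (l i).
Proof.
  intros B; destruct (bolzano_weierstrass nat (seq 0 n) u M) as [phi [l [I C]]].
  - intros m i Hi; apply in_seq in Hi; apply B; lia.
  - exists phi, l; split; auto; intros i Hi; apply C, in_seq; lia.
Qed.

(** [X] carries no topology: compactness is left to the caller, which extracts a limit from [u]. It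
    serves both the quadratic form on unit vectors and minus the squared distance to a closed set of
    tensors. *)
Lemma sup_attaining_sequence (X : Type) (D : X -> Prop) (f : X -> R) M :
  (exists x, D x) -> (forall x, D x -> f x <= M) ->
  exists (u : nat -> X) s, (forall m, D (u m)) /\ Un_cv (fun m => f (u m)) s /\
    forall x, D x -> f x <= s.
Proof.
  intros [x0 H0] B.
  destruct (completeness (fun y => exists x, D x /\ y = f x)) as [s [Hs1 Hs2]].
  - exists M; intros y [x [Dx ->]]; auto.
  - exists (f x0), x0; auto.
  - destruct (choice (fun m x => D x /\ s - / (INR m + 1) < f x)) as [u Hu].
    { intros m; apply NNPP; intros N.
      assert (pos : 0 < / (INR m + 1)).
      { apply Rinv_0_lt_compat; pose proof (pos_INR m); lra. }
      assert (s <= s - / (INR m + 1)); [|lra].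
      apply Hs2; intros y [x [Dx ->]]; apply Rnot_lt_le; intros L; apply N; exists x; auto. }
    exists u, s; split; [intros; apply Hu|]; split.
    + intros eps He; destruct (Un_cv_inv_succ eps He) as [N HN].
      exists N; intros m Hm; specialize (HN m Hm); unfold Rdist in *.
      rewrite Rminus_0_r in HN; pose proof (Rle_abs (/ (INR m + 1))).
      destruct (Hu m) as [Dm Lm].
      assert (f (u m) <= s) by (apply Hs1; exists (u m); auto).
      apply Rabs_def1; lra.
    + intros x Dx; apply Hs1; exists x; auto.
Qed.

(** * Bilinear forms and the spectral theorem *)

Definition dot (n : nat) (x y : nat -> R) : R := rsum n (fun i => x i * y i).

Definition bil (n : nat) (A : Form) (x y : nat -> R) : R :=
  rsum n (fun i => rsum n (fun j => A i j * x i * y j)).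

Definition mulv (n : nat) (A : Form) (x : nat -> R) (i : nat) : R :=
  rsum n (fun j => A i j * x j).

Lemma dot_sym n x y : dot n x y = dot n y x.
Proof. apply rsum_ext; intros; ring. Qed.

Lemma dot_lin n x y s z :
  dot n (fun i => x i + s * y i) z = dot n x z + s * dot n y z.
Proof.
  unfold dot; rewrite <- rsum_scal_l, <- rsum_plus; apply rsum_ext; intros; ring.
Qed.

Lemma dot_lin_r n x y s z :
  dot n z (fun i => x i + s * y i) = dot n z x + s * dot n z y.
Proof. rewrite dot_sym, dot_lin, (dot_sym n x), (dot_sym n y); reflexivity. Qed.

Lemma dot_scal_l n s y z : dot n (fun i => s * y i) z = s * dot n y z.
Proof. unfold dot; rewrite <- rsum_scal_l; apply rsum_ext; intros; ring. Qed.

Lemma dot_nonneg n x : 0 <= dot n x x.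
Proof. apply rsum_nonneg; intros; nra. Qed.

Lemma dot_eq0 n x i : dot n x x <= 0 -> (i < n)%nat -> x i = 0.
Proof.
  intros Z Hi; pose proof (rsum_eq0 n (fun i => x i * x i) i) as E; simpl in E.
  assert (x i * x i = 0) by (apply E; auto; intros; nra). nra.
Qed.

Lemma dot_bounds_entry n x i : dot n x x <= 1 -> (i < n)%nat -> Rabs (x i) <= 1.
Proof.
  intros D Hi.
  assert (x i * x i <= dot n x x).
  { apply (rsum_ge_term n (fun i => x i * x i)); auto; intros; nra. }
  apply Rabs_le; nra.
Qed.

Lemma bil_mulv n A x y : bil n A x y = dot n x (mulv n A y).
Proof.
  apply rsum_ext; intros; unfold mulv; rewrite <- rsum_scal_l; apply rsum_ext; intros; ring.
Qed.

Lemma bil_sym n A x y : is_sym n A -> bil n A x y = bil n A y x.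
Proof.
  intros S; unfold bil; rewrite rsum_swap; apply rsum_ext2; intros; rewrite S by auto; ring.
Qed.

Lemma bil_lin n A x y s z :
  bil n A (fun i => x i + s * y i) z = bil n A x z + s * bil n A y z.
Proof. rewrite !bil_mulv; apply dot_lin. Qed.

Lemma bil_lin_r n A x y s z :
  bil n A z (fun i => x i + s * y i) = bil n A z x + s * bil n A z y.
Proof.
  unfold bil; rewrite <- rsum_scal_l, <- rsum_plus; apply rsum_ext; intros.
  rewrite <- rsum_scal_l, <- rsum_plus; apply rsum_ext; intros; ring.
Qed.

Lemma bil_scal n A x s :
  bil n A (fun i => s * x i) (fun i => s * x i) = s * s * bil n A x x.
Proof.
  unfold bil; rewrite <- rsum_scal_l; apply rsum_ext; intros.
  rewrite <- rsum_scal_l; apply rsum_ext; intros; ring.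
Qed.

Lemma bil_form_lin n A B s x y :
  bil n (fun i j => A i j + s * B i j) x y = bil n A x y + s * bil n B x y.
Proof.
  unfold bil; rewrite <- rsum_scal_l, <- rsum_plus; apply rsum_ext; intros.
  rewrite <- rsum_scal_l, <- rsum_plus; apply rsum_ext; intros; ring.
Qed.

Lemma bil_form_ext n A B x y : (forall i j, (i < n)%nat -> (j < n)%nat -> A i j = B i j) ->
  bil n A x y = bil n B x y.
Proof. intros E; apply rsum_ext2; intros; rewrite E; auto. Qed.

Lemma bil_idf n x y : bil n idf x y = dot n x y.
Proof.
  rewrite bil_mulv; apply rsum_ext; intros; unfold mulv, idf; rewrite rsum_delta_l; auto.
Qed.

Lemma mulv_kdelta n A i j : (j < n)%nat -> mulv n A (kdelta j) i = A i j.
Proof.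
  intros Hj; unfold mulv; rewrite <- (rsum_delta_r n j (fun p => A i p)) by auto.
  apply rsum_ext; intros; rewrite (kdelta_sym j); reflexivity.
Qed.

Lemma dot_kdelta n x i : (i < n)%nat -> dot n (kdelta i) x = x i.
Proof. apply (rsum_delta_l n i x). Qed.

Lemma bil_kdelta n A i j : (i < n)%nat -> (j < n)%nat -> bil n A (kdelta i) (kdelta j) = A i j.
Proof.
  intros Hi Hj; rewrite bil_mulv, dot_kdelta, mulv_kdelta; auto.
Qed.

Lemma psd_bil n A x : psd n A -> 0 <= bil n A x x.
Proof. intros P; apply P. Qed.

Lemma tr_nonneg n A : psd n A -> 0 <= tr n A.
Proof.
  intros P; apply rsum_nonneg; intros i Hi; rewrite <- (bil_kdelta n A i i) by auto.
  apply P.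
Qed.

(** First-order condition at a minimum, for a polynomial that vanishes at [s = 0]. At
    [s = - b / (|c| + 1)] the linear term would win unless [b = 0]. *)
Lemma quadratic_nonneg_linear_zero b c : (forall s, 0 <= 2 * s * b + s * s * c) -> b = 0.
Proof.
  intros H; pose proof (Rabs_pos c); pose proof (Rle_abs c).
  set (t := / (Rabs c + 1)).
  assert (E : t * (Rabs c + 1) = 1) by (apply Rinv_l; lra).
  assert (0 < t) by (apply Rinv_0_lt_compat; lra).
  specialize (H (- t * b)).
  assert (t * c <= 1) by nra.
  assert (b * b * (t * (2 - t * c)) <= 0) by nra.
  assert (0 < t * (2 - t * c)) by nra.
  destruct (Req_dec b 0) as [|N]; auto; exfalso.
  assert (0 < b * b) by nra.
  pose proof (Rmult_lt_0_compat (b * b) (t * (2 - t * c))); lra.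
Qed.

(** A null vector minimises the form, so the first variation in every direction [y] vanishes. *)
Lemma psd_null n A x y : is_sym n A -> psd n A -> bil n A x x = 0 -> bil n A x y = 0.
Proof.
  intros S P Z; apply quadratic_nonneg_linear_zero with (bil n A y y); intros s.
  pose proof (psd_bil n A (fun i => x i + s * y i) P) as H.
  rewrite bil_lin, !bil_lin_r, Z, (bil_sym n A y x S) in H; lra.
Qed.

Lemma psd_null_mulv n A x i : is_sym n A -> psd n A -> bil n A x x = 0 -> (i < n)%nat ->
  mulv n A x i = 0.
Proof.
  intros S P Z Hi; rewrite <- (dot_kdelta n (mulv n A x)) by auto.
  rewrite <- bil_mulv, bil_sym by auto; apply psd_null; auto.
Qed.

Lemma Un_cv_dot n (u w : nat -> nat -> R) l l' :
  (forall i, (i < n)%nat -> Un_cv (fun m => u m i) (l i)) ->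
  (forall i, (i < n)%nat -> Un_cv (fun m => w m i) (l' i)) ->
  Un_cv (fun m => dot n (u m) (w m)) (dot n l l').
Proof.
  intros C C'; apply (Un_cv_rsum n (fun m i => u m i * w m i) (fun i => l i * l' i)).
  intros; apply (CV_mult (fun m => u m i) (fun m => w m i)); auto.
Qed.

Lemma Un_cv_bil n (A : nat -> Form) A' (u : nat -> nat -> R) l :
  (forall i j, (i < n)%nat -> (j < n)%nat -> Un_cv (fun m => A m i j) (A' i j)) ->
  (forall i, (i < n)%nat -> Un_cv (fun m => u m i) (l i)) ->
  Un_cv (fun m => bil n (A m) (u m) (u m)) (bil n A' l l).
Proof.
  intros C D; apply (Un_cv_rsum n (fun m i => rsum n (fun j => A m i j * u m i * u m j))
    (fun i => rsum n (fun j => A' i j * l i * l j))); intros i Hi.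
  apply (Un_cv_rsum n (fun m j => A m i j * u m i * u m j)
    (fun j => A' i j * l i * l j)); intros j Hj.
  apply (CV_mult (fun m => A m i j * u m i) (fun m => u m j)); auto.
  apply (CV_mult (fun m => A m i j) (fun m => u m i)); auto.
Qed.

Lemma bil_bound n A : exists M, forall x, dot n x x = 1 -> bil n A x x <= M.
Proof.
  exists (rsum n (fun i => rsum n (fun j => Rabs (A i j)))); intros x D.
  apply rsum_le; intros i Hi; apply rsum_le; intros j Hj.
  apply Rle_trans with (Rabs (A i j * x i * x j)); [apply Rle_abs|].
  rewrite !Rabs_mult.
  pose proof (dot_bounds_entry n x i ltac:(lra) Hi).
  pose proof (dot_bounds_entry n x j ltac:(lra) Hj).
  pose proof (Rabs_pos (A i j)); pose proof (Rabs_pos (x i)); pose proof (Rabs_pos (x j)).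
  assert (Rabs (x i) * Rabs (x j) <= 1) by nra.
  nra.
Qed.

Definition orthonormal (n k : nat) (v : nat -> nat -> R) : Prop :=
  forall a b, (a < k)%nat -> (b < k)%nat -> dot n (v a) (v b) = kdelta a b.

Definition proj (k : nat) (v : nat -> nat -> R) : Form :=
  fun i j => rsum k (fun a => v a i * v a j).

Lemma dot_rsum_r n k x (v : nat -> nat -> R) c :
  dot n x (fun i => rsum k (fun a => c a * v a i)) = rsum k (fun a => c a * dot n x (v a)).
Proof.
  unfold dot.
  rewrite (rsum_ext n _ (fun i => rsum k (fun a => x i * (c a * v a i)))).
  2: intros; rewrite rsum_scal_l; reflexivity.
  rewrite rsum_swap; apply rsum_ext; intros; rewrite <- rsum_scal_l; apply rsum_ext; intros; ring.
Qed.

(* The projection has trace [k < n], so it fixes not every [e_i]. *)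
Lemma orthogonal_unit_vector n k v : (k < n)%nat -> orthonormal n k v ->
  exists x, dot n x x = 1 /\ forall a, (a < k)%nat -> dot n (v a) x = 0.
Proof.
  intros Hk O.
  assert (E : exists i, (i < n)%nat /\ proj k v i i <> 1).
  { apply NNPP; intros N.
    assert (T1 : rsum n (fun i => proj k v i i) = INR n * 1).
    { rewrite <- rsum_const; apply rsum_ext; intros i Hi.
      destruct (Req_dec (proj k v i i) 1); auto; exfalso; apply N; exists i; auto. }
    assert (T2 : rsum n (fun i => proj k v i i) = INR k * 1).
    { unfold proj; rewrite rsum_swap, <- rsum_const; apply rsum_ext; intros a Ha.
      specialize (O a a Ha Ha); rewrite kdelta_same in O; exact O. }
    apply lt_INR in Hk; lra. }
  destruct E as [i [Hi Ni]].
  set (y := fun j => kdelta i j + -1 * rsum k (fun a => v a i * v a j)).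
  assert (Y : forall a, (a < k)%nat -> dot n (v a) y = 0).
  { intros a Ha; unfold y; rewrite dot_lin_r, dot_rsum_r, dot_sym, dot_kdelta by auto.
    rewrite (rsum_ext k _ (fun b => v b i * kdelta b a)).
    - rewrite (rsum_delta_r k a (fun b => v b i)) by auto; ring.
    - intros b Hb; rewrite O, (kdelta_sym a b) by auto; ring. }
  assert (P : 0 < dot n y y).
  { destruct (dot_nonneg n y) as [|Z]; auto.
    assert (y i = 0) as Z' by (apply (dot_eq0 n); auto; lra).
    unfold y in Z'; rewrite kdelta_same in Z'; unfold proj in Ni; lra. }
  pose proof (sqrt_lt_R0 _ P) as P'; pose proof (sqrt_sqrt (dot n y y) ltac:(lra)) as SS.
  set (r := sqrt (dot n y y)) in *.
  exists (fun j => / r * y j); split.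
  - rewrite dot_scal_l, dot_sym, dot_scal_l, <- SS; field; lra.
  - intros a Ha; rewrite dot_sym, dot_scal_l, dot_sym, Y by auto; ring.
Qed.

(** The complement [D] is again an orthogonal projection, so the sum of its squared entries is its
    trace, which is [n - n = 0]. *)
Lemma orthonormal_complete n v i j : orthonormal n n v -> (i < n)%nat -> (j < n)%nat ->
  proj n v i j = kdelta i j.
Proof.
  intros O.
  set (D := fun i j => kdelta i j - proj n v i j).
  assert (Z : rsum n (fun i => dot n (D i) (D i)) <= 0).
  { assert (E : forall i, (i < n)%nat -> dot n (D i) (D i) = 1 - proj n v i i).
    { intros k Hk.
      assert (PP : dot n (proj n v k) (proj n v k) = proj n v k k).
      { unfold proj at 2; rewrite (dot_rsum_r n n (proj n v k) v (fun a => v a k)).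
        apply rsum_ext; intros a Ha; rewrite dot_sym; unfold proj.
        rewrite (dot_rsum_r n n (v a) v (fun a => v a k)).
        rewrite (rsum_ext n _ (fun b => v b k * kdelta b a)).
        - rewrite (rsum_delta_r n a (fun b => v b k)) by auto; ring.
        - intros b Hb; rewrite O, (kdelta_sym a b) by auto; ring. }
      assert (X : dot n (D k) (D k) = dot n (kdelta k) (kdelta k)
        - 2 * dot n (kdelta k) (proj n v k) + dot n (proj n v k) (proj n v k)).
      { unfold dot, D; rewrite <- rsum_scal_l, <- rsum_minus, <- rsum_plus.
        apply rsum_ext; intros; ring. }
      rewrite X, PP, !dot_kdelta, kdelta_same by auto; ring. }
    rewrite (rsum_ext n _ _ E), rsum_minus, rsum_const.
    unfold proj; rewrite rsum_swap.
    rewrite (rsum_ext n _ (fun _ => 1)).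
    - rewrite rsum_const; lra.
    - intros a Ha; specialize (O a a Ha Ha); rewrite kdelta_same in O; exact O. }
  intros Hi Hj.
  pose proof (rsum_eq0 n (fun i => dot n (D i) (D i)) i (fun i _ => dot_nonneg n (D i)) Z Hi) as E.
  simpl in E.
  assert (D i j = 0) by (apply (dot_eq0 n); auto; lra).
  unfold D in *; lra.
Qed.

(** The next eigenvector maximises the form on the unit sphere of the orthogonal complement [W] of
    those already found. Symmetry keeps [W] stable under [A], which brings the residual [mu x - A x]
    into [W], where maximality can be tested against it. *)
Lemma partial_eigenbasis n A k : is_sym n A -> (k <= n)%nat ->
  exists v alpha, orthonormal n k v /\
    forall a i, (a < k)%nat -> (i < n)%nat -> mulv n A (v a) i = alpha a * v a i.
Proof.
  intros S; induction k as [|k IH]; intros Hk.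
  - exists (fun _ _ => 0), (fun _ => 0); split; intros a; intros; lia.
  - destruct IH as [v [alpha [O E]]]; [lia|].
    destruct (bil_bound n A) as [M HM].
    set (W := fun x => forall a, (a < k)%nat -> dot n (v a) x = 0).
    destruct (sup_attaining_sequence _ (fun x => dot n x x = 1 /\ W x)
      (fun x => bil n A x x) M) as [u [mu [Hu [Cu Umax]]]].
    { destruct (orthogonal_unit_vector n k v) as [x Hx]; auto; exists x; auto. }
    { intros x [Hx _]; auto. }
    destruct (bolzano_weierstrass_vec n u 1) as [phi [x [I Cx]]].
    { intros m i Hi; apply (dot_bounds_entry n); auto; rewrite (proj1 (Hu m)); lra. }
    assert (Dx : dot n x x = 1).
    { apply UL_sequence with (fun m => dot n (u (phi m)) (u (phi m))).
      - apply Un_cv_dot; auto.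
      - apply Un_cv_ext with (fun _ => 1); [intros; symmetry; apply Hu|apply Un_cv_const]. }
    assert (Wx : W x).
    { intros a Ha.
      apply UL_sequence with (fun m => dot n (v a) (u (phi m))).
      - apply Un_cv_dot; auto; intros; apply Un_cv_const.
      - apply Un_cv_ext with (fun _ => 0); [|apply Un_cv_const].
        intros m; symmetry; apply (proj2 (Hu (phi m))); auto. }
    assert (Qx : bil n A x x = mu).
    { apply UL_sequence with (fun m => bil n A (u (phi m)) (u (phi m))).
      - apply (Un_cv_bil n (fun _ => A)); auto; intros; apply Un_cv_const.
      - apply (Un_cv_subseq (fun m => bil n A (u m) (u m))); auto. }
    assert (Qle : forall y, W y -> bil n A y y <= mu * dot n y y).
    { intros y Wy; destruct (dot_nonneg n y) as [P|Z].
      - pose proof (sqrt_lt_R0 _ P) as P'; pose proof (sqrt_sqrt (dot n y y) ltac:(lra)) as SS.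
        set (r := sqrt (dot n y y)) in *.
        assert (L : bil n A (fun j => / r * y j) (fun j => / r * y j) <= mu).
        { apply (Umax (fun j => / r * y j)); split.
          - rewrite dot_scal_l, dot_sym, dot_scal_l, <- SS; field; lra.
          - intros a Ha; rewrite dot_sym, dot_scal_l, dot_sym, Wy by auto; ring. }
        rewrite bil_scal in L; rewrite <- SS.
        replace (bil n A y y) with (/ r * / r * bil n A y y * (r * r)) by (field; lra).
        apply Rmult_le_compat_r; nra.
      - rewrite <- Z, Rmult_0_r; right; apply rsum_0; intros i Hi; apply rsum_0; intros j Hj.
        rewrite (dot_eq0 n y i) by (auto; lra); ring. }
    set (r := fun i => mu * x i + -1 * mulv n A x i).
    assert (Wr : W r).
    { intros a Ha; unfold r; rewrite dot_lin_r.
      replace (fun i => mu * x i) with (fun i => mu * x i) by reflexivity.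
      rewrite (dot_sym n (v a) (fun i => mu * x i)), dot_scal_l, dot_sym, Wx by auto.
      rewrite <- bil_mulv, bil_sym, bil_mulv by auto.
      replace (dot n x (mulv n A (v a))) with (dot n x (fun i => alpha a * v a i)).
      - rewrite dot_sym, dot_scal_l, Wx by auto; ring.
      - apply rsum_ext; intros; rewrite E; auto. }
    (* Along [x + s r] the function [mu |.|^2 - A (., .)] is nonnegative and vanishes at [s = 0], so
       its linear coefficient, which is [2 |r|^2], is zero. *)
    assert (Rz : dot n r x * mu - bil n A x r = 0).
    { apply quadratic_nonneg_linear_zero with (mu * dot n r r - bil n A r r); intros s.
      assert (Wz : W (fun i => x i + s * r i)).
      { intros a Ha; rewrite dot_lin_r, Wx, Wr by auto; ring. }
      pose proof (Qle _ Wz) as L.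
      rewrite bil_lin, !bil_lin_r, dot_lin, !dot_lin_r, (bil_sym n A r x S), Dx, Qx,
        (dot_sym n x r) in L; lra. }
    assert (Z : dot n r r <= 0).
    { right; rewrite <- Rz, (bil_sym n A x r S), bil_mulv; unfold r at 2.
      rewrite dot_lin_r, (dot_sym n r (fun i => mu * x i)), dot_scal_l, (dot_sym n x r); ring. }
    exists (fun a => if Nat.eqb a k then x else v a), (fun a => if Nat.eqb a k then mu else alpha a).
    split.
    + intros a b Ha Hb; destruct (Nat.eqb_spec a k), (Nat.eqb_spec b k); subst.
      * rewrite kdelta_same; auto.
      * rewrite kdelta_diff by auto; rewrite dot_sym; apply Wx; lia.
      * rewrite kdelta_diff by auto; apply Wx; lia.
      * apply O; lia.
    + intros a i Ha Hi; destruct (Nat.eqb_spec a k).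
      * pose proof (dot_eq0 n r i Z Hi); unfold r in *; lra.
      * apply E; auto; lia.
Qed.

Theorem spectral n A : is_sym n A ->
  exists v alpha, orthonormal n n v /\
    forall i j, (i < n)%nat -> (j < n)%nat -> A i j = rsum n (fun a => alpha a * (v a i * v a j)).
Proof.
  intros S; destruct (partial_eigenbasis n A n S (le_n n)) as [v [alpha [O E]]].
  exists v, alpha; split; auto; intros i j Hi Hj.
  rewrite <- (mulv_kdelta n A i j Hj).
  transitivity (rsum n (fun p => A i p * rsum n (fun a => v a p * v a j))).
  - apply rsum_ext; intros p Hp; rewrite kdelta_sym.
    rewrite <- (orthonormal_complete n v p j O Hp Hj); reflexivity.
  - rewrite (rsum_ext n _ (fun p => rsum n (fun a => v a j * (A i p * v a p)))).
    2: intros; rewrite <- rsum_scal_l; apply rsum_ext; intros; ring.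
    rewrite rsum_swap; apply rsum_ext; intros a Ha.
    rewrite rsum_scal_l; change (rsum n (fun p => A i p * v a p)) with (mulv n A (v a) i).
    rewrite E by auto; ring.
Qed.

Lemma bil_rank_one n v w x y :
  bil n (fun i j => v i * w j) x y = dot n v x * dot n w y.
Proof.
  unfold bil, dot; rewrite rsum_mult; apply rsum_ext2; intros; ring.
Qed.

Lemma bil_form_rsum n k (c : nat -> R) (B : nat -> Form) x y :
  bil n (fun i j => rsum k (fun a => c a * B a i j)) x y = rsum k (fun a => c a * bil n (B a) x y).
Proof.
  induction k as [|k IH]; simpl.
  - apply rsum_0; intros; apply rsum_0; intros; ring.
  - rewrite (bil_form_lin n (fun i j => rsum k (fun a => c a * B a i j)) (B k)), IH; ring.
Qed.

Lemma spectral_psd n A : is_sym n A -> psd n A ->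
  exists v alpha, orthonormal n n v /\ (forall a, (a < n)%nat -> 0 <= alpha a) /\
    forall i j, (i < n)%nat -> (j < n)%nat -> A i j = rsum n (fun a => alpha a * (v a i * v a j)).
Proof.
  intros S P; destruct (spectral n A S) as [v [alpha [O E]]].
  exists v, alpha; repeat split; auto; intros a Ha.
  assert (X : bil n A (v a) (v a) = alpha a).
  { rewrite (bil_form_ext n A _ _ _ E), (bil_form_rsum n n alpha (fun a i j => v a i * v a j)).
    rewrite (rsum_ext n _ (fun b => alpha b * kdelta b a)).
    - apply rsum_delta_r; auto.
    - intros b Hb; rewrite bil_rank_one, !O by auto.
      unfold kdelta; destruct (Nat.eqb b a); ring. }
  rewrite <- X; apply P.
Qed.

Lemma psd_decomposition n A : is_sym n A -> psd n A ->
  exists l : nat -> nat -> R, forall i j, (i < n)%nat -> (j < n)%nat ->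
    A i j = rsum n (fun a => l a i * l a j).
Proof.
  intros S P; destruct (spectral_psd n A S P) as [v [alpha [_ [pos E]]]].
  exists (fun a i => sqrt (alpha a) * v a i); intros i j Hi Hj; rewrite E by auto.
  apply rsum_ext; intros a Ha; rewrite <- (sqrt_sqrt (alpha a)) at 1 by auto; ring.
Qed.

(** Writing [A] as a sum of squares [l_a l_a^T] turns the trace of [A B] into a sum of values of the
    quadratic form [B]. *)
Lemma trace_product_nonneg n A B : is_sym n A -> psd n A -> psd n B ->
  0 <= rsum n (fun i => rsum n (fun j => A i j * B i j)).
Proof.
  intros S P P'; destruct (psd_decomposition n A S P) as [l E].
  replace (rsum n (fun i => rsum n (fun j => A i j * B i j)))
    with (rsum n (fun a => bil n B (l a) (l a))).
  - apply rsum_nonneg; intros; apply P'.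
  - unfold bil; rewrite rsum_swap; apply rsum_ext; intros i Hi.
    rewrite rsum_swap; apply rsum_ext; intros j Hj.
    rewrite E, <- rsum_scal_r by auto; apply rsum_ext; intros; ring.
Qed.

Lemma psd_trace_zero n A i j : is_sym n A -> psd n A -> tr n A = 0 -> (i < n)%nat -> (j < n)%nat ->
  A i j = 0.
Proof.
  intros S P Z Hi Hj.
  assert (D : A j j = 0).
  { apply (rsum_eq0 n (fun i => A i i)); auto; [|unfold tr in Z; lra].
    intros k Hk; rewrite <- (bil_kdelta n A k k) by auto; apply P. }
  rewrite <- (mulv_kdelta n A i j) by auto; apply psd_null_mulv; auto.
  rewrite bil_kdelta; auto.
Qed.

(** The trace inequality for [m n] by [m n] matrices stored as [m^2] blocks. It is applied with
    [m = 4], to the real and imaginary parts of a pair of complex vectors. *)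
Lemma trace_product_nonneg_blocks m n (A B : nat -> nat -> nat -> nat -> R) :
  (forall b c p q, (p < n)%nat -> (q < n)%nat -> A b c p q = A c b q p) ->
  (forall X : nat -> nat -> R, 0 <= rsum m (fun b => rsum m (fun c =>
     rsum n (fun p => rsum n (fun q => A b c p q * X b p * X c q))))) ->
  (forall X : nat -> nat -> R, 0 <= rsum m (fun b => rsum m (fun c =>
     rsum n (fun p => rsum n (fun q => B b c p q * X b p * X c q))))) ->
  0 <= rsum m (fun b => rsum m (fun c =>
     rsum n (fun p => rsum n (fun q => A b c p q * B b c p q)))).
Proof.
  intros S PA PB.
  set (flat := fun (A : nat -> nat -> nat -> nat -> R) i j =>
    A (i / n)%nat (j / n)%nat (i mod n)%nat (j mod n)%nat).
  assert (dm : forall b p, (p < n)%nat -> ((b * n + p) / n = b /\ (b * n + p) mod n = p)%nat).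
  { intros b p Hp; split.
    - rewrite Nat.div_add_l, Nat.div_small; lia.
    - rewrite Nat.add_comm, Nat.Div0.mod_add, Nat.mod_small; lia. }
  assert (sums : forall f : nat -> nat -> R,
    rsum (m * n) (fun i => rsum (m * n) (fun j => f i j)) =
    rsum m (fun b => rsum m (fun c => rsum n (fun p => rsum n (fun q =>
      f (b * n + p)%nat (c * n + q)%nat))))).
  { intros f; rewrite rsum_flatten; apply rsum_ext; intros b Hb.
    rewrite (rsum_ext n _ (fun p => rsum m (fun c => rsum n (fun q =>
      f (b * n + p)%nat (c * n + q)%nat)))) by (intros; apply rsum_flatten).
    apply rsum_swap. }
  assert (psdflat : forall A, (forall X : nat -> nat -> R, 0 <= rsum m (fun b => rsum m (fun c =>
     rsum n (fun p => rsum n (fun q => A b c p q * X b p * X c q))))) -> psd (m * n) (flat A)).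
  { intros A0 P x; rewrite sums.
    specialize (P (fun b p => x (b * n + p)%nat)).
    erewrite rsum_ext; [exact P|]; intros b Hb; apply rsum_ext; intros c Hc.
    apply rsum_ext2; intros p q Hp Hq; unfold flat.
    destruct (dm b p Hp) as [-> ->]; destruct (dm c q Hq) as [-> ->]; reflexivity. }
  assert (H : 0 <= rsum (m * n) (fun i => rsum (m * n) (fun j => flat A i j * flat B i j))).
  { apply trace_product_nonneg; auto.
    intros i j Hi Hj; unfold flat; assert (n <> 0)%nat by (intros ->; lia).
    apply S; apply Nat.mod_upper_bound; auto. }
  rewrite sums in H; erewrite rsum_ext; [exact H|]; intros b Hb; apply rsum_ext; intros c Hc.
  apply rsum_ext2; intros p q Hp Hq; unfold flat.
  destruct (dm b p Hp) as [-> ->]; destruct (dm c q Hq) as [-> ->]; reflexivity.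
Qed.

(** * Tensors as quadrilinear forms *)

Lemma sum4_ext n F G :
  (forall i j k l, (i < n)%nat -> (j < n)%nat -> (k < n)%nat -> (l < n)%nat ->
     F i j k l = G i j k l) -> sum4 n F = sum4 n G.
Proof. intros E; apply rsum_ext2; intros; apply rsum_ext2; intros; auto. Qed.

Lemma sum4_plus n F G :
  sum4 n (fun i j k l => F i j k l + G i j k l) = sum4 n F + sum4 n G.
Proof.
  unfold sum4; rewrite <- rsum_plus; apply rsum_ext; intros.
  rewrite <- rsum_plus; apply rsum_ext; intros.
  rewrite <- rsum_plus; apply rsum_ext; intros; apply rsum_plus.
Qed.

Lemma sum4_scal n c F : sum4 n (fun i j k l => c * F i j k l) = c * sum4 n F.
Proof.
  unfold sum4; rewrite <- rsum_scal_l; apply rsum_ext; intros.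
  rewrite <- rsum_scal_l; apply rsum_ext; intros.
  rewrite <- rsum_scal_l; apply rsum_ext; intros; apply rsum_scal_l.
Qed.

Lemma sum4_nonneg n F :
  (forall i j k l, (i < n)%nat -> (j < n)%nat -> (k < n)%nat -> (l < n)%nat ->
     0 <= F i j k l) -> 0 <= sum4 n F.
Proof. intros E; repeat (apply rsum_nonneg; intros); auto. Qed.

Lemma sum4_ge_term n F i j k l :
  (forall i j k l, (i < n)%nat -> (j < n)%nat -> (k < n)%nat -> (l < n)%nat ->
     0 <= F i j k l) -> (i < n)%nat -> (j < n)%nat -> (k < n)%nat -> (l < n)%nat ->
  F i j k l <= sum4 n F.
Proof.
  intros E Hi Hj Hk Hl; unfold sum4.
  eapply Rle_trans; [|apply (rsum_ge_term n (fun i => rsum n (fun j => rsum n (fun k =>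
    rsum n (fun l => F i j k l)))) i); auto; intros; repeat (apply rsum_nonneg; intros); auto].
  eapply Rle_trans; [|apply (rsum_ge_term n (fun j => rsum n (fun k =>
    rsum n (fun l => F i j k l))) j); auto; intros; repeat (apply rsum_nonneg; intros); auto].
  eapply Rle_trans; [|apply (rsum_ge_term n (fun k => rsum n (fun l => F i j k l)) k); auto;
    intros; repeat (apply rsum_nonneg; intros); auto].
  apply (rsum_ge_term n (fun l => F i j k l)); auto.
Qed.

Lemma sum4_le n F G :
  (forall i j k l, (i < n)%nat -> (j < n)%nat -> (k < n)%nat -> (l < n)%nat ->
     F i j k l <= G i j k l) -> sum4 n F <= sum4 n G.
Proof. intros E; repeat (apply rsum_le; intros); auto. Qed.

Lemma sum4_rsum n (F : nat -> nat -> nat -> nat -> nat -> R) m :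
  sum4 n (fun i j k l => rsum m (fun p => F i j k l p)) =
  rsum m (fun p => sum4 n (fun i j k l => F i j k l p)).
Proof.
  symmetry; unfold sum4; rewrite (rsum_swap m n); apply rsum_ext; intros.
  rewrite (rsum_swap m n); apply rsum_ext; intros.
  rewrite (rsum_swap m n); apply rsum_ext; intros; apply rsum_swap.
Qed.

Lemma sum4_prod_12_34 n X Y : sum4 n (fun i j k l => X i j * Y k l) =
  rsum n (fun i => rsum n (fun j => X i j)) * rsum n (fun i => rsum n (fun j => Y i j)).
Proof.
  unfold sum4; rewrite <- rsum_scal_r; apply rsum_ext; intros.
  rewrite <- rsum_scal_r; apply rsum_ext; intros.
  rewrite <- rsum_scal_l; apply rsum_ext; intros; apply rsum_scal_l.
Qed.

Lemma sum4_swap23 n F : sum4 n F = sum4 n (fun i j k l => F i k j l).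
Proof. unfold sum4; apply rsum_ext; intros; apply rsum_swap. Qed.

Lemma sum4_swap34 n F : sum4 n F = sum4 n (fun i j k l => F i j l k).
Proof. unfold sum4; apply rsum_ext2; intros; apply rsum_swap. Qed.

Lemma sum4_swap12 n F : sum4 n F = sum4 n (fun i j k l => F j i k l).
Proof. unfold sum4; apply rsum_swap. Qed.

Definition ev (n : nat) (T : Tensor) (a b c d : nat -> R) : R :=
  sum4 n (fun i j k l => T i j k l * (a i * b j * c k * d l)).

Lemma ev_tensor_lin n T T' s a b c d :
  ev n (fun i j k l => T i j k l + s * T' i j k l) a b c d = ev n T a b c d + s * ev n T' a b c d.
Proof.
  unfold ev; rewrite <- sum4_scal, <- sum4_plus; apply sum4_ext; intros; ring.
Qed.

Lemma ev_lin1 n T s a a' b c d :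
  ev n T (fun i => a i + s * a' i) b c d = ev n T a b c d + s * ev n T a' b c d.
Proof. unfold ev; rewrite <- sum4_scal, <- sum4_plus; apply sum4_ext; intros; ring. Qed.

Lemma ev_lin2 n T s a a' b c d :
  ev n T b (fun i => a i + s * a' i) c d = ev n T b a c d + s * ev n T b a' c d.
Proof. unfold ev; rewrite <- sum4_scal, <- sum4_plus; apply sum4_ext; intros; ring. Qed.

Lemma ev_lin3 n T s a a' b c d :
  ev n T b c (fun i => a i + s * a' i) d = ev n T b c a d + s * ev n T b c a' d.
Proof. unfold ev; rewrite <- sum4_scal, <- sum4_plus; apply sum4_ext; intros; ring. Qed.

Lemma ev_lin4 n T s a a' b c d :
  ev n T b c d (fun i => a i + s * a' i) = ev n T b c d a + s * ev n T b c d a'.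
Proof. unfold ev; rewrite <- sum4_scal, <- sum4_plus; apply sum4_ext; intros; ring. Qed.

Lemma act_anti12 n T i j k l : is_act n T ->
  (i < n)%nat -> (j < n)%nat -> (k < n)%nat -> (l < n)%nat -> T i j k l = - T j i k l.
Proof. intros A; intros; apply A; auto. Qed.

Lemma act_pair n T i j k l : is_act n T ->
  (i < n)%nat -> (j < n)%nat -> (k < n)%nat -> (l < n)%nat -> T i j k l = T k l i j.
Proof. intros A; intros; apply A; auto. Qed.

Lemma act_anti34 n T i j k l : is_act n T ->
  (i < n)%nat -> (j < n)%nat -> (k < n)%nat -> (l < n)%nat -> T i j k l = - T i j l k.
Proof.
  intros A Hi Hj Hk Hl.
  rewrite (act_pair n T i j k l), (act_anti12 n T k l i j), (act_pair n T l k i j); auto.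
Qed.

Lemma act_bianchi n T i j k l : is_act n T ->
  (i < n)%nat -> (j < n)%nat -> (k < n)%nat -> (l < n)%nat ->
  T i j k l + T j k i l + T k i j l = 0.
Proof. intros A; intros; apply A; auto. Qed.

Lemma ev_anti12 n T a b c d : is_act n T -> ev n T a b c d = - ev n T b a c d.
Proof.
  intros A; unfold ev; rewrite sum4_swap12.
  replace (- sum4 n _) with ((-1) * sum4 n (fun i j k l => T i j k l * (b i * a j * c k * d l)))
    by ring.
  rewrite <- sum4_scal; apply sum4_ext; intros i j k l Hi Hj Hk Hl.
  rewrite (act_anti12 n T j i k l A) by auto; ring.
Qed.

Lemma ev_pair n T a b c d : is_act n T -> ev n T a b c d = ev n T c d a b.
Proof.
  intros A; unfold ev.
  rewrite sum4_swap23, sum4_swap12, sum4_swap34, sum4_swap23.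
  apply sum4_ext; intros i j k l Hi Hj Hk Hl.
  rewrite (act_pair n T k l i j A) by auto; ring.
Qed.

Lemma ev_anti34 n T a b c d : is_act n T -> ev n T a b c d = - ev n T a b d c.
Proof.
  intros A; rewrite (ev_pair n T a b c d), ev_anti12, (ev_pair n T d c a b) by auto; ring.
Qed.

Lemma ev_kdelta n T i j k l : (i < n)%nat -> (j < n)%nat -> (k < n)%nat -> (l < n)%nat ->
  ev n T (kdelta i) (kdelta j) (kdelta k) (kdelta l) = T i j k l.
Proof.
  intros Hi Hj Hk Hl; unfold ev, sum4.
  transitivity (rsum n (fun i' => kdelta i i' * rsum n (fun j' => kdelta j j' *
    rsum n (fun k' => kdelta k k' * rsum n (fun l' => kdelta l l' * T i' j' k' l'))))).
  - apply rsum_ext; intros; rewrite <- rsum_scal_l; apply rsum_ext; intros.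
    rewrite <- !rsum_scal_l; apply rsum_ext; intros.
    rewrite <- !rsum_scal_l; apply rsum_ext; intros; ring.
  - rewrite !rsum_delta_l; auto.
Qed.

(* The real part of [T (x + i y, u + i v, conj (x' + i y'), conj (u' + i v'))]. *)
Definition cev (n : nat) (T : Tensor) (x y u v x' y' u' v' : nat -> R) : R :=
  ev n T x u x' u' + ev n T x v x' v' + ev n T y u y' u' + ev n T y v y' v'
  - ev n T y v x' u' + ev n T y u x' v' + ev n T x v y' u' - ev n T x u y' v'.

Lemma pic2_re_cev n T x y u v : pic2_re n T x y u v = cev n T x y u v x y u v.
Proof.
  unfold cev, ev, pic2_re, Rminus.
  assert (N : forall r, - r = -1 * r) by (intros; ring).
  rewrite !N, <- !sum4_scal, <- !sum4_plus; apply sum4_ext; intros; ring.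
Qed.

(** Exchanging the pairs [(i, j)] and [(k, l)] fixes the tensor and reverses the sign of the
    imaginary weight. *)
Lemma pic2_im_act n T x y u v : is_act n T -> pic2_im n T x y u v = 0.
Proof.
  intros A.
  assert (E : pic2_im n T x y u v = - pic2_im n T x y u v); [|lra].
  unfold pic2_im at 1.
  rewrite sum4_swap23, sum4_swap12, sum4_swap34, sum4_swap23.
  unfold pic2_im; match goal with |- _ = - ?s => replace (- s) with (-1 * s) by ring end.
  rewrite <- sum4_scal; apply sum4_ext; intros i j k l Hi Hj Hk Hl.
  rewrite (act_pair n T k l i j A) by auto; ring.
Qed.

Lemma pic2_re_lin n T T' s x y u v :
  pic2_re n (fun i j k l => T i j k l + s * T' i j k l) x y u v =
  pic2_re n T x y u v + s * pic2_re n T' x y u v.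
Proof. rewrite !pic2_re_cev; unfold cev; rewrite !ev_tensor_lin; ring. Qed.

Lemma pic2_re_ext n T T' x y u v : teq n T T' -> pic2_re n T x y u v = pic2_re n T' x y u v.
Proof. intros E; apply sum4_ext; intros; rewrite E; auto. Qed.

(** * Null vectors of the PIC2 cone *)

Definition m12 (n : nat) (T : Tensor) (a b : nat -> R) (p q : nat) : R :=
  rsum n (fun i => rsum n (fun j => T i j p q * a i * b j)).

Definition m13 (n : nat) (T : Tensor) (a c : nat -> R) (p q : nat) : R :=
  rsum n (fun i => rsum n (fun k => T i p k q * a i * c k)).

Lemma m13_sym n T a c p q : is_act n T -> (p < n)%nat -> (q < n)%nat ->
  m13 n T a c p q = m13 n T c a q p.
Proof.
  intros A Hp Hq; unfold m13; rewrite rsum_swap; apply rsum_ext2; intros i j Hi Hj.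
  rewrite (act_pair n T j p i q A) by auto; ring.
Qed.

Lemma ev_m13 n T a b c d :
  ev n T a b c d = rsum n (fun p => rsum n (fun q => m13 n T a c p q * b p * d q)).
Proof.
  unfold ev; rewrite sum4_swap12, sum4_swap34, sum4_swap23; unfold sum4; apply rsum_ext2; intros p q Hp Hq.
  unfold m13; rewrite Rmult_assoc, <- rsum_scal_r; apply rsum_ext; intros.
  rewrite <- rsum_scal_r; apply rsum_ext; intros; ring.
Qed.

Lemma ev_Q n T a b c d : ev n (Qop n T) a b c d =
  rsum n (fun p => rsum n (fun q => m12 n T a b p q * m12 n T c d p q
    + 2 * (m13 n T a c p q * m13 n T b d p q) - 2 * (m13 n T a d p q * m13 n T b c p q))).
Proof.
  transitivity (sum4 n (fun i j k l => rsum n (fun p => rsum n (fun q =>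
     (T i j p q * a i * b j) * (T k l p q * c k * d l)
     + (2 * ((T i p k q * a i * c k) * (T j p l q * b j * d l))
     + (-2) * ((T i p l q * a i * d l) * (T j p k q * b j * c k))))))).
  - apply sum4_ext; intros i j k l Hi Hj Hk Hl; unfold Qop, Bop.
    rewrite <- rsum_scal_l, <- rsum_plus, <- rsum_scal_r; apply rsum_ext; intros p Hp.
    rewrite <- rsum_scal_l, <- rsum_plus, <- rsum_scal_r; apply rsum_ext; intros q Hq.
    field.
  - rewrite sum4_rsum; apply rsum_ext; intros p Hp.
    rewrite sum4_rsum; apply rsum_ext; intros q Hq.
    rewrite !sum4_plus, !sum4_scal.
    rewrite (sum4_prod_12_34 n (fun i j => T i j p q * a i * b j)
       (fun k l => T k l p q * c k * d l)).
    rewrite sum4_swap23.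
    rewrite (sum4_prod_12_34 n (fun i k => T i p k q * a i * c k)
       (fun j l => T j p l q * b j * d l)).
    rewrite (sum4_swap34 n (fun i j k l => T i p l q * a i * d l * (T j p k q * b j * c k))).
    rewrite (sum4_swap23 n (fun i j k l => T i p k q * a i * d k * (T j p l q * b j * c l))).
    rewrite (sum4_prod_12_34 n (fun i l => T i p l q * a i * d l)
       (fun j k => T j p k q * b j * c k)).
    fold (m12 n T a b p q) (m12 n T c d p q) (m13 n T a c p q) (m13 n T b d p q)
      (m13 n T a d p q) (m13 n T b c p q); ring.
Qed.

Lemma quartic_nonneg_quadratic_nonneg M K : (forall s, 0 <= s * s * M + s * s * s * s * K) -> 0 <= M.
Proof.
  intros H; apply Rnot_lt_le; intros L.
  pose proof (Rabs_pos K); pose proof (Rle_abs K).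
  (* [s2] stands for [s^2], small enough that the quartic term recovers at most half of [M]. *)
  set (s2 := - M / (2 * (Rabs K + 1))).
  assert (E : s2 * (Rabs K + 1) = - M / 2) by (unfold s2; field; lra).
  assert (P : 0 < s2) by (apply Rdiv_lt_0_compat; lra).
  specialize (H (sqrt s2)).
  replace (sqrt s2 * sqrt s2 * sqrt s2 * sqrt s2 * K)
    with ((sqrt s2 * sqrt s2) * (sqrt s2 * sqrt s2) * K) in H by ring.
  rewrite sqrt_sqrt in H by lra.
  assert (s2 * K <= - M / 2) by nra.
  assert (s2 * (M + s2 * K) < 0); [|lra].
  apply Ropp_lt_cancel; rewrite Ropp_0, <- Ropp_mult_distr_r_reverse.
  apply Rmult_lt_0_compat; lra.
Qed.

(* Adding the values at [(zeta, eta)], [-(zeta, eta)] and [+-i (zeta, eta)] cancels the terms of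
   odd order and the term [Re T (zeta, eta, conj z, conj w)]. *)
Lemma second_variation n T x y u v f g h k :
  (forall x y u v, 0 <= pic2_re n T x y u v) -> pic2_re n T x y u v = 0 ->
  0 <= cev n T f g u v f g u v + cev n T x y h k x y h k
       + cev n T f g u v x y h k + cev n T x y h k f g u v.
Proof.
  intros P Z; apply (quartic_nonneg_quadratic_nonneg _ (cev n T f g h k f g h k)); intros s.
  pose proof (P (fun i => x i + s * f i) (fun i => y i + s * g i)
    (fun i => u i + s * h i) (fun i => v i + s * k i)) as P1.
  pose proof (P (fun i => x i + - s * f i) (fun i => y i + - s * g i)
    (fun i => u i + - s * h i) (fun i => v i + - s * k i)) as P2.
  pose proof (P (fun i => x i + - s * g i) (fun i => y i + s * f i)
    (fun i => u i + - s * k i) (fun i => v i + s * h i)) as P3.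
  pose proof (P (fun i => x i + s * g i) (fun i => y i + - s * f i)
    (fun i => u i + s * k i) (fun i => v i + - s * h i)) as P4.
  rewrite pic2_re_cev in *; unfold cev in *.
  repeat rewrite ?ev_lin1, ?ev_lin2, ?ev_lin3, ?ev_lin4 in P1.
  repeat rewrite ?ev_lin1, ?ev_lin2, ?ev_lin3, ?ev_lin4 in P2.
  repeat rewrite ?ev_lin1, ?ev_lin2, ?ev_lin3, ?ev_lin4 in P3.
  repeat rewrite ?ev_lin1, ?ev_lin2, ?ev_lin3, ?ev_lin4 in P4.
  match type of P1 with 0 <= ?a => match type of P2 with 0 <= ?b =>
  match type of P3 with 0 <= ?c => match type of P4 with 0 <= ?d =>
  match type of Z with ?z = 0 => match goal with |- 0 <= ?e =>
    assert (E : a + b + c + d = 4 * z + 4 * e) by ring end end end end end end.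
  lra.
Qed.

(* Blocks of the real form of a Hermitian matrix, in the coordinates
   [zeta = X 0 + i X 1], [eta = X 2 + i X 3]. *)
Definition hblock (a a' d d' c ct c' ct' : Form) (b b' : nat) : Form :=
  match b, b' with
  | 0%nat, 0%nat | 1%nat, 1%nat => a
  | 0%nat, 1%nat => a'
  | 1%nat, 0%nat => fun p q => - a' p q
  | 2%nat, 2%nat | 3%nat, 3%nat => d
  | 2%nat, 3%nat => d'
  | 3%nat, 2%nat => fun p q => - d' p q
  | 0%nat, 2%nat | 1%nat, 3%nat => fun p q => - ct p q
  | 2%nat, 0%nat | 3%nat, 1%nat => fun p q => - c p q
  | 1%nat, 2%nat => fun p q => - ct' p q
  | 0%nat, 3%nat => ct'
  | 2%nat, 1%nat => fun p q => - c' p q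
  | 3%nat, 0%nat => c'
  | _, _ => fun _ _ => 0
  end.

(** Moves the block sums inside, so that identities between block forms can be checked by [ring] at
    each [(p, q)]. *)
Lemma rsum4_collect n (F : nat -> nat -> nat -> nat -> R) :
  rsum 4 (fun b => rsum 4 (fun b' => rsum n (fun p => rsum n (fun q => F b b' p q)))) =
  rsum n (fun p => rsum n (fun q => rsum 4 (fun b => rsum 4 (fun b' => F b b' p q)))).
Proof.
  transitivity (rsum 4 (fun b => rsum n (fun p => rsum 4 (fun b' => rsum n (fun q => F b b' p q))))).
  { apply rsum_ext; intros; apply rsum_swap. }
  rewrite rsum_swap; apply rsum_ext; intros p Hp.
  transitivity (rsum 4 (fun b => rsum n (fun q => rsum 4 (fun b' => F b b' p q)))).
  { apply rsum_ext; intros; apply rsum_swap. }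
  apply rsum_swap.
Qed.

(** The first sum of [Qop] contributes the squared moduli of [T (z, w, e_p, e_q)] for [z = x + i y]
    and [w = u + i v]. What remains is quadratic in the blocks of the form that the second variation
    shows to be nonnegative, and is recognised as the trace of a product of two nonnegative
    matrices. *)
Theorem Q_nonneg_at_null n T x y u v : PIC2 n T -> pic2_re n T x y u v = 0 ->
  0 <= pic2_re n (Qop n T) x y u v.
Proof.
  intros [A P0] Z.
  assert (P : forall x y u v, 0 <= pic2_re n T x y u v) by (intros; apply P0).
  set (m := m13 n T).
  set (a := fun p q => m u u p q + m v v p q).
  set (a' := fun p q => m v u p q - m u v p q).
  set (d := fun p q => m x x p q + m y y p q).
  set (d' := fun p q => m y x p q - m x y p q).
  set (c := fun p q => m x u p q + m y v p q).
  set (ct := fun p q => m u x p q + m v y p q).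
  set (c' := fun p q => m y u p q - m x v p q).
  set (ct' := fun p q => m u y p q - m v x p q).
  set (M := hblock a a' d d' c ct c' ct').
  (* [N] is [M] composed with [(zeta, eta) -> (conj eta, - conj zeta)]; the trace of [M N] is twice
     the part of [pic2_re n (Qop n T)] that is not visibly a sum of squares. *)
  set (N := hblock d (fun p q => - d' p q) a (fun p q => - a' p q)
              (fun p q => - ct p q) (fun p q => - c p q)
              (fun p q => - ct' p q) (fun p q => - c' p q)).
  assert (quad : forall X : nat -> nat -> R,
    rsum 4 (fun b => rsum 4 (fun b' => rsum n (fun p => rsum n (fun q =>
      M b b' p q * X b p * X b' q)))) =
    cev n T (X 0%nat) (X 1%nat) u v (X 0%nat) (X 1%nat) u v
    + cev n T x y (X 2%nat) (X 3%nat) x y (X 2%nat) (X 3%nat)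
    + cev n T (X 0%nat) (X 1%nat) u v x y (X 2%nat) (X 3%nat)
    + cev n T x y (X 2%nat) (X 3%nat) (X 0%nat) (X 1%nat) u v).
  { intros X; rewrite rsum4_collect.
    (* The antisymmetries move the varied vectors into the second and fourth slots, which are those
       left open by [m13]. *)
    assert (flip : forall w z w' z', ev n T w z w' z' = ev n T z w z' w').
    { intros; rewrite ev_anti12, ev_anti34 by auto; ring. }
    set (f := X 0%nat); set (g := X 1%nat); set (h := X 2%nat); set (k := X 3%nat).
    unfold cev.
    rewrite (flip f u f u), (flip f v f v), (flip g u g u), (flip g v g v),
      (flip g v f u), (flip g u f v), (flip f v g u), (flip f u g v).
    rewrite (ev_anti12 n T f u x h), (ev_anti12 n T f v x k), (ev_anti12 n T g u y h),
      (ev_anti12 n T g v y k), (ev_anti12 n T g v x h), (ev_anti12 n T g u x k),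
      (ev_anti12 n T f v y h), (ev_anti12 n T f u y k) by auto.
    rewrite (ev_anti34 n T x h f u), (ev_anti34 n T x k f v), (ev_anti34 n T y h g u),
      (ev_anti34 n T y k g v), (ev_anti34 n T y k f u), (ev_anti34 n T y h f v),
      (ev_anti34 n T x k g u), (ev_anti34 n T x h g v) by auto.
    rewrite !ev_m13; unfold Rminus.
    repeat rewrite <- ?rsum_opp, <- ?rsum_plus.
    apply rsum_ext; intros p Hp.
    repeat rewrite <- ?rsum_opp, <- ?rsum_plus.
    apply rsum_ext; intros q Hq; fold m; simpl; unfold M, hblock.
    unfold a, a', d, d', c, ct, c', ct'; fold f g h k; ring. }
  assert (PM : forall X : nat -> nat -> R, 0 <= rsum 4 (fun b => rsum 4 (fun b' =>
     rsum n (fun p => rsum n (fun q => M b b' p q * X b p * X b' q))))).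
  { intros X; rewrite quad; apply second_variation; auto. }
  assert (PN : forall X : nat -> nat -> R, 0 <= rsum 4 (fun b => rsum 4 (fun b' =>
     rsum n (fun p => rsum n (fun q => N b b' p q * X b p * X b' q))))).
  { intros X.
    specialize (PM (fun b p => match b with
      | 0%nat => X 2%nat p | 1%nat => - X 3%nat p | 2%nat => - X 0%nat p | _ => X 1%nat p end)).
    erewrite rsum4_collect, rsum_ext2; [rewrite rsum4_collect in PM; exact PM|].
    intros p q Hp Hq; simpl; unfold M, N, hblock; ring. }
  pose proof (trace_product_nonneg_blocks 4 n M N) as H.
  assert (SM : forall b b' p q, (p < n)%nat -> (q < n)%nat -> M b b' p q = M b' b q p).
  { assert (ms : forall w z p q, (p < n)%nat -> (q < n)%nat -> m w z p q = m z w q p).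
    { intros; apply m13_sym; auto. }
    intros b b' p q Hp Hq; unfold M, hblock, a, a', d, d', c, ct, c', ct'.
    destruct b as [|[|[|[|b]]]], b' as [|[|[|[|b']]]]; try reflexivity;
      rewrite !(ms _ _ p q) by auto; ring. }
  specialize (H SM PM PN); rewrite rsum4_collect in H.
  rewrite pic2_re_cev; unfold cev; rewrite !ev_Q; fold m.
  match goal with |- 0 <= ?e => replace e with
    (rsum n (fun p => rsum n (fun q =>
      (m12 n T x u p q - m12 n T y v p q) ^ 2 + (m12 n T x v p q + m12 n T y u p q) ^ 2))
     + / 2 * rsum n (fun p => rsum n (fun q => rsum 4 (fun b => rsum 4 (fun b' =>
        M b b' p q * N b b' p q))))) end.
  - apply Rplus_le_le_0_compat; [|lra].
    apply rsum_nonneg; intros; apply rsum_nonneg; intros.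
    apply Rplus_le_le_0_compat; apply pow2_ge_0.
  - unfold Rminus; rewrite <- !rsum_scal_l.
    repeat rewrite <- ?rsum_opp, <- ?rsum_plus.
    apply rsum_ext; intros p Hp; rewrite <- !rsum_scal_l.
    repeat rewrite <- ?rsum_opp, <- ?rsum_plus.
    apply rsum_ext; intros q Hq; simpl; unfold M, N, hblock, a, a', d, d', c, ct, c', ct'; field.
Qed.

(** * The algebra of the quadratic map [Q] *)

Lemma act_lin n T T' s : is_act n T -> is_act n T' ->
  is_act n (fun i j k l => T i j k l + s * T' i j k l).
Proof.
  intros A A' i j k l Hi Hj Hk Hl.
  destruct (A i j k l Hi Hj Hk Hl) as [E1 [E2 E3]].
  destruct (A' i j k l Hi Hj Hk Hl) as [F1 [F2 F3]].
  rewrite <- E2, <- F2; repeat split; [rewrite E1, F1; ring|].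
  replace (T j k i l) with (- T i j k l - T k i j l) by lra.
  replace (T' j k i l) with (- T' i j k l - T' k i j l) by lra; ring.
Qed.

Lemma act_ext n T T' : teq n T T' -> is_act n T -> is_act n T'.
Proof.
  intros E A i j k l Hi Hj Hk Hl; rewrite <- !E by auto; apply A; auto.
Qed.

Lemma idf_sym n : is_sym n idf.
Proof. intros i j _ _; apply kdelta_sym. Qed.

Lemma act_kn n A B : is_sym n A -> is_sym n B -> is_act n (kn A B).
Proof.
  intros SA SB i j k l Hi Hj Hk Hl; unfold kn.
  rewrite (SA k i), (SA k j), (SA l i), (SA l j), (SA k l), (SA j i),
    (SB k i), (SB k j), (SB l i), (SB l j), (SB k l), (SB j i) by auto.
  repeat split; ring.
Qed.

(** The form [T * H] of the overview. *)
Definition cstar (n : nat) (T : Tensor) (H : Form) : Form :=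
  fun i k => rsum n (fun p => rsum n (fun q => T i p k q * H p q)).

Definition sq (n : nat) (A : Form) : Form := fun i k => rsum n (fun p => A i p * A p k).

Definition nrm2 (n : nat) (A : Form) : R := rsum n (fun p => rsum n (fun q => A p q * A p q)).

Lemma Ric_sym n T : is_act n T -> is_sym n (Ric n T).
Proof. intros A i k Hi Hk; apply rsum_ext; intros; apply (act_pair n); auto. Qed.

Lemma cstar_sym n T H : is_act n T -> is_sym n H -> is_sym n (cstar n T H).
Proof.
  intros A S i k Hi Hk; unfold cstar; rewrite rsum_swap; apply rsum_ext2; intros p q Hp Hq.
  rewrite (S p q), (act_pair n T i q k p) by auto; reflexivity.
Qed.

Lemma sq_sym n A : is_sym n A -> is_sym n (sq n A).
Proof.
  intros S i k Hi Hk; apply rsum_ext; intros p Hp; rewrite (S i p), (S p k) by auto; ring.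
Qed.

Lemma tr_sq n A : is_sym n A -> tr n (sq n A) = nrm2 n A.
Proof.
  intros S; unfold tr, sq, nrm2; apply rsum_ext2; intros p q Hp Hq; rewrite (S q p); auto.
Qed.

Lemma contract_kn_34 n X H k l : (k < n)%nat -> (l < n)%nat ->
  rsum n (fun p => rsum n (fun q => X p q * kn H idf k l p q)) =
  rsum n (fun p => X p l * H k p - X l p * H k p - X p k * H l p + X k p * H l p).
Proof.
  intros Hk Hl.
  transitivity (
    rsum n (fun p => rsum n (fun q => kdelta l q * (X p q * H k p)))
    - rsum n (fun q => rsum n (fun p => kdelta l p * (X p q * H k q)))
    - rsum n (fun p => rsum n (fun q => kdelta k q * (X p q * H l p)))
    + rsum n (fun q => rsum n (fun p => kdelta k p * (X p q * H l q)))).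
  - rewrite (rsum_swap n n (fun q p => kdelta l p * (X p q * H k q))).
    rewrite (rsum_swap n n (fun q p => kdelta k p * (X p q * H l q))).
    repeat rewrite <- ?rsum_minus, <- ?rsum_plus; apply rsum_ext; intros.
    repeat rewrite <- ?rsum_minus, <- ?rsum_plus; apply rsum_ext; intros.
    unfold kn, idf; ring.
  - repeat rewrite <- ?rsum_minus, <- ?rsum_plus; apply rsum_ext; intros p Hp.
    rewrite !rsum_delta_l by auto; ring.
Qed.

Lemma contract_kn_24 n X H j l : is_sym n H -> (j < n)%nat -> (l < n)%nat ->
  rsum n (fun p => rsum n (fun q => X p q * kn H idf j p l q)) =
  H j l * rsum n (fun p => X p p) + kdelta j l * rsum n (fun p => rsum n (fun q => X p q * H p q))
  - rsum n (fun p => X l p * H j p + X p j * H l p).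
Proof.
  intros S Hj Hl.
  transitivity (
    rsum n (fun p => rsum n (fun q => kdelta p q * (X p q * H j l)))
    + rsum n (fun p => rsum n (fun q => kdelta j l * (X p q * H p q)))
    - (rsum n (fun q => rsum n (fun p => kdelta l p * (X p q * H j q)))
    + rsum n (fun p => rsum n (fun q => kdelta j q * (X p q * H l p))))).
  - rewrite (rsum_swap n n (fun q p => kdelta l p * (X p q * H j q))).
    repeat rewrite <- ?rsum_minus, <- ?rsum_plus; apply rsum_ext; intros p Hp.
    repeat rewrite <- ?rsum_minus, <- ?rsum_plus; apply rsum_ext; intros q Hq.
    rewrite (kdelta_sym l p), (S l p) by auto; unfold kn, idf; ring.
  - rewrite (rsum_plus n (fun p => X l p * H j p)), <- !rsum_scal_l; f_equal; f_equal.
    + apply rsum_ext; intros; rewrite rsum_delta_l by auto; ring.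
    + apply rsum_ext; intros; apply rsum_scal_l.
    + apply rsum_ext; intros; rewrite rsum_delta_l by auto; ring.
    + apply rsum_ext; intros; rewrite rsum_delta_l by auto; ring.
Qed.

(** The contractions over the second and fourth slots produce [Ric T] and [T * H]. All other terms
    carry [T] with a single index contracted against [H], and cancel in groups of three by Bianchi's
    identity. *)
Lemma Bop_kn n T H i j k l : is_act n T -> is_sym n H ->
  (i < n)%nat -> (j < n)%nat -> (k < n)%nat -> (l < n)%nat ->
  Bop n T (kn H idf) i j k l = kn (Ric n T) H i j k l + kn (cstar n T H) idf i j k l.
Proof.
  intros A S Hi Hj Hk Hl; unfold Bop.
  transitivity (
    / 2 * (rsum n (fun p => rsum n (fun q => T i j p q * kn H idf k l p q))
         + rsum n (fun p => rsum n (fun q => T k l p q * kn H idf i j p q)))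
    + (rsum n (fun p => rsum n (fun q => T i p k q * kn H idf j p l q))
    - rsum n (fun p => rsum n (fun q => T i p l q * kn H idf j p k q))
    - rsum n (fun p => rsum n (fun q => T j p k q * kn H idf i p l q))
    + rsum n (fun p => rsum n (fun q => T j p l q * kn H idf i p k q)))).
  { repeat rewrite <- ?rsum_minus, <- ?rsum_plus; f_equal; [f_equal|].
    - apply rsum_ext; intros; rewrite <- rsum_plus; reflexivity.
    - apply rsum_ext; intros; repeat rewrite <- ?rsum_minus, <- ?rsum_plus; reflexivity. }
  rewrite (contract_kn_34 n (fun p q => T i j p q)), (contract_kn_34 n (fun p q => T k l p q)),
    (contract_kn_24 n (fun p q => T i p k q)), (contract_kn_24 n (fun p q => T i p l q)),
    (contract_kn_24 n (fun p q => T j p k q)), (contract_kn_24 n (fun p q => T j p l q)) by auto.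
  fold (Ric n T i k) (Ric n T i l) (Ric n T j k) (Ric n T j l)
    (cstar n T H i k) (cstar n T H i l) (cstar n T H j k) (cstar n T H j l).
  match goal with |- / 2 * (?a + ?b) + (_ - ?c - (_ - ?d) - (_ - ?e) + (_ - ?f)) = _ =>
    assert (Z : / 2 * (a + b) - c + d + e - f = 0) end.
  { rewrite <- rsum_plus, <- rsum_scal_l.
    repeat rewrite <- ?rsum_minus, <- ?rsum_plus; apply rsum_0; intros p Hp.
    transitivity ((T k l i p - T i l k p + T i k l p) * H j p
      + (T j l k p - T k l j p - T j k l p) * H i p
      + (T i j k p - T i p k j + T j p k i) * H l p
      + (T i p l j - T i j l p - T j p l i) * H k p).
    - rewrite (act_anti34 n T i j p l), (act_anti34 n T i j p k), (act_anti34 n T k l p i),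
        (act_anti34 n T k l p j) by auto; field.
    - rewrite (act_anti12 n T i l k p), (act_anti12 n T j l k p),
        (act_pair n T i p k j), (act_pair n T j p k i), (act_pair n T i p l j),
        (act_pair n T j p l i), (act_anti12 n T k j i p), (act_anti12 n T l j i p) by auto.
      pose proof (act_bianchi n T i k l p A Hi Hk Hl Hp).
      pose proof (act_bianchi n T j k l p A Hj Hk Hl Hp).
      pose proof (act_bianchi n T i j k p A Hi Hj Hk Hp).
      pose proof (act_bianchi n T i j l p A Hi Hj Hl Hp).
      replace (T k l i p - - T l i k p + T i k l p) with 0 by lra.
      replace (- T l j k p - T k l j p - T j k l p) with 0 by lra.
      replace (T i j k p - - T j k i p + T k i j p) with 0 by lra.
      replace (- T j l i p - T i j l p - T l i j p) with 0 by lra.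
      ring. }
  unfold kn, idf; lra.
Qed.

Lemma Bop_ext n S S' T T' : teq n S S' -> teq n T T' -> teq n (Bop n S T) (Bop n S' T').
Proof.
  intros E E' i j k l Hi Hj Hk Hl; unfold Bop; f_equal; [f_equal|]; apply rsum_ext2;
    intros; rewrite !E, !E' by auto; reflexivity.
Qed.

Lemma Qop_ext n T T' : teq n T T' -> teq n (Qop n T) (Qop n T').
Proof. intros E; apply Bop_ext; auto. Qed.

Lemma Qop_plus n S T i j k l :
  Qop n (fun i j k l => S i j k l + T i j k l) i j k l =
  Qop n S i j k l + 2 * Bop n S T i j k l + Qop n T i j k l.
Proof.
  unfold Qop, Bop.
  match goal with |- / 2 * ?a + ?b =
    / 2 * ?a1 + ?b1 + 2 * (/ 2 * ?a2 + ?b2) + (/ 2 * ?a3 + ?b3) =>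
    assert (E1 : a = a1 + 2 * a2 + a3); [|assert (E2 : b = b1 + 2 * b2 + b3)] end.
  - rewrite <- rsum_scal_l; repeat rewrite <- ?rsum_minus, <- ?rsum_plus; apply rsum_ext; intros.
    rewrite <- rsum_scal_l; repeat rewrite <- ?rsum_minus, <- ?rsum_plus; apply rsum_ext; intros.
    ring.
  - rewrite <- rsum_scal_l; repeat rewrite <- ?rsum_minus, <- ?rsum_plus; apply rsum_ext; intros.
    rewrite <- rsum_scal_l; repeat rewrite <- ?rsum_minus, <- ?rsum_plus; apply rsum_ext; intros.
    ring.
  - rewrite E1, E2; ring.
Qed.

Lemma Ric_kn n H i k : (i < n)%nat -> (k < n)%nat ->
  Ric n (kn H idf) i k = (INR n - 2) * H i k + tr n H * kdelta i k.
Proof.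
  intros Hi Hk; unfold Ric.
  transitivity (rsum n (fun _ => H i k) - rsum n (fun j => H i j * kdelta j k)
    - rsum n (fun j => kdelta i j * H j k) + rsum n (fun j => H j j) * kdelta i k).
  - rewrite <- rsum_scal_r; repeat rewrite <- ?rsum_minus, <- ?rsum_plus; apply rsum_ext; intros.
    unfold kn, idf; rewrite kdelta_same; ring.
  - rewrite rsum_const, (rsum_delta_r n k (fun j => H i j)), rsum_delta_l by auto.
    unfold tr; ring.
Qed.

Lemma cstar_kn n H i k : is_sym n H -> (i < n)%nat -> (k < n)%nat ->
  cstar n (kn H idf) H i k = tr n H * H i k - 2 * sq n H i k + nrm2 n H * kdelta i k.
Proof.
  intros S Hi Hk; unfold cstar.
  rewrite (rsum_ext2 n _ (fun p q => H p q * kn H idf i p k q)) by (intros; ring).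
  rewrite contract_kn_24 by auto.
  rewrite (rsum_ext n (fun p => H k p * H i p + H p i * H k p) (fun p => 2 * (H i p * H p k))).
  - rewrite rsum_scal_l; fold (sq n H i k) (nrm2 n H) (tr n H); ring.
  - intros p Hp; rewrite (S k p), (S p i) by auto; ring.
Qed.

(** Hamilton's quadratic expression, usually written [B_abcd], in which the symmetries of [Qop]
    become visible. *)
Definition qform (n : nat) (T : Tensor) (a b c d : nat) : R :=
  rsum n (fun p => rsum n (fun q => T a p b q * T c p d q)).

Lemma qform_sym n T a b c d : qform n T a b c d = qform n T c d a b.
Proof. apply rsum_ext2; intros; ring. Qed.

Lemma qform_flip n T a b c d : is_act n T ->
  (a < n)%nat -> (b < n)%nat -> (c < n)%nat -> (d < n)%nat ->
  qform n T a b c d = qform n T b a d c.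
Proof.
  intros A Ha Hb Hc Hd; unfold qform; rewrite rsum_swap; apply rsum_ext2; intros p q Hp Hq.
  rewrite (act_pair n T a q b p), (act_pair n T c q d p) by auto; ring.
Qed.

(** Bianchi's identity rewrites [T i j p q] as [T i p j q - T j p i q]; expanding the product gives
    four terms, equal in pairs by [qform_flip]. *)
Lemma contract_34_34 n T i j k l : is_act n T ->
  (i < n)%nat -> (j < n)%nat -> (k < n)%nat -> (l < n)%nat ->
  rsum n (fun p => rsum n (fun q => T i j p q * T k l p q)) =
  2 * (qform n T i j k l - qform n T i j l k).
Proof.
  intros A Hi Hj Hk Hl.
  assert (B : forall i j p q, (i < n)%nat -> (j < n)%nat -> (p < n)%nat -> (q < n)%nat ->
     T i j p q = T i p j q - T j p i q).
  { clear i j Hi Hj; intros i j p q Hi Hj Hp Hq; pose proof (act_bianchi n T i j p q A Hi Hj Hp Hq).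
    rewrite (act_anti12 n T i p j q) by auto; lra. }
  transitivity (qform n T i j k l - qform n T i j l k - qform n T j i k l + qform n T j i l k).
  - unfold qform; repeat rewrite <- ?rsum_minus, <- ?rsum_plus; apply rsum_ext; intros p Hp.
    repeat rewrite <- ?rsum_minus, <- ?rsum_plus; apply rsum_ext; intros q Hq.
    rewrite (B i j p q), (B k l p q) by auto; ring.
  - rewrite (qform_flip n T j i k l), (qform_flip n T j i l k) by auto; ring.
Qed.

Lemma Qop_qform n T i j k l : is_act n T ->
  (i < n)%nat -> (j < n)%nat -> (k < n)%nat -> (l < n)%nat ->
  Qop n T i j k l =
  2 * (qform n T i j k l - qform n T i j l k + qform n T i k j l - qform n T i l j k).
Proof.
  intros A Hi Hj Hk Hl.
  transitivity (rsum n (fun p => rsum n (fun q => T i j p q * T k l p q))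
    + (qform n T i k j l - qform n T i l j k - qform n T j k i l + qform n T j l i k)).
  - unfold Qop, Bop, qform; rewrite <- rsum_scal_l.
    repeat rewrite <- ?rsum_minus, <- ?rsum_plus; apply rsum_ext; intros.
    rewrite <- rsum_scal_l.
    repeat rewrite <- ?rsum_minus, <- ?rsum_plus; apply rsum_ext; intros; field.
  - rewrite contract_34_34, (qform_sym n T j k i l), (qform_sym n T j l i k) by auto; ring.
Qed.

Lemma act_Qop n T : is_act n T -> is_act n (Qop n T).
Proof.
  intros A i j k l Hi Hj Hk Hl; rewrite !Qop_qform by auto.
  assert (fl : forall a b c d, (a < n)%nat -> (b < n)%nat -> (c < n)%nat -> (d < n)%nat ->
    qform n T a b c d = qform n T b a d c) by (intros; apply qform_flip; auto).
  repeat split.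
  - rewrite (fl j i k l), (fl j i l k), (qform_sym n T j k i l), (qform_sym n T j l i k) by auto; ring.
  - rewrite (qform_sym n T k l i j), (qform_sym n T k l j i), (fl i j l k), (fl j i k l),
      (fl k i l j), (fl k j l i), (qform_sym n T j k i l) by auto; ring.
  - rewrite (fl j i k l), (qform_sym n T k l i j), (qform_sym n T j k i l),
      (fl k i j l), (fl k i l j), (fl k j i l), (qform_sym n T j l k i), (fl k i j l) by auto; ring.
Qed.

Lemma Ric_Qop n T i k : is_act n T -> (i < n)%nat -> (k < n)%nat ->
  Ric n (Qop n T) i k = 2 * cstar n T (Ric n T) i k.
Proof.
  intros A Hi Hk.
  set (X := rsum n (fun j => qform n T i j k j)).
  set (Y := rsum n (fun j => qform n T i j j k)).
  (* Both sides are the sum of [T i j p q * T k j p q]: once after renaming [j] and [p], once by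
     [contract_34_34]. Hence [X = 2 Y], and [X - 2 Y] drops out of the Ricci trace. *)
  assert (XY : X = 2 * (X - Y)).
  { unfold Y; unfold X at 2; rewrite <- rsum_minus, <- rsum_scal_l.
    rewrite (rsum_ext n _ (fun j => rsum n (fun p => rsum n (fun q => T i j p q * T k j p q)))).
    - apply rsum_swap.
    - intros j Hj; rewrite contract_34_34; auto. }
  transitivity (2 * (X - 2 * Y + rsum n (fun j => qform n T i k j j))).
  - unfold X, Y; rewrite <- !rsum_scal_l, <- rsum_minus, <- rsum_plus, <- rsum_scal_l.
    apply rsum_ext; intros j Hj; rewrite Qop_qform by auto; ring.
  - replace (X - 2 * Y) with 0 by lra; rewrite Rplus_0_l; f_equal.
    unfold qform; rewrite rsum_swap; apply rsum_ext; intros p Hp.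
    rewrite rsum_swap; apply rsum_ext; intros q Hq; rewrite rsum_scal_l; f_equal.
    apply rsum_ext; intros j Hj.
    rewrite (act_anti12 n T j p j q), (act_anti34 n T p j j q) by auto; ring.
Qed.

(** * Kulkarni-Nomizu products in an eigenbasis *)

Lemma sum4_prod4 n f g h w : sum4 n (fun i j k l => f i * g j * h k * w l) =
  rsum n f * rsum n g * rsum n h * rsum n w.
Proof.
  rewrite (sum4_ext n _ (fun i j k l => (f i * g j) * (h k * w l))) by (intros; ring).
  rewrite (sum4_prod_12_34 n (fun i j => f i * g j) (fun k l => h k * w l)), <- !rsum_mult; ring.
Qed.

Definition rank1 (v : nat -> R) : Form := fun i j => v i * v j.

(** The product of [v v^T] and [w w^T] is the tensor square of the two-form [v wedge w]. *)
Lemma ev_kn_rank1 n v w a b c d : ev n (kn (rank1 v) (rank1 w)) a b c d =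
  (dot n v a * dot n w b - dot n w a * dot n v b) *
  (dot n v c * dot n w d - dot n w c * dot n v d).
Proof.
  transitivity (
    sum4 n (fun i j k l => (v i * a i) * (w j * b j) * (v k * c k) * (w l * d l))
    + (-1) * sum4 n (fun i j k l => (v i * a i) * (w j * b j) * (w k * c k) * (v l * d l))
    + (-1) * sum4 n (fun i j k l => (w i * a i) * (v j * b j) * (v k * c k) * (w l * d l))
    + sum4 n (fun i j k l => (w i * a i) * (v j * b j) * (w k * c k) * (v l * d l))).
  - unfold ev; rewrite <- !sum4_scal, <- !sum4_plus; apply sum4_ext; intros.
    unfold kn, rank1; ring.
  - rewrite !(sum4_prod4 n (fun i => v i * a i) (fun j => w j * b j)),
      !(sum4_prod4 n (fun i => w i * a i) (fun j => v j * b j)).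
    unfold dot; ring.
Qed.

(** The squared modulus of the two-form [v wedge w] at the complex pair [(x + i y, u + i w')]. *)
Definition area (n : nat) (v w x y u w' : nat -> R) : R :=
  (dot n v x * dot n w u - dot n w x * dot n v u
   - (dot n v y * dot n w w' - dot n w y * dot n v w')) ^ 2
  + (dot n v x * dot n w w' - dot n w x * dot n v w'
     + (dot n v y * dot n w u - dot n w y * dot n v u)) ^ 2.

Lemma pic2_re_kn_rank1 n v w x y u u' :
  pic2_re n (kn (rank1 v) (rank1 w)) x y u u' = area n v w x y u u'.
Proof. rewrite pic2_re_cev; unfold cev, area; rewrite !ev_kn_rank1; ring. Qed.

Lemma area_nonneg n v w x y u u' : 0 <= area n v w x y u u'.
Proof. apply Rplus_le_le_0_compat; apply pow2_ge_0. Qed.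

Lemma area_sym n v w x y u u' : area n v w x y u u' = area n w v x y u u'.
Proof. unfold area; ring. Qed.

Lemma area_diag n v x y u u' : area n v v x y u u' = 0.
Proof. unfold area; ring. Qed.

Lemma pic2_re_rsum2 n N c (W : nat -> nat -> Tensor) x y u v :
  pic2_re n (fun i j k l => rsum N (fun a => rsum N (fun b => c a b * W a b i j k l))) x y u v =
  rsum N (fun a => rsum N (fun b => c a b * pic2_re n (W a b) x y u v)).
Proof.
  unfold pic2_re.
  rewrite (sum4_ext n _ (fun i j k l => rsum N (fun a => rsum N (fun b =>
    c a b * (W a b i j k l * ((x i * x k + y i * y k) * (u j * u l + v j * v l) -
      (y i * x k - x i * y k) * (v j * u l - u j * v l))))))).
  - rewrite sum4_rsum; apply rsum_ext; intros a Ha.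
    rewrite sum4_rsum; apply rsum_ext; intros b Hb; apply sum4_scal.
  - intros i j k l _ _ _ _; rewrite <- rsum_scal_r; apply rsum_ext; intros.
    rewrite <- rsum_scal_r; apply rsum_ext; intros; ring.
Qed.

Lemma kn_spectral n N (v : nat -> nat -> R) c d A B :
  (forall i j, (i < n)%nat -> (j < n)%nat -> A i j = rsum N (fun a => c a * (v a i * v a j))) ->
  (forall i j, (i < n)%nat -> (j < n)%nat -> B i j = rsum N (fun a => d a * (v a i * v a j))) ->
  teq n (kn A B) (fun i j k l => rsum N (fun a => rsum N (fun b =>
    c a * d b * kn (rank1 (v a)) (rank1 (v b)) i j k l))).
Proof.
  intros EA EB i j k l Hi Hj Hk Hl; unfold kn at 1; rewrite !EA, !EB by auto.
  rewrite !rsum_mult.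
  repeat rewrite <- ?rsum_minus, <- ?rsum_plus; apply rsum_ext; intros.
  repeat rewrite <- ?rsum_minus, <- ?rsum_plus; apply rsum_ext; intros.
  unfold kn, rank1; ring.
Qed.

Lemma spectral_sq n v alpha A : orthonormal n n v ->
  (forall i j, (i < n)%nat -> (j < n)%nat -> A i j = rsum n (fun a => alpha a * (v a i * v a j))) ->
  forall i j, (i < n)%nat -> (j < n)%nat ->
  sq n A i j = rsum n (fun a => (alpha a * alpha a) * (v a i * v a j)).
Proof.
  intros O E i j Hi Hj; unfold sq.
  transitivity (rsum n (fun p => rsum n (fun a => rsum n (fun b =>
    (alpha a * v a i) * (alpha b * v b j) * (v a p * v b p))))).
  - apply rsum_ext; intros p Hp; rewrite !E, rsum_mult by auto; apply rsum_ext2; intros; ring.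
  - rewrite rsum_swap; apply rsum_ext; intros a Ha; rewrite rsum_swap.
    rewrite (rsum_ext n _ (fun b => kdelta a b * (alpha a * v a i * (alpha b * v b j)))).
    + rewrite rsum_delta_l by auto; ring.
    + intros b Hb; rewrite rsum_scal_l; fold (dot n (v a) (v b)); rewrite O by auto; ring.
Qed.

Lemma spectral_tr n v alpha A : orthonormal n n v ->
  (forall i j, (i < n)%nat -> (j < n)%nat -> A i j = rsum n (fun a => alpha a * (v a i * v a j))) ->
  tr n A = rsum n alpha.
Proof.
  intros O E; unfold tr.
  rewrite (rsum_ext n _ (fun i => rsum n (fun a => alpha a * (v a i * v a i)))) by auto.
  rewrite rsum_swap; apply rsum_ext; intros a Ha; rewrite rsum_scal_l.
  fold (dot n (v a) (v a)); rewrite O, kdelta_same by auto; ring.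
Qed.

Lemma rsum_sq_le n f : (forall i, (i < n)%nat -> 0 <= f i) ->
  rsum n (fun i => f i * f i) <= rsum n f * rsum n f.
Proof.
  intros P; induction n as [|n IH]; simpl; [lra|].
  assert (0 <= rsum n f) by (apply rsum_nonneg; auto with arith).
  assert (0 <= f n) by auto with arith.
  assert (rsum n (fun i => f i * f i) <= rsum n f * rsum n f) by auto with arith.
  nra.
Qed.

Lemma rsum_remove n f a : (a < n)%nat ->
  rsum n (fun i => if Nat.eqb i a then 0 else f i) = rsum n f - f a.
Proof.
  intros Ha; rewrite <- (rsum_delta_l n a f) by auto; rewrite <- rsum_minus.
  apply rsum_ext; intros i Hi; destruct (Nat.eqb_spec i a).
  - subst; rewrite kdelta_same; ring.
  - rewrite kdelta_diff by auto; ring.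
Qed.

(** The other eigenvalues are nonnegative with sum [t - (alpha a + alpha b)], so their squares add
    up to at most the square of that sum. *)
Lemma two_eigenvalues n alpha a b : (forall i, (i < n)%nat -> 0 <= alpha i) ->
  (a < n)%nat -> (b < n)%nat -> a <> b ->
  let t := rsum n alpha in
  alpha a + alpha b <= t /\
  rsum n (fun i => alpha i * alpha i) <=
    alpha a * alpha a + alpha b * alpha b + (t - (alpha a + alpha b)) * (t - (alpha a + alpha b)).
Proof.
  intros P Ha Hb N t.
  set (f := fun i => if Nat.eqb i b then 0 else if Nat.eqb i a then 0 else alpha i).
  assert (F : forall i, (i < n)%nat -> 0 <= f i).
  { intros i Hi; unfold f; destruct (Nat.eqb i b), (Nat.eqb i a); auto; lra. }
  assert (S1 : rsum n f = t - (alpha a + alpha b)).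
  { unfold f; rewrite rsum_remove by auto; rewrite rsum_remove by auto.
    destruct (Nat.eqb_spec b a); [congruence|]; unfold t; ring. }
  assert (S2 : rsum n (fun i => f i * f i) =
    rsum n (fun i => alpha i * alpha i) - alpha a * alpha a - alpha b * alpha b).
  { rewrite (rsum_ext n _ (fun i => if Nat.eqb i b then 0 else
      if Nat.eqb i a then 0 else alpha i * alpha i)).
    - rewrite rsum_remove by auto; rewrite (rsum_remove n (fun i => alpha i * alpha i)) by auto.
      destruct (Nat.eqb_spec b a); [congruence|]; ring.
    - intros i Hi; unfold f; destruct (Nat.eqb i b), (Nat.eqb i a); ring. }
  pose proof (rsum_sq_le n f F); pose proof (rsum_nonneg n f F).
  rewrite S1, S2 in *; lra.
Qed.

(* [s^2] times the left side is at least
   [(t^2 - 4 u (t - u)) (1 - s)^2 + 4 u (t - u) (1 - s/2)^2 - c s^2 t^2] with [u = p + q]. *)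
Lemma eigenvalue_inequality N s c t a p q n2 :
  4 <= N -> 0 < s <= 2 -> 0 <= c -> 2 * c * s ^ 2 <= (1 - s) ^ 2 -> 2 * c * s ^ 2 <= (1 - s / 2) ^ 2 ->
  t = 2 * s * a -> 0 <= p -> 0 <= q -> p + q <= t ->
  n2 <= p * p + q * q + (t - (p + q)) * (t - (p + q)) ->
  c * t ^ 2 <= (N - 2) * p * q - (t * p - p * p) - (t * q - q * q)
    + ((2 * a * t - (2 - s) * n2) / s - c * t ^ 2).
Proof.
  intros HN Hs Hc C1 C2 Ht Hp Hq Hu Hn.
  set (u := p + q) in *.
  set (y := u * (t - u)).
  assert (Y0 : 0 <= y) by (apply Rmult_le_pos; unfold u in *; lra).
  assert (Y1 : 0 <= t ^ 2 - 4 * y).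
  { replace (t ^ 2 - 4 * y) with ((t - 2 * u) ^ 2) by (unfold y; ring); apply pow2_ge_0. }
  assert (B : 2 * c * s ^ 2 * t ^ 2 <= (t ^ 2 - 4 * y) * (1 - s) ^ 2 + 4 * y * (1 - s / 2) ^ 2).
  { replace (2 * c * s ^ 2 * t ^ 2) with
      ((t ^ 2 - 4 * y) * (2 * c * s ^ 2) + 4 * y * (2 * c * s ^ 2)) by ring.
    apply Rplus_le_compat; apply Rmult_le_compat_l; lra. }
  assert (PQ : 0 <= p * q) by (apply Rmult_le_pos; auto).
  assert (K : s ^ 2 * (c * t ^ 2) <= s ^ 2 * ((N - 2) * p * q - (t * p - p * p) - (t * q - q * q)
    + ((2 * a * t - (2 - s) * n2) / s - c * t ^ 2))).
  { replace (s ^ 2 * ((N - 2) * p * q - (t * p - p * p) - (t * q - q * q)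
    + ((2 * a * t - (2 - s) * n2) / s - c * t ^ 2))) with
     (s ^ 2 * ((N - 4) * (p * q) - y) + t ^ 2 - s * (2 - s) * n2 - s ^ 2 * (c * t ^ 2))
     by (unfold y, u; rewrite Ht; field; lra).
    assert (s * (2 - s) * n2 <= s * (2 - s) * (p * p + q * q + (t - u) * (t - u))).
    { apply Rmult_le_compat_l; auto; apply Rmult_le_pos; lra. }
    assert (0 <= s ^ 2 * ((N - 4) * (p * q))).
    { apply Rmult_le_pos; [apply pow2_ge_0|]; apply Rmult_le_pos; lra. }
    assert (0 <= s * (2 - s) * (p * q)) by (apply Rmult_le_pos; auto; apply Rmult_le_pos; lra).
    assert (s * (2 - s) * (p * p + q * q + (t - u) * (t - u)) =
      s * (2 - s) * (t ^ 2 - 2 * y) - 2 * (s * (2 - s) * (p * q))) by (unfold y, u; ring).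
    assert ((t ^ 2 - 4 * y) * (1 - s) ^ 2 + 4 * y * (1 - s / 2) ^ 2 =
      t ^ 2 - s ^ 2 * y - s * (2 - s) * (t ^ 2 - 2 * y)) by field.
    lra. }
  apply Rmult_le_reg_l with (s ^ 2); auto; apply pow_lt; lra.
Qed.

Lemma nrm2_le_tr n A : is_sym n A -> psd n A -> 0 <= nrm2 n A <= tr n A ^ 2.
Proof.
  intros S P; destruct (spectral_psd n A S P) as [v [alpha [O [pos E]]]]; split.
  - apply rsum_nonneg; intros; apply rsum_nonneg; intros; nra.
  - rewrite <- tr_sq by auto.
    rewrite (spectral_tr n v alpha A O E).
    rewrite (spectral_tr n v (fun a => alpha a * alpha a) (sq n A) O) by
      (apply spectral_sq; auto).
    pose proof (rsum_sq_le n alpha pos); simpl; lra.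
Qed.

(** In an eigenbasis of [A] both sides are combinations of the nonnegative numbers [area] of pairs
    of eigenvectors. Coefficients can therefore be compared pair by pair, and pairs of equal indices
    drop out. *)
Lemma error_term_bound n s c a A x y u v :
  (5 <= n)%nat -> 0 < s <= 2 -> 0 <= c ->
  2 * c * s ^ 2 <= (1 - s) ^ 2 -> 2 * c * s ^ 2 <= (1 - s / 2) ^ 2 ->
  is_sym n A -> psd n A -> tr n A = 2 * s * a ->
  let t := tr n A in
  let k := (2 * a * t - (2 - s) * nrm2 n A) / s - c * t ^ 2 in
  let K := fun i j => 2 * (t * A i j - sq n A i j) - k * idf i j in
  c * t ^ 2 * pic2_re n (kn idf idf) x y u v <=
  pic2_re n (fun i j k l => (INR n - 2) * kn A A i j k l + -1 * kn K idf i j k l) x y u v.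
Proof.
  intros Hn Hs Hc C1 C2 S P Ht t k K.
  destruct (spectral_psd n A S P) as [v' [alpha [O [pos E]]]].
  assert (Et : t = rsum n alpha) by (apply (spectral_tr n v'); auto).
  assert (En : nrm2 n A = rsum n (fun a => alpha a * alpha a)).
  { rewrite <- tr_sq by auto; apply (spectral_tr n v'); auto; apply spectral_sq; auto. }
  assert (EI : forall i j, (i < n)%nat -> (j < n)%nat ->
    idf i j = rsum n (fun a => 1 * (v' a i * v' a j))).
  { intros i j Hi Hj; unfold idf; rewrite <- (orthonormal_complete n v') by auto.
    apply rsum_ext; intros; ring. }
  set (kap := fun a => 2 * (t * alpha a - alpha a * alpha a) - k).
  assert (EK : forall i j, (i < n)%nat -> (j < n)%nat ->
    K i j = rsum n (fun a => kap a * (v' a i * v' a j))).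
  { intros i j Hi Hj; unfold K; rewrite (E i j), (spectral_sq n v' alpha A O E i j), EI by auto.
    rewrite <- rsum_scal_l, <- rsum_minus, <- rsum_scal_l, <- rsum_scal_l, <- rsum_minus.
    apply rsum_ext; intros; unfold kap; ring. }
  set (w := fun a b => area n (v' a) (v' b) x y u v).
  assert (PI : pic2_re n (kn idf idf) x y u v = rsum n (fun a => rsum n (fun b => 1 * 1 * w a b))).
  { rewrite (pic2_re_ext n _ _ x y u v (kn_spectral n n v' _ _ _ _ EI EI)).
    rewrite (pic2_re_rsum2 n n (fun a b => 1 * 1)); apply rsum_ext2; intros.
    rewrite pic2_re_kn_rank1; reflexivity. }
  assert (PE : pic2_re n (fun i j k l => (INR n - 2) * kn A A i j k l + -1 * kn K idf i j k l)
    x y u v = rsum n (fun a => rsum n (fun b =>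
      ((INR n - 2) * (alpha a * alpha b) + -1 * (kap a * 1)) * w a b))).
  { rewrite (pic2_re_ext n _ (fun i j k l => rsum n (fun a => rsum n (fun b =>
      ((INR n - 2) * (alpha a * alpha b) + -1 * (kap a * 1)) *
        kn (rank1 (v' a)) (rank1 (v' b)) i j k l)))).
    - rewrite (pic2_re_rsum2 n n (fun a b =>
        (INR n - 2) * (alpha a * alpha b) + -1 * (kap a * 1))); apply rsum_ext2; intros.
      rewrite pic2_re_kn_rank1; reflexivity.
    - intros i j k' l Hi Hj Hk Hl.
      rewrite (kn_spectral n n v' _ _ _ _ E E), (kn_spectral n n v' _ _ _ _ EK EI) by auto.
      rewrite <- !rsum_scal_l, <- rsum_plus; apply rsum_ext; intros.
      rewrite <- !rsum_scal_l, <- rsum_plus; apply rsum_ext; intros; ring. }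
  (* [kap] sits on one factor only; adding the sum with [a] and [b] exchanged symmetrises the
     coefficient. *)
  assert (PE2 : 2 * pic2_re n (fun i j k l =>
      (INR n - 2) * kn A A i j k l + -1 * kn K idf i j k l) x y u v =
      rsum n (fun a => rsum n (fun b =>
        (2 * (INR n - 2) * (alpha a * alpha b) - kap a - kap b) * w a b))).
  { replace (2 * pic2_re n _ x y u v) with (pic2_re n (fun i j k l =>
      (INR n - 2) * kn A A i j k l + -1 * kn K idf i j k l) x y u v + pic2_re n (fun i j k l =>
      (INR n - 2) * kn A A i j k l + -1 * kn K idf i j k l) x y u v) by ring.
    rewrite PE, rsum_swap at 1; rewrite PE.
    repeat rewrite <- ?rsum_plus; apply rsum_ext; intros a' Ha.
    repeat rewrite <- ?rsum_plus; apply rsum_ext; intros b' Hb.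
    unfold w; rewrite (area_sym n (v' b') (v' a')); ring. }
  apply Rmult_le_reg_l with 2; [lra|]; rewrite PE2, PI, <- !rsum_scal_l.
  apply rsum_le; intros a' Ha; rewrite <- !rsum_scal_l; apply rsum_le; intros b' Hb.
  destruct (Nat.eq_dec a' b') as [<-|N].
  - unfold w; rewrite area_diag; lra.
  - replace (2 * (c * t ^ 2 * (1 * 1 * w a' b'))) with (2 * (c * t ^ 2) * w a' b') by ring.
    apply Rmult_le_compat_r; [apply area_nonneg|].
    destruct (two_eigenvalues n alpha a' b' pos Ha Hb N) as [U1 U2]; rewrite <- Et, <- En in *.
    assert (N5 : INR 5 <= INR n) by (apply le_INR; auto); simpl INR in N5.
    pose proof (eigenvalue_inequality (INR n) s c t a (alpha a') (alpha b') (nrm2 n A)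
      ltac:(lra) Hs Hc C1 C2 Ht (pos _ Ha) (pos _ Hb) U1 U2).
    fold k in H; unfold kap; lra.
Qed.

(** * Traces, Einstein tensors and the decomposition of [Q R] *)

Lemma ev_zero n T a b c d :
  (forall i j k l, a i * b j * c k * d l = 0) -> ev n T a b c d = 0.
Proof.
  intros Z; unfold ev; rewrite (sum4_ext n _ (fun i j k l => 0 * 0)).
  - rewrite sum4_scal; ring.
  - intros; rewrite Z; ring.
Qed.

(** At real vectors the PIC2 condition is a condition on sectional curvature. *)
Lemma ev_sectional_nonneg n T x u : PIC2 n T -> 0 <= ev n T x u x u.
Proof.
  intros [_ P]; destruct (P x (fun _ => 0) u (fun _ => 0)) as [_ H].
  rewrite pic2_re_cev in H; unfold cev in H.
  rewrite (ev_zero n T x (fun _ => 0)), (ev_zero n T (fun _ => 0) u),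
    (ev_zero n T (fun _ => 0) (fun _ => 0)), (ev_zero n T (fun _ => 0) (fun _ => 0)),
    (ev_zero n T (fun _ => 0) u), (ev_zero n T x (fun _ => 0)), (ev_zero n T x u (fun _ => 0)) in H
    by (intros; ring); lra.
Qed.

Lemma bil_cstar_rank1 n T l e : bil n (cstar n T (rank1 l)) e e = ev n T e l e l.
Proof.
  rewrite ev_m13; unfold bil, cstar, m13, rank1.
  transitivity (rsum n (fun i => rsum n (fun j => rsum n (fun p => rsum n (fun q =>
    T i p j q * e i * e j * l p * l q))))).
  - apply rsum_ext2; intros i j Hi Hj.
    rewrite Rmult_assoc, <- rsum_scal_r; apply rsum_ext; intros.
    rewrite <- rsum_scal_r; apply rsum_ext; intros; ring.
  - transitivity (sum4 n (fun i j p q => T i p j q * e i * e j * l p * l q)); [reflexivity|].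
    rewrite sum4_swap23, sum4_swap12, sum4_swap34, sum4_swap23; unfold sum4.
    apply rsum_ext2; intros p q Hp Hq.
    rewrite Rmult_assoc, <- rsum_scal_r; apply rsum_ext; intros.
    rewrite <- rsum_scal_r; apply rsum_ext; intros; ring.
Qed.

Lemma cstar_rsum n N T (c : nat -> R) (B : nat -> Form) i k :
  cstar n T (fun p q => rsum N (fun r => c r * B r p q)) i k =
  rsum N (fun r => c r * cstar n T (B r) i k).
Proof.
  induction N as [|N IH]; simpl.
  - apply rsum_0; intros; apply rsum_0; intros; ring.
  - rewrite <- IH; unfold cstar; rewrite <- rsum_scal_l, <- rsum_plus; apply rsum_ext; intros.
    rewrite <- rsum_scal_l, <- rsum_plus; apply rsum_ext; intros; ring.
Qed.

(** Writing [A] as a sum of squares [l l^T] turns the value into a sum of sectional curvatures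
    [T (e, l, e, l)]. *)
Lemma bil_cstar_nonneg n T A e : PIC2 n T -> is_sym n A -> psd n A -> 0 <= bil n (cstar n T A) e e.
Proof.
  intros P S PA; destruct (psd_decomposition n A S PA) as [l E].
  rewrite (bil_form_ext n _ (fun i k => rsum n (fun r => 1 * cstar n T (rank1 (l r)) i k))).
  - rewrite (bil_form_rsum n n (fun _ => 1)); apply rsum_nonneg; intros.
    rewrite bil_cstar_rank1, Rmult_1_l; apply ev_sectional_nonneg; auto.
  - intros i j Hi Hj; rewrite <- (cstar_rsum n n T (fun _ => 1)); unfold cstar, rank1.
    apply rsum_ext2; intros p q Hp Hq; rewrite E by auto; f_equal; apply rsum_ext; intros; ring.
Qed.

Lemma trE n A : tr n A = rsum n (fun i => A i i).
Proof. reflexivity. Qed.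

Lemma tr_lin n A B s : tr n (fun i j => A i j + s * B i j) = tr n A + s * tr n B.
Proof. unfold tr; rewrite rsum_plus, rsum_scal_l; reflexivity. Qed.

Lemma tr_idf n : tr n idf = INR n.
Proof.
  unfold tr, idf; rewrite (rsum_ext n _ (fun _ => 1)) by (intros; apply kdelta_same).
  rewrite rsum_const; ring.
Qed.

Lemma tr_ext n A B : (forall i j, (i < n)%nat -> (j < n)%nat -> A i j = B i j) -> tr n A = tr n B.
Proof. intros E; apply rsum_ext; auto. Qed.

Lemma Ric_lin n T T' s i k :
  Ric n (fun i j k l => T i j k l + s * T' i j k l) i k = Ric n T i k + s * Ric n T' i k.
Proof. unfold Ric; rewrite rsum_plus, rsum_scal_l; reflexivity. Qed.

Lemma scal_lin n T T' s :
  scal n (fun i j k l => T i j k l + s * T' i j k l) = scal n T + s * scal n T'.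
Proof.
  transitivity (tr n (fun i j => Ric n T i j + s * Ric n T' i j)).
  - apply tr_ext; intros; apply Ric_lin.
  - apply (tr_lin n (Ric n T)).
Qed.

Lemma Ric_ext n T T' i k : teq n T T' -> (i < n)%nat -> (k < n)%nat -> Ric n T i k = Ric n T' i k.
Proof. intros E Hi Hk; apply rsum_ext; intros; apply E; auto. Qed.

Lemma scal_ext n T T' : teq n T T' -> scal n T = scal n T'.
Proof. intros E; apply tr_ext; intros; apply Ric_ext; auto. Qed.

Lemma scal_kn n H : scal n (kn H idf) = (2 * INR n - 2) * tr n H.
Proof.
  transitivity (tr n (fun i k => (INR n - 2) * H i k + tr n H * idf i k)).
  - apply tr_ext; intros; apply Ric_kn; auto.
  - unfold tr at 1; rewrite rsum_plus, !rsum_scal_l; fold (tr n H) (tr n idf).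
    rewrite tr_idf; ring.
Qed.

Lemma Ric_kn_same n A i k :
  Ric n (kn A A) i k = 2 * (tr n A * A i k - sq n A i k).
Proof.
  unfold Ric, sq, tr.
  rewrite Rmult_minus_distr_l, <- rsum_scal_r, <- !rsum_scal_l, <- rsum_minus.
  apply rsum_ext; intros j Hj; unfold kn; ring.
Qed.

Lemma Ric0_zero_einstein n T i k : Ric0 n T i k = 0 -> Ric n T i k = scal n T / INR n * kdelta i k.
Proof. unfold Ric0; intros E; unfold Rdiv; lra. Qed.

Lemma einstein_Ric0 n T mu : (0 < n)%nat ->
  (forall i k, (i < n)%nat -> (k < n)%nat -> Ric n T i k = mu * kdelta i k) ->
  scal n T = INR n * mu /\ forall i k, (i < n)%nat -> (k < n)%nat -> Ric0 n T i k = 0.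
Proof.
  intros Hn E.
  assert (X : scal n T = INR n * mu).
  { unfold scal; rewrite (rsum_ext n _ (fun _ => mu)), rsum_const; auto.
    intros; rewrite E, kdelta_same by auto; ring. }
  split; auto; intros i k Hi Hk; unfold Ric0; rewrite X, E by auto; field.
  apply not_0_INR; lia.
Qed.

Lemma tr_cstar n T H lam : is_act n T ->
  (forall i k, (i < n)%nat -> (k < n)%nat -> Ric n T i k = lam * kdelta i k) ->
  tr n (cstar n T H) = lam * tr n H.
Proof.
  intros A E; unfold tr, cstar; rewrite rsum_swap, <- rsum_scal_l; apply rsum_ext; intros p Hp.
  rewrite rsum_swap.
  rewrite (rsum_ext n _ (fun q => kdelta p q * (lam * H p q))).
  - rewrite rsum_delta_l; auto.
  - intros q Hq; rewrite rsum_scal_r.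
    replace (rsum n (fun i => T i p i q)) with (Ric n T p q); [rewrite E by auto; ring|].
    apply rsum_ext; intros i Hi.
    rewrite (act_anti12 n T p i q i), (act_anti34 n T i p q i) by auto; ring.
Qed.

Lemma sq_idf_minus n a H i k : is_sym n H -> (i < n)%nat -> (k < n)%nat ->
  sq n (fun i j => a * idf i j - H i j) i k = a * a * kdelta i k - 2 * a * H i k + sq n H i k.
Proof.
  intros S Hi Hk; unfold sq.
  transitivity (rsum n (fun p => kdelta i p * (a * a * kdelta p k - a * H p k))
    - rsum n (fun p => (a * H i p) * kdelta p k) + rsum n (fun p => H i p * H p k)).
  - rewrite <- rsum_minus, <- rsum_plus; apply rsum_ext; intros; unfold idf; ring.
  - rewrite rsum_delta_l, (rsum_delta_r n k (fun p => a * H i p)) by auto; ring.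
Qed.

Lemma tr_idf_minus n a H : tr n (fun i j => a * idf i j - H i j) = INR n * a - tr n H.
Proof.
  unfold tr; rewrite rsum_minus, rsum_scal_l; fold (tr n idf); rewrite tr_idf; ring.
Qed.

Lemma idf_minus_sym n a H : is_sym n H -> is_sym n (fun i j => a * idf i j - H i j).
Proof. intros S i j Hi Hj; rewrite (S i j), (idf_sym n i j) by auto; reflexivity. Qed.

Lemma knE A B i j k l :
  kn A B i j k l = A i k * B j l - A i l * B j k - A j k * B i l + A j l * B i k.
Proof. reflexivity. Qed.

(* With [A = a id - H] the term [H . H] of [Q (T + H . id)] is [A . A + (2 a H - a^2 id) . id];
   [K] absorbs the traceless Ricci part of [A . A]. *)
Lemma Qop_split n T H lam a k : is_act n T -> is_sym n H ->
  (forall i k, (i < n)%nat -> (k < n)%nat -> Ric n T i k = lam * kdelta i k) ->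
  let A := fun i j => a * idf i j - H i j in
  let t := tr n A in
  let K := fun i j => 2 * (t * A i j - sq n A i j) - k * idf i j in
  let H' := fun i j => 2 * lam * H i j + 2 * cstar n T H i j
     + (4 * (INR n - 1) * a ^ 2 - 4 * t * a + nrm2 n A - k) * idf i j
     + (4 * t - 4 * (INR n - 2) * a) * A i j - 4 * sq n A i j in
  teq n (Qop n (fun i j k l => T i j k l + kn H idf i j k l))
    (fun i j k l => Qop n T i j k l + 1 * ((INR n - 2) * kn A A i j k l + -1 * kn K idf i j k l)
       + kn H' idf i j k l).
Proof.
  intros AT S E A t K H' i j k' l Hi Hj Hk Hl.
  rewrite Qop_plus, Bop_kn by auto.
  unfold Qop at 2; rewrite (Bop_kn n (kn H idf)) by (auto; apply act_kn; auto; apply idf_sym).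
  assert (Et : tr n H = INR n * a - t) by (unfold t, A; rewrite tr_idf_minus; ring).
  assert (SA : is_sym n A) by (apply idf_minus_sym; auto).
  assert (Eq : forall i j, (i < n)%nat -> (j < n)%nat ->
     sq n H i j = a * a * kdelta i j - 2 * a * A i j + sq n A i j).
  { intros i' j' Hi' Hj'; unfold A at 2; rewrite sq_idf_minus by auto.
    unfold A, idf; ring. }
  assert (EN : nrm2 n H = INR n * a ^ 2 - 2 * a * t + nrm2 n A).
  { rewrite <- !tr_sq by auto; rewrite (tr_ext n _ _ Eq); unfold tr at 1.
    rewrite rsum_plus, rsum_minus, !rsum_scal_l.
    fold (tr n A) (tr n (sq n A)) (tr n kdelta); change kdelta with idf; rewrite tr_idf.
    unfold t; ring. }
  rewrite !knE, !E, !Ric_kn, !cstar_kn, !Eq, EN, !Et by auto.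
  unfold K, H', A, idf; ring.
Qed.

Lemma bil_sq_null n A e : is_sym n A -> psd n A -> bil n A e e = 0 -> bil n (sq n A) e e = 0.
Proof.
  intros S P Z; rewrite bil_mulv; apply rsum_0; intros i Hi; unfold mulv, sq.
  rewrite (rsum_ext n _ (fun k => rsum n (fun p => A i p * (A p k * e k)))).
  - rewrite rsum_swap, rsum_0; [ring|]; intros p Hp; rewrite rsum_scal_l.
    fold (mulv n A e p); rewrite (psd_null_mulv n A e p) by auto; ring.
  - intros; rewrite <- rsum_scal_r; apply rsum_ext; intros; ring.
Qed.

(** Equal to [(n - 2 sigma) A] for the form [A] of the overview; this is the form whose positivity
    [Ccone] requires. *)
Definition gform (n : nat) (sigma : R) (H : Form) : Form :=
  fun i j => tr n H * idf i j - (INR n - 2 * sigma) * H i j.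

Lemma tr_gform n s H : tr n (gform n s H) = 2 * s * tr n H.
Proof.
  rewrite trE; unfold gform; rewrite rsum_minus, !rsum_scal_l; fold (tr n idf) (tr n H).
  rewrite tr_idf; ring.
Qed.

Lemma gform_sym n s H : is_sym n H -> is_sym n (gform n s H).
Proof. intros S i j Hi Hj; unfold gform; rewrite (S i j), (idf_sym n i j) by auto; reflexivity. Qed.

Lemma bil_gform n s H e :
  bil n (gform n s H) e e = tr n H * dot n e e - (INR n - 2 * s) * bil n H e e.
Proof.
  rewrite <- bil_idf; unfold bil, gform; rewrite <- !rsum_scal_l, <- rsum_minus.
  apply rsum_ext; intros; rewrite <- !rsum_scal_l, <- rsum_minus; apply rsum_ext; intros; ring.
Qed.

Lemma gform_lin n s H H' tau i j :
  gform n s (fun i j => H i j + tau * H' i j) i j = gform n s H i j + tau * gform n s H' i j.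
Proof. unfold gform; rewrite tr_lin; ring. Qed.

Lemma INR_ge_5 n : (5 <= n)%nat -> 5 <= INR n.
Proof. intros Hn; apply le_INR in Hn; simpl INR in Hn; lra. Qed.

(** A crude constant: [36 n + 64] bounds the quadratic loss in [tr H'] and [8 n^2] the quadratic
    gain in [scal T'], both relative to [h^2]. *)
Definition growth (n : nat) : R := 36 * INR n + 64 + 8 * INR n ^ 2.

(** The last three conclusions feed the conditions at the three kinds of boundary point: a null pair
    of [T], a null vector of [gform], and equality in the trace condition. [c] measures the gain in
    the first two: invariance uses [c = 0], transversality [c > 0]. *)
Lemma tangent_data n s c T H lam : (5 <= n)%nat -> 0 < s <= 2 -> 0 <= c ->
  2 * c * s ^ 2 <= (1 - s) ^ 2 -> 2 * c * s ^ 2 <= (1 - s / 2) ^ 2 ->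
  PIC2 n T -> (forall i k, (i < n)%nat -> (k < n)%nat -> Ric n T i k = lam * kdelta i k) ->
  is_sym n H -> psd n (gform n s H) ->
  let h := tr n H in
  let t := 2 * s * h / (INR n - 2 * s) in
  exists (T' : Tensor) (H' : Form),
    teq n (Qop n (fun i j k l => T i j k l + kn H idf i j k l))
          (fun i j k l => T' i j k l + kn H' idf i j k l) /\
    is_act n T' /\ (forall i k, (i < n)%nat -> (k < n)%nat -> Ric0 n T' i k = 0) /\ is_sym n H' /\
    (forall x y u v, pic2_re n T x y u v = 0 ->
       c * t ^ 2 * pic2_re n (kn idf idf) x y u v <= pic2_re n T' x y u v) /\
    (forall e, dot n e e = 1 -> bil n (gform n s H) e e = 0 ->
       2 * s * c * t ^ 2 <= bil n (gform n s H') e e) /\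
    (forall theta, 0 <= theta <= 1 ->
       4 * lam * h - 2 * INR n * lam ^ 2 * theta - growth n * h ^ 2 <= tr n H' - theta * scal n T').
Proof.
  intros Hn Hs Hc C1 C2 PT E S PG h t.
  pose proof (INR_ge_5 n Hn) as N5.
  assert (AT : is_act n T) by apply PT.
  assert (m0 : 1 <= INR n - 2 * s) by lra.
  set (a := h / (INR n - 2 * s)).
  assert (Eh : h = (INR n - 2 * s) * a) by (unfold a; field; lra).
  set (A := fun i j => a * idf i j - H i j).
  assert (SA : is_sym n A) by (apply idf_minus_sym; auto).
  assert (GA : forall i j, gform n s H i j = (INR n - 2 * s) * A i j).
  { intros; unfold gform, A; fold h; rewrite Eh; ring. }
  assert (BA : forall e, bil n (gform n s H) e e = (INR n - 2 * s) * bil n A e e).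
  { intros; unfold bil; rewrite <- rsum_scal_l; apply rsum_ext; intros; rewrite <- rsum_scal_l.
    apply rsum_ext; intros; rewrite GA; ring. }
  assert (PA : psd n A).
  { intros e; change (0 <= bil n A e e); apply Rmult_le_reg_l with (INR n - 2 * s); [lra|].
    rewrite Rmult_0_r, <- BA; apply PG. }
  assert (Et : tr n A = 2 * s * a).
  { unfold A; rewrite tr_idf_minus; fold h; rewrite Eh; ring. }
  assert (tt : t = tr n A) by (rewrite Et; unfold t, a; field; lra).
  assert (h0 : 0 <= h).
  { pose proof (tr_nonneg n _ PG) as X; rewrite tr_gform in X; fold h in X; nra. }
  assert (a0 : 0 <= a) by (apply Rmult_le_reg_l with (INR n - 2 * s); lra).
  assert (ah : a <= h) by nra.
  pose proof (nrm2_le_tr n A SA PA) as N2.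
  (* The condition on [H'] tolerates [s k <= 2 a t - (2 - s) |A|^2]; staying [c t^2] below the
     resulting bound on [k] leaves a gain in both conditions. *)
  set (k := (2 * a * tr n A - (2 - s) * nrm2 n A) / s - c * tr n A ^ 2).
  set (K := fun i j => 2 * (tr n A * A i j - sq n A i j) - k * idf i j).
  set (D := fun i j k' l => (INR n - 2) * kn A A i j k' l + -1 * kn K idf i j k' l).
  set (T' := fun i j k' l => Qop n T i j k' l + 1 * D i j k' l).
  set (H' := fun i j => 2 * lam * H i j + 2 * cstar n T H i j
     + (4 * (INR n - 1) * a ^ 2 - 4 * tr n A * a + nrm2 n A - k) * idf i j
     + (4 * tr n A - 4 * (INR n - 2) * a) * A i j - 4 * sq n A i j).
  assert (SK : is_sym n K).
  { intros i j Hi Hj; unfold K; rewrite (SA i j), (sq_sym n A SA i j), (idf_sym n i j) by auto.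
    reflexivity. }
  set (mu := 2 * lam ^ 2 + (INR n - 2) * k - tr n K).
  assert (ET' : forall i j, (i < n)%nat -> (j < n)%nat -> Ric n T' i j = mu * kdelta i j).
  { intros i j Hi Hj; unfold T'; rewrite Ric_lin, Ric_Qop by auto; unfold D.
    replace (Ric n (fun i j k' l => (INR n - 2) * kn A A i j k' l + -1 * kn K idf i j k' l) i j)
      with ((INR n - 2) * Ric n (kn A A) i j + -1 * Ric n (kn K idf) i j)
      by (unfold Ric; rewrite rsum_plus, !rsum_scal_l; reflexivity).
    rewrite Ric_kn_same, Ric_kn by auto.
    replace (cstar n T (Ric n T) i j) with (lam * (lam * kdelta i j)).
    - unfold mu, K, idf; ring.
    - rewrite <- E by auto; unfold cstar, Ric at 1; rewrite <- rsum_scal_l.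
      apply rsum_ext; intros p Hp.
      rewrite (rsum_ext n _ (fun q => kdelta p q * (lam * T i p j q))).
      + rewrite rsum_delta_l; auto.
      + intros; rewrite E by auto; ring. }
  assert (trK : tr n K = 2 * (tr n A ^ 2 - nrm2 n A) - INR n * k).
  { rewrite trE; unfold K; rewrite rsum_minus, !rsum_scal_l, rsum_minus, rsum_scal_l.
    fold (tr n A) (tr n (sq n A)) (tr n idf); rewrite tr_idf, tr_sq by auto; ring. }
  destruct (einstein_Ric0 n T' mu ltac:(lia) ET') as [scT' R0].
  assert (trH' : tr n H' = 4 * lam * h + INR n * (4 * (INR n - 1) * a ^ 2 - 4 * tr n A * a
     + nrm2 n A - k) + (4 * tr n A - 4 * (INR n - 2) * a) * tr n A - 4 * nrm2 n A).
  { rewrite trE; unfold H'; rewrite rsum_minus, !rsum_plus, !rsum_scal_l.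
    fold (tr n H) (tr n (cstar n T H)) (tr n idf) (tr n A) (tr n (sq n A)).
    rewrite (tr_cstar n T H lam), tr_idf, tr_sq by auto; fold h; ring. }
  exists T', H'; split; [apply Qop_split; auto|]; split; [|split; [auto|split; [|split; [|split]]]].
  - apply act_lin; [apply act_Qop; auto|]; unfold D.
    apply (act_lin n (fun i j k' l => (INR n - 2) * kn A A i j k' l)).
    + apply (act_ext n (fun i j k' l => kn A A i j k' l + (INR n - 3) * kn A A i j k' l)).
      * intros i j k' l _ _ _ _; ring.
      * apply act_lin; apply act_kn; auto.
    + apply act_kn; auto; apply idf_sym.
  - intros i j Hi Hj; unfold H'.
    rewrite (S i j), (cstar_sym n T H AT S i j), (SA i j), (sq_sym n A SA i j), (idf_sym n i j)
      by auto; reflexivity.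
  - intros x y u v Z; unfold T'; rewrite pic2_re_lin, tt.
    pose proof (Q_nonneg_at_null n T x y u v PT Z).
    pose proof (error_term_bound n s c a A x y u v Hn Hs Hc C1 C2 SA PA Et).
    unfold D, K, k; lra.
  - intros e De Z; rewrite BA in Z; assert (Ze : bil n A e e = 0) by nra.
    assert (bH' : bil n H' e e = 2 * lam * bil n H e e + 2 * bil n (cstar n T H) e e
       + (4 * (INR n - 1) * a ^ 2 - 4 * tr n A * a + nrm2 n A - k) * bil n idf e e
       + (4 * tr n A - 4 * (INR n - 2) * a) * bil n A e e - 4 * bil n (sq n A) e e).
    { unfold H', bil; rewrite <- !rsum_scal_l; repeat rewrite <- ?rsum_minus, <- ?rsum_plus.
      apply rsum_ext; intros; rewrite <- !rsum_scal_l; repeat rewrite <- ?rsum_minus, <- ?rsum_plus.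
      apply rsum_ext; intros; ring. }
    assert (bH : bil n H e e = a).
    { rewrite <- (Rmult_1_r a), <- De, <- bil_idf.
      replace (bil n H e e) with (a * bil n idf e e - bil n A e e); [lra|].
      unfold bil; rewrite <- rsum_scal_l, <- rsum_minus; apply rsum_ext; intros.
      rewrite <- rsum_scal_l, <- rsum_minus; apply rsum_ext; intros; unfold A; ring. }
    (* Since [H = a id - A] and [h = (n - 2 s) a], the [lam] terms of [tr H'] and [H' (e, e)] cancel
       in the goal, and [T * A] enters it with a favourable sign. *)
    assert (bC : bil n (cstar n T H) e e = a * lam - bil n (cstar n T A) e e).
    { transitivity (bil n (fun i j => a * Ric n T i j + -1 * cstar n T A i j) e e).
      - apply bil_form_ext; intros i j Hi Hj; unfold cstar, A, Ric.
        rewrite <- !rsum_scal_l, <- rsum_plus; apply rsum_ext; intros p Hp.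
        rewrite <- (rsum_delta_r n p (fun q => T i p j q)) by auto.
        rewrite <- !rsum_scal_l, <- rsum_plus; apply rsum_ext; intros q Hq.
        unfold idf; rewrite (kdelta_sym q p); ring.
      - rewrite (bil_form_lin n (fun i j => a * Ric n T i j)).
        rewrite (bil_form_ext n (fun i j => a * Ric n T i j) (fun i j => 0 + (a * lam) * idf i j)).
        + rewrite (bil_form_lin n (fun _ _ => 0)), bil_idf, De.
          replace (bil n (fun _ _ => 0) e e) with 0; [ring|].
          symmetry; apply rsum_0; intros; apply rsum_0; intros; ring.
        + intros; rewrite E by auto; unfold idf; ring. }
    rewrite bil_gform, De, trH', bH', bH, bC, bil_idf, De, Ze, (bil_sq_null n A e) by auto.
    pose proof (bil_cstar_nonneg n T A e PT SA PA) as BC.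
    assert (Y : 0 <= (INR n - 2 * s) * bil n (cstar n T A) e e) by (apply Rmult_le_pos; lra).
    assert (Ek : s * k = 2 * a * tr n A - (2 - s) * nrm2 n A - c * s * tr n A ^ 2)
      by (unfold k; field; lra).
    rewrite tt, Eh.
    match goal with |- ?l <= ?r => assert (X : r - l = 2 * ((INR n - 2 * s) * bil n (cstar n T A) e e)
      + 2 * (2 * a * tr n A - (2 - s) * nrm2 n A - c * s * tr n A ^ 2 - s * k)) end.
    { rewrite Et; ring. }
    rewrite Ek in X; lra.
  - intros theta Hth.
    (* From here every quadratic quantity is compared with [a^2], which is at most [h^2] because
       [n - 2 s >= 1]. *)
    assert (Ek : k = 4 * a ^ 2 - (2 - s) * (nrm2 n A / s) - c * tr n A ^ 2).
    { unfold k; rewrite Et; field; lra. }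
    assert (k1 : k <= 4 * a ^ 2).
    { assert (0 <= nrm2 n A / s) by (apply Rmult_le_pos; [lra|left; apply Rinv_0_lt_compat; lra]).
      assert (0 <= c * tr n A ^ 2) by (apply Rmult_le_pos; [auto|apply pow2_ge_0]).
      assert (0 <= (2 - s) * (nrm2 n A / s)) by (apply Rmult_le_pos; lra).
      lra. }
    assert (a2 : a ^ 2 <= h ^ 2) by (apply pow_incr; lra).
    assert (t0 : 0 <= tr n A <= 4 * a) by (rewrite Et; nra).
    assert (t2 : tr n A ^ 2 <= 16 * a ^ 2).
    { replace (16 * a ^ 2) with ((4 * a) ^ 2) by ring; apply pow_incr; lra. }
    assert (ta : tr n A * a <= 4 * a ^ 2) by nra.
    assert (low : 4 * lam * h - (36 * INR n + 64) * a ^ 2 <= tr n H').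
    { rewrite trH'.
      assert (0 <= INR n * (4 * (INR n - 1) * a ^ 2 + nrm2 n A)).
      { apply Rmult_le_pos; [lra|]; apply Rplus_le_le_0_compat; [|lra].
        apply Rmult_le_pos; [lra|apply pow2_ge_0]. }
      assert (INR n * (4 * (tr n A * a) + k) <= INR n * (20 * a ^ 2)) by
        (apply Rmult_le_compat_l; lra).
      assert (INR n * (tr n A * a) <= INR n * (4 * a ^ 2)) by (apply Rmult_le_compat_l; lra).
      assert (0 <= tr n A * a) by (apply Rmult_le_pos; lra).
      assert (0 <= tr n A ^ 2) by apply pow2_ge_0.
      lra. }
    assert (up : scal n T' <= 2 * INR n * lam ^ 2 + 8 * INR n ^ 2 * a ^ 2).
    { rewrite scT'; unfold mu; rewrite trK.
      assert (INR n * (2 * (INR n - 1) * k) <= INR n * (8 * INR n * a ^ 2)).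
      { apply Rmult_le_compat_l; [lra|].
        apply Rle_trans with (2 * (INR n - 1) * (4 * a ^ 2)).
        - apply Rmult_le_compat_l; lra.
        - pose proof (pow2_ge_0 a); lra. }
      assert (0 <= INR n * (2 * (tr n A ^ 2 - nrm2 n A))) by (apply Rmult_le_pos; lra).
      lra. }
    unfold growth.
    assert (theta * scal n T' <= theta * (2 * INR n * lam ^ 2 + 8 * INR n ^ 2 * a ^ 2))
      by (apply Rmult_le_compat_l; lra).
    assert (theta * (8 * INR n ^ 2 * a ^ 2) <= 1 * (8 * INR n ^ 2 * h ^ 2)).
    { apply Rmult_le_compat; try lra.
      - apply Rmult_le_pos; [|apply pow2_ge_0]; pose proof (pow2_ge_0 (INR n)); lra.
      - apply Rmult_le_compat_l; auto; pose proof (pow2_ge_0 (INR n)); lra. }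
    assert ((36 * INR n + 64) * a ^ 2 <= (36 * INR n + 64) * h ^ 2)
      by (apply Rmult_le_compat_l; lra).
    lra.
Qed.

(** * Infinitesimal invariance *)

(** If no step worked, counterexamples with [tau <= 1 / (m + 1)] would accumulate at a point of [D]
    where [f = 0] and [g <= 0]. Points are sequences of which the first [N] coordinates matter, and
    compactness of [D] is expressed by sequences. *)
Lemma compact_perturbation N (D : (nat -> R) -> Prop) (f g : (nat -> R) -> R) :
  (forall x i, D x -> (i < N)%nat -> Rabs (x i) <= 1) ->
  (forall (u : nat -> nat -> R) l, (forall i, (i < N)%nat -> Un_cv (fun m => u m i) (l i)) ->
     ((forall m, D (u m)) -> D l) /\
     Un_cv (fun m => f (u m)) (f l) /\ Un_cv (fun m => g (u m)) (g l)) ->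
  (forall x, D x -> 0 <= f x) -> (forall x, D x -> f x = 0 -> 0 < g x) ->
  exists tau0, 0 < tau0 /\ forall tau x, 0 < tau <= tau0 -> D x -> 0 <= f x + tau * g x.
Proof.
  intros B C F G; apply NNPP; intros Neg.
  assert (bad : forall m : nat, exists p : R * (nat -> R),
    0 < fst p <= / (INR m + 1) /\ D (snd p) /\ f (snd p) + fst p * g (snd p) < 0).
  { intros m; apply NNPP; intros N1; apply Neg.
    exists (/ (INR m + 1)); split.
    - apply Rinv_0_lt_compat; pose proof (pos_INR m); lra.
    - intros tau x Ht Dx; apply Rnot_lt_le; intros L; apply N1; exists (tau, x); auto. }
  apply choice in bad; destruct bad as [p Hp].
  destruct (bolzano_weierstrass_vec N (fun m => snd (p m)) 1) as [phi [l [I Cl]]].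
  { intros m i Hi; apply B; auto; apply Hp. }
  destruct (C (fun m => snd (p (phi m))) l Cl) as [Dl [Cf Cg]].
  specialize (Dl (fun m => proj1 (proj2 (Hp (phi m))))).
  assert (Ct : Un_cv (fun m => fst (p (phi m))) 0).
  { apply (Un_cv_subseq (fun m => fst (p m))); auto.
    intros eps He; destruct (Un_cv_inv_succ eps He) as [M HM]; exists M; intros m Hm.
    specialize (HM m Hm); unfold Rdist in *; rewrite Rminus_0_r in *.
    destruct (Hp m) as [[H1 H2] _]; rewrite Rabs_right in * by lra; lra. }
  assert (f0 : f l = 0).
  { apply Rle_antisym; [|auto].
    apply (Un_cv_le (fun m => f (snd (p (phi m))))
      (fun m => - (fst (p (phi m)) * g (snd (p (phi m)))))); auto.
    - intros m; destruct (Hp (phi m)) as [_ [_ H]]; lra.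
    - replace 0 with (- (0 * g l)) by ring.
      apply (CV_opp (fun m => fst (p (phi m)) * g (snd (p (phi m))))).
      apply (CV_mult (fun m => fst (p (phi m))) (fun m => g (snd (p (phi m))))); auto. }
  assert (g l <= 0).
  { apply (Un_cv_le (fun m => g (snd (p (phi m)))) (fun _ => 0)); auto.
    - intros m; destruct (Hp (phi m)) as [[H1 _] [Dm H]]; specialize (F _ Dm).
      apply Rnot_lt_le; intros L.
      pose proof (Rmult_lt_0_compat _ _ H1 L); lra.
    - apply Un_cv_const. }
  specialize (G l Dl f0); lra.
Qed.

Lemma Un_cv_sum4 n (F : nat -> nat -> nat -> nat -> nat -> R) G :
  (forall i j k l, (i < n)%nat -> (j < n)%nat -> (k < n)%nat -> (l < n)%nat ->
     Un_cv (fun m => F m i j k l) (G i j k l)) ->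
  Un_cv (fun m => sum4 n (F m)) (sum4 n G).
Proof.
  intros C; unfold sum4; do 4 (apply Un_cv_rsum; intros); auto.
Qed.

Lemma Un_cv_ev n (T : nat -> Tensor) T' (a b c d : nat -> nat -> R) a' b' c' d' :
  (forall i j k l, (i < n)%nat -> (j < n)%nat -> (k < n)%nat -> (l < n)%nat ->
     Un_cv (fun m => T m i j k l) (T' i j k l)) ->
  (forall i, (i < n)%nat -> Un_cv (fun m => a m i) (a' i)) ->
  (forall i, (i < n)%nat -> Un_cv (fun m => b m i) (b' i)) ->
  (forall i, (i < n)%nat -> Un_cv (fun m => c m i) (c' i)) ->
  (forall i, (i < n)%nat -> Un_cv (fun m => d m i) (d' i)) ->
  Un_cv (fun m => ev n (T m) (a m) (b m) (c m) (d m)) (ev n T' a' b' c' d').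
Proof.
  intros CT Ca Cb Cc Cd.
  apply (Un_cv_sum4 n (fun m i j k l => T m i j k l * (a m i * b m j * c m k * d m l))
    (fun i j k l => T' i j k l * (a' i * b' j * c' k * d' l))).
  intros; repeat apply CV_mult; auto.
Qed.

Lemma Un_cv_pic2_re n (T : nat -> Tensor) T' (x y u v : nat -> nat -> R) x' y' u' v' :
  (forall i j k l, (i < n)%nat -> (j < n)%nat -> (k < n)%nat -> (l < n)%nat ->
     Un_cv (fun m => T m i j k l) (T' i j k l)) ->
  (forall i, (i < n)%nat -> Un_cv (fun m => x m i) (x' i)) ->
  (forall i, (i < n)%nat -> Un_cv (fun m => y m i) (y' i)) ->
  (forall i, (i < n)%nat -> Un_cv (fun m => u m i) (u' i)) ->
  (forall i, (i < n)%nat -> Un_cv (fun m => v m i) (v' i)) ->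
  Un_cv (fun m => pic2_re n (T m) (x m) (y m) (u m) (v m)) (pic2_re n T' x' y' u' v').
Proof.
  intros CT Cx Cy Cu Cv.
  apply Un_cv_ext with (fun m => cev n (T m) (x m) (y m) (u m) (v m) (x m) (y m) (u m) (v m)).
  { intros; symmetry; apply pic2_re_cev. }
  rewrite pic2_re_cev; unfold cev.
  repeat first [apply Un_cv_ev; assumption | apply CV_minus | apply CV_plus].
Qed.

(** Orthonormality of [x + i y] and [u + i v] for the Hermitian product. Such pairs form a compact
    set, on which [id . id] has the constant value 2. *)
Definition unitary (n : nat) (x y u v : nat -> R) : Prop :=
  dot n x x + dot n y y = 1 /\ dot n u u + dot n v v = 1 /\
  dot n x u + dot n y v = 0 /\ dot n y u - dot n x v = 0.

Lemma ev_kn_idf n a b c d :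
  ev n (kn idf idf) a b c d = 2 * (dot n a c * dot n b d - dot n a d * dot n b c).
Proof.
  transitivity (2 * sum4 n (fun i j k l => (idf i k * a i * c k) * (idf j l * b j * d l))
    + (-2) * sum4 n (fun i j k l => (idf i l * a i * d l) * (idf j k * b j * c k))).
  - unfold ev; rewrite <- !sum4_scal, <- sum4_plus; apply sum4_ext; intros; unfold kn; ring.
  - rewrite sum4_swap23, (sum4_swap34 n (fun i j k l => idf i l * a i * d l * (idf j k * b j * c k))).
    rewrite (sum4_swap23 n (fun i j k l => idf i k * a i * d k * (idf j l * b j * c l))).
    rewrite (sum4_prod_12_34 n (fun i k => idf i k * a i * c k) (fun j l => idf j l * b j * d l)),
      (sum4_prod_12_34 n (fun i l => idf i l * a i * d l) (fun j k => idf j k * b j * c k)).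
    fold (bil n idf a c) (bil n idf b d) (bil n idf a d) (bil n idf b c).
    rewrite !bil_idf; ring.
Qed.

Lemma pic2_re_idf_unitary n x y u v : unitary n x y u v -> pic2_re n (kn idf idf) x y u v = 2.
Proof.
  intros [N1 [N2 [O1 O2]]]; rewrite pic2_re_cev; unfold cev; rewrite !ev_kn_idf.
  rewrite (dot_sym n u x), (dot_sym n v x), (dot_sym n u y), (dot_sym n v y),
    (dot_sym n v u), (dot_sym n y x).
  replace (dot n x x) with (1 - dot n y y) by lra.
  replace (dot n u u) with (1 - dot n v v) by lra.
  replace (dot n y u) with (dot n x v) by lra.
  replace (dot n y v) with (- dot n x u) by lra; ring.
Qed.

Lemma pic2_re_scal_l n T s x y u v :
  pic2_re n T (fun i => s * x i) (fun i => s * y i) u v = s ^ 2 * pic2_re n T x y u v.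
Proof. unfold pic2_re; rewrite <- sum4_scal; apply sum4_ext; intros; ring. Qed.

Lemma pic2_re_scal_r n T s x y u v :
  pic2_re n T x y (fun i => s * u i) (fun i => s * v i) = s ^ 2 * pic2_re n T x y u v.
Proof. unfold pic2_re; rewrite <- sum4_scal; apply sum4_ext; intros; ring. Qed.

(** Adding the multiple [(al - i be) z] of [z = x + i y] to [w = u + i v] changes nothing because
    [T] is alternating in each pair. *)
Lemma pic2_re_shift n T al be x y u v : is_act n T ->
  pic2_re n T x y (fun i => u i + al * x i + be * y i) (fun i => v i + al * y i + - be * x i) =
  pic2_re n T x y u v.
Proof.
  intros A.
  assert (Z1 : forall a c d, ev n T a a c d = 0).
  { intros; pose proof (ev_anti12 n T a a c d A); lra. }
  assert (Z2 : forall a c d, ev n T c d a a = 0).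
  { intros; pose proof (ev_anti34 n T c d a a A); lra. }
  rewrite !pic2_re_cev; unfold cev.
  repeat rewrite ?ev_lin2, ?ev_lin4; rewrite !Z1, !Z2.
  rewrite (ev_anti12 n T y x), (ev_anti12 n T y x y v), (ev_anti34 n T x u y x),
    (ev_anti34 n T y v y x) by auto.
  repeat match goal with |- context [ev n T y x ?c ?d] => rewrite (ev_anti12 n T y x c d A) end.
  repeat match goal with |- context [ev n T ?c ?d y x] => rewrite (ev_anti34 n T c d y x A) end.
  ring.
Qed.

Lemma pic2_re_zero n T x y u v :
  (forall i, (i < n)%nat -> x i = 0 /\ y i = 0) \/ (forall i, (i < n)%nat -> u i = 0 /\ v i = 0) ->
  pic2_re n T x y u v = 0.
Proof.
  intros Z; unfold pic2_re; rewrite (sum4_ext n _ (fun i j k l => 0 * 0)).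
  - rewrite sum4_scal; ring.
  - intros i j k l Hi Hj Hk Hl; destruct Z as [Z|Z].
    + destruct (Z i Hi) as [-> ->]; ring.
    + destruct (Z j Hj) as [-> ->]; ring.
Qed.

(** Gram-Schmidt for a complex pair: scalings multiply the value by a square, and projecting [w] off
    [z] is a shift that leaves it unchanged. If a vector to be normalised vanishes, the value is
    0. *)
Lemma pic2_re_nonneg_of_unitary n T : is_act n T ->
  (forall x y u v, unitary n x y u v -> 0 <= pic2_re n T x y u v) ->
  forall x y u v, 0 <= pic2_re n T x y u v.
Proof.
  intros A P.
  assert (norm : forall x y, 0 < dot n x x + dot n y y -> exists r, 0 < r /\
     dot n (fun i => / r * x i) (fun i => / r * x i)
     + dot n (fun i => / r * y i) (fun i => / r * y i) = 1).
  { intros x y N; exists (sqrt (dot n x x + dot n y y)).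
    pose proof (sqrt_lt_R0 _ N) as N'; pose proof (sqrt_sqrt (dot n x x + dot n y y) ltac:(lra)) as SS.
    set (r := sqrt (dot n x x + dot n y y)) in *; split; auto.
    rewrite !dot_scal_l, (dot_sym n x), (dot_sym n y), !dot_scal_l.
    replace (/ r * (/ r * dot n x x) + / r * (/ r * dot n y y)) with
      (/ r * / r * (dot n x x + dot n y y)) by ring.
    rewrite <- SS; field; lra. }
  assert (P1 : forall x y u v, dot n x x + dot n y y = 1 ->
     dot n x u + dot n y v = 0 -> dot n y u - dot n x v = 0 -> 0 <= pic2_re n T x y u v).
  { intros x y u v N O1 O2.
    pose proof (dot_nonneg n u); pose proof (dot_nonneg n v).
    destruct (Rle_lt_dec (dot n u u + dot n v v) 0) as [L|L].
    - rewrite pic2_re_zero; [lra|]; right; intros i Hi; split; apply (dot_eq0 n); auto; lra.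
    - destruct (norm u v L) as [r [r0 N1]].
      assert (E : pic2_re n T x y u v =
        r ^ 2 * pic2_re n T x y (fun i => / r * u i) (fun i => / r * v i))
        by (rewrite pic2_re_scal_r; field; lra).
      rewrite E; apply Rmult_le_pos; [apply pow2_ge_0|]; apply P; repeat split; auto.
      + rewrite (dot_sym n x), (dot_sym n y), !dot_scal_l, (dot_sym n u), (dot_sym n v).
        rewrite <- Rmult_plus_distr_l, O1; ring.
      + rewrite (dot_sym n x), (dot_sym n y), !dot_scal_l, (dot_sym n u), (dot_sym n v).
        rewrite <- Rmult_minus_distr_l, O2; ring. }
  assert (P2 : forall x y u v, dot n x x + dot n y y = 1 -> 0 <= pic2_re n T x y u v).
  { intros x y u v N.
    rewrite <- (pic2_re_shift n T (- (dot n x u + dot n y v)) (- (dot n y u - dot n x v)))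
      by auto; apply P1; auto.
    - rewrite !dot_lin_r, (dot_sym n y x).
      replace (dot n x x) with (1 - dot n y y) by lra; ring.
    - rewrite !dot_lin_r, (dot_sym n y x).
      replace (dot n x x) with (1 - dot n y y) by lra; ring. }
  intros x y u v.
  pose proof (dot_nonneg n x); pose proof (dot_nonneg n y).
  destruct (Rle_lt_dec (dot n x x + dot n y y) 0) as [L|L].
  - rewrite pic2_re_zero; [lra|]; left; intros i Hi; split; apply (dot_eq0 n); auto; lra.
  - destruct (norm x y L) as [r [r0 N1]].
    assert (E : pic2_re n T x y u v =
      r ^ 2 * pic2_re n T (fun i => / r * x i) (fun i => / r * y i) u v)
      by (rewrite pic2_re_scal_l; field; lra).
    rewrite E; apply Rmult_le_pos; [apply pow2_ge_0|]; auto.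
Qed.

Lemma pic2_perturbation n T T' : PIC2 n T -> is_act n T' ->
  (forall x y u v, unitary n x y u v -> pic2_re n T x y u v = 0 -> 0 < pic2_re n T' x y u v) ->
  exists tau0, 0 < tau0 /\ forall tau, 0 < tau <= tau0 ->
    PIC2 n (fun i j k l => T i j k l + tau * T' i j k l).
Proof.
  intros [A P] A' Pos.
  (* The four real vectors are stored in one vector of length [4 n], with [sl q] its slice number
     [q], to fit [compact_perturbation]. *)
  set (sl := fun (q : nat) (p : nat -> R) i => p (q * n + i)%nat).
  destruct (compact_perturbation (4 * n) (fun p => unitary n (sl 0%nat p) (sl 1%nat p) (sl 2%nat p) (sl 3%nat p))
     (fun p => pic2_re n T (sl 0%nat p) (sl 1%nat p) (sl 2%nat p) (sl 3%nat p))
     (fun p => pic2_re n T' (sl 0%nat p) (sl 1%nat p) (sl 2%nat p) (sl 3%nat p))) as [tau0 [t0 Ht]].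
  - intros p i [N1 [N2 _]] Hi.
    pose proof (dot_nonneg n (sl 0%nat p)); pose proof (dot_nonneg n (sl 1%nat p)).
    pose proof (dot_nonneg n (sl 2%nat p)); pose proof (dot_nonneg n (sl 3%nat p)).
    assert (X : forall q, dot n (sl q p) (sl q p) <= 1 -> (q * n <= i < q * n + n)%nat ->
      Rabs (p i) <= 1).
    { intros q D L; replace i with (q * n + (i - q * n))%nat by lia.
      apply (dot_bounds_entry n (sl q p)); auto; lia. }
    destruct (le_lt_dec n i); [destruct (le_lt_dec (2 * n) i); [destruct (le_lt_dec (3 * n) i)|]|].
    + apply (X 3%nat); [lra|lia].
    + apply (X 2%nat); [lra|lia].
    + apply (X 1%nat); [lra|lia].
    + apply (X 0%nat); [lra|lia].
  - intros w l C.
    assert (Cs : forall q, (q < 4)%nat -> forall i, (i < n)%nat ->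
      Un_cv (fun m => sl q (w m) i) (sl q l i)).
    { intros q Hq i Hi; apply C; nia. }
    split; [|split].
    + intros D.
      assert (Cd : forall q r, (q < 4)%nat -> (r < 4)%nat ->
        Un_cv (fun m => dot n (sl q (w m)) (sl r (w m))) (dot n (sl q l) (sl r l))).
      { intros; apply Un_cv_dot; auto. }
      repeat split.
      * apply UL_sequence with (fun m => dot n (sl 0%nat (w m)) (sl 0%nat (w m))
          + dot n (sl 1%nat (w m)) (sl 1%nat (w m))).
        -- apply (CV_plus (fun m => dot n (sl 0%nat (w m)) (sl 0%nat (w m)))
             (fun m => dot n (sl 1%nat (w m)) (sl 1%nat (w m)))); apply Cd; lia.
        -- apply Un_cv_ext with (fun _ => 1); [|apply Un_cv_const].
           intros m; symmetry; apply (D m).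
      * apply UL_sequence with (fun m => dot n (sl 2%nat (w m)) (sl 2%nat (w m))
          + dot n (sl 3%nat (w m)) (sl 3%nat (w m))).
        -- apply (CV_plus (fun m => dot n (sl 2%nat (w m)) (sl 2%nat (w m)))
             (fun m => dot n (sl 3%nat (w m)) (sl 3%nat (w m)))); apply Cd; lia.
        -- apply Un_cv_ext with (fun _ => 1); [|apply Un_cv_const].
           intros m; symmetry; apply (D m).
      * apply UL_sequence with (fun m => dot n (sl 0%nat (w m)) (sl 2%nat (w m))
          + dot n (sl 1%nat (w m)) (sl 3%nat (w m))).
        -- apply (CV_plus (fun m => dot n (sl 0%nat (w m)) (sl 2%nat (w m)))
             (fun m => dot n (sl 1%nat (w m)) (sl 3%nat (w m)))); apply Cd; lia.
        -- apply Un_cv_ext with (fun _ => 0); [|apply Un_cv_const].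
           intros m; symmetry; apply (D m).
      * apply UL_sequence with (fun m => dot n (sl 1%nat (w m)) (sl 2%nat (w m))
          - dot n (sl 0%nat (w m)) (sl 3%nat (w m))).
        -- apply (CV_minus (fun m => dot n (sl 1%nat (w m)) (sl 2%nat (w m)))
             (fun m => dot n (sl 0%nat (w m)) (sl 3%nat (w m)))); apply Cd; lia.
        -- apply Un_cv_ext with (fun _ => 0); [|apply Un_cv_const].
           intros m; symmetry; apply (D m).
    + apply (Un_cv_pic2_re n (fun _ => T)); try (apply Cs; lia); intros; apply Un_cv_const.
    + apply (Un_cv_pic2_re n (fun _ => T')); try (apply Cs; lia); intros; apply Un_cv_const.
  - intros; apply P.
  - intros; apply Pos; auto.
  - exists tau0; split; auto; intros tau Htau.
    assert (AN : is_act n (fun i j k l => T i j k l + tau * T' i j k l)) by (apply act_lin; auto).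
    split; auto; intros x y u v; split; [apply pic2_im_act; auto|].
    revert x y u v; apply pic2_re_nonneg_of_unitary; auto; intros x y u v U.
    rewrite pic2_re_lin.
    set (p := fun i => if Nat.ltb i n then x i else if Nat.ltb i (2 * n) then y (i - n)%nat
       else if Nat.ltb i (3 * n) then u (i - 2 * n)%nat else v (i - 3 * n)%nat).
    assert (E0 : forall i, (i < n)%nat -> sl 0%nat p i = x i).
    { intros i Hi; unfold sl, p; replace (0 * n + i)%nat with i by lia.
      destruct (Nat.ltb_spec i n); [auto|lia]. }
    assert (E1 : forall i, (i < n)%nat -> sl 1%nat p i = y i).
    { intros i Hi; unfold sl, p; destruct (Nat.ltb_spec (1 * n + i) n); [lia|].
      destruct (Nat.ltb_spec (1 * n + i) (2 * n)); [f_equal; lia|lia]. }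
    assert (E2 : forall i, (i < n)%nat -> sl 2%nat p i = u i).
    { intros i Hi; unfold sl, p; destruct (Nat.ltb_spec (2 * n + i) n); [lia|].
      destruct (Nat.ltb_spec (2 * n + i) (2 * n)); [lia|].
      destruct (Nat.ltb_spec (2 * n + i) (3 * n)); [f_equal; lia|lia]. }
    assert (E3 : forall i, (i < n)%nat -> sl 3%nat p i = v i).
    { intros i Hi; unfold sl, p; destruct (Nat.ltb_spec (3 * n + i) n); [lia|].
      destruct (Nat.ltb_spec (3 * n + i) (2 * n)); [lia|].
      destruct (Nat.ltb_spec (3 * n + i) (3 * n)); [lia|f_equal; lia]. }
    assert (Ed : forall a b a' b', (forall i, (i < n)%nat -> a i = a' i) ->
      (forall i, (i < n)%nat -> b i = b' i) -> dot n a b = dot n a' b').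
    { intros a b a' b' Ea Eb; apply rsum_ext; intros; rewrite Ea, Eb; auto. }
    assert (Ep : forall T, pic2_re n T (sl 0%nat p) (sl 1%nat p) (sl 2%nat p) (sl 3%nat p) =
      pic2_re n T x y u v).
    { intros T0; apply sum4_ext; intros; rewrite !E0, !E1, !E2, !E3 by auto; reflexivity. }
    rewrite <- !Ep; apply Ht; auto; unfold unitary.
    rewrite (Ed _ _ x x E0 E0), (Ed _ _ y y E1 E1), (Ed _ _ u u E2 E2), (Ed _ _ v v E3 E3),
      (Ed _ _ x u E0 E2), (Ed _ _ y v E1 E3), (Ed _ _ y u E1 E2), (Ed _ _ x v E0 E3); exact U.
Qed.

Lemma psd_of_unit n A : (forall e, dot n e e = 1 -> 0 <= bil n A e e) -> psd n A.
Proof.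
  intros P x; change (0 <= bil n A x x).
  destruct (Rle_lt_dec (dot n x x) 0) as [L|L].
  - right; symmetry; apply rsum_0; intros i Hi; apply rsum_0; intros j Hj.
    rewrite (dot_eq0 n x i) by auto; ring.
  - pose proof (sqrt_lt_R0 _ L) as L'; pose proof (sqrt_sqrt (dot n x x) ltac:(lra)) as SS.
    set (r := sqrt (dot n x x)) in *.
    assert (E : bil n A x x = r * r * bil n A (fun i => / r * x i) (fun i => / r * x i))
      by (rewrite bil_scal; field; lra).
    rewrite E; apply Rmult_le_pos; [nra|]; apply P.
    rewrite dot_scal_l, dot_sym, dot_scal_l, <- SS; field; lra.
Qed.

Lemma psd_perturbation n A B : psd n A ->
  (forall e, dot n e e = 1 -> bil n A e e = 0 -> 0 < bil n B e e) ->
  exists tau0, 0 < tau0 /\ forall tau, 0 < tau <= tau0 ->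
    psd n (fun i j => A i j + tau * B i j).
Proof.
  intros P Pos.
  destruct (compact_perturbation n (fun e => dot n e e = 1) (fun e => bil n A e e)
    (fun e => bil n B e e)) as [tau0 [t0 Ht]].
  - intros x i D Hi; apply (dot_bounds_entry n); auto; lra.
  - intros w l C; split; [|split].
    + intros D; apply UL_sequence with (fun m => dot n (w m) (w m)); [apply Un_cv_dot; auto|].
      apply Un_cv_ext with (fun _ => 1); auto; apply Un_cv_const.
    + apply (Un_cv_bil n (fun _ => A)); auto; intros; apply Un_cv_const.
    + apply (Un_cv_bil n (fun _ => B)); auto; intros; apply Un_cv_const.
  - intros e _; apply P.
  - exact Pos.
  - exists tau0; split; auto; intros tau Htau; apply psd_of_unit; intros e De.
    rewrite bil_form_lin; auto.
Qed.

(* A share [id . id] is added to the Einstein part and the rest to the trace part, which makes every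
   condition defining the tangent cone strict. *)
Definition barrier (n : nat) (theta : R) : Tensor :=
  fun i j k l => (2 * theta * INR n + 2) * kn idf idf i j k l.

(** The hypotheses on [T'] and [H'] are weak inequalities at boundary points only. The barrier makes
    them strict, and compactness then yields actual steps inside the cone rather than a limiting
    direction. *)
Lemma tangent_criterion n s theta eps T H T' H' : (0 < n)%nat -> 0 < s -> 0 <= theta -> 0 < eps ->
  PIC2 n T -> (forall i k, (i < n)%nat -> (k < n)%nat -> Ric0 n T i k = 0) ->
  is_sym n H -> psd n (gform n s H) -> 0 <= tr n H - theta * scal n T ->
  is_act n T' -> (forall i k, (i < n)%nat -> (k < n)%nat -> Ric0 n T' i k = 0) -> is_sym n H' ->
  (forall x y u v, unitary n x y u v -> pic2_re n T x y u v = 0 -> 0 <= pic2_re n T' x y u v) ->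
  (forall e, dot n e e = 1 -> bil n (gform n s H) e e = 0 -> 0 <= bil n (gform n s H') e e) ->
  (tr n H = theta * scal n T -> 0 <= tr n H' - theta * scal n T') ->
  exists tau0, 0 < tau0 /\ forall tau, 0 < tau <= tau0 ->
    Ccone n s theta (fun i j k l => (T i j k l + kn H idf i j k l)
      + tau * ((T' i j k l + kn H' idf i j k l) + eps * barrier n theta i j k l)).
Proof.
  intros Hn Hs Hth He PT RT SH PH TH AT' RT' SH' P1 P2 P3.
  assert (N0 : 1 <= INR n) by (apply le_INR in Hn; simpl in Hn; lra).
  (* Adding [id . id] to the Einstein part raises [theta scal] by [theta (2 n - 2) n], while [c id]
     raises the trace by [c n]. The trace condition thus gains [n (1 + 2 theta)] per unit of [eps];
     the coefficient in [barrier] is [1 + c]. *)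
  set (c := 2 * theta * INR n + 1).
  assert (tn : 0 <= theta * INR n) by (apply Rmult_le_pos; lra).
  assert (c1 : 1 <= c) by (unfold c; lra).
  assert (AI : is_act n (kn idf idf)) by (apply act_kn; apply idf_sym).
  set (Te := fun i j k l => T' i j k l + eps * kn idf idf i j k l).
  set (He' := fun i j => H' i j + (eps * c) * idf i j).
  assert (ATe : is_act n Te) by (apply act_lin; auto).
  assert (RI : forall i k, (i < n)%nat -> (k < n)%nat -> Ric0 n (kn idf idf) i k = 0).
  { apply (einstein_Ric0 n _ (2 * INR n - 2) Hn); intros i k Hi Hk.
    rewrite Ric_kn, tr_idf by auto; unfold idf; ring. }
  assert (R0lin : forall A B t, (forall i k, (i < n)%nat -> (k < n)%nat -> Ric0 n A i k = 0) ->
     (forall i k, (i < n)%nat -> (k < n)%nat -> Ric0 n B i k = 0) ->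
     forall i k, (i < n)%nat -> (k < n)%nat ->
       Ric0 n (fun i j k l => A i j k l + t * B i j k l) i k = 0).
  { intros A B t EA EB i k Hi Hk; specialize (EA i k Hi Hk); specialize (EB i k Hi Hk).
    unfold Ric0 in *; rewrite Ric_lin, scal_lin.
    replace (Ric n A i k) with (/ INR n * scal n A * kdelta i k) by lra.
    replace (Ric n B i k) with (/ INR n * scal n B * kdelta i k) by lra; ring. }
  destruct (pic2_perturbation n T Te) as [t1 [t1p Ht1]]; auto.
  { intros x y u v U Z; unfold Te; rewrite pic2_re_lin, pic2_re_idf_unitary by auto.
    specialize (P1 x y u v U Z); lra. }
  destruct (psd_perturbation n (gform n s H) (gform n s He')) as [t2 [t2p Ht2]]; auto.
  { intros e De Z.
    assert (E : bil n (gform n s He') e e = bil n (gform n s H') e e + (eps * c) * (2 * s)).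
    { rewrite !bil_gform; unfold He'; rewrite tr_lin, bil_form_lin, bil_idf, tr_idf, De; ring. }
    rewrite E; specialize (P2 e De Z).
    assert (0 < (eps * c) * (2 * s)) by (repeat apply Rmult_lt_0_compat; lra); lra. }
  set (f := tr n H - theta * scal n T) in *.
  set (g := tr n He' - theta * scal n Te).
  assert (Eg : g = tr n H' - theta * scal n T' + eps * (INR n * (1 + 2 * theta))).
  { unfold g, He', Te; rewrite tr_lin, scal_lin, scal_kn, tr_idf; unfold c; ring. }
  assert (g0 : 0 < eps * (INR n * (1 + 2 * theta))) by (repeat apply Rmult_lt_0_compat; lra).
  (* A strict trace condition survives for [tau <= f / (1 + |g|)]; in the equality case [g > 0], and
     any bound on [tau] will do. *)
  assert (exists t3, 0 < t3 /\ forall tau, 0 < tau <= t3 -> 0 <= f + tau * g) as [t3 [t3p Ht3]].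
  { destruct TH as [fp|f0].
    - exists (f / (1 + Rabs g)); pose proof (Rabs_pos g); split.
      + apply Rdiv_lt_0_compat; lra.
      + intros tau [T1 T2].
        assert (tau * (1 + Rabs g) <= f).
        { apply Rle_trans with (f / (1 + Rabs g) * (1 + Rabs g)).
          - apply Rmult_le_compat_r; lra.
          - right; field; lra. }
        pose proof (Rle_abs (- g)); rewrite Rabs_Ropp in *.
        assert (tau * (- g) <= tau * Rabs g) by (apply Rmult_le_compat_l; lra); lra.
    - exists 1; split; [lra|]; intros tau [T1 T2].
      assert (0 < g) by (rewrite Eg; specialize (P3 ltac:(unfold f in f0; lra)); lra).
      rewrite <- f0; assert (0 < tau * g) by (apply Rmult_lt_0_compat; lra); lra. }
  exists (Rmin t1 (Rmin t2 t3)); split; [repeat apply Rmin_pos; auto|].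
  intros tau [T0 TM].
  assert (tau <= t1) by (eapply Rle_trans; [exact TM|apply Rmin_l]).
  assert (tau <= t2) by (eapply Rle_trans; [exact TM|eapply Rle_trans; [apply Rmin_r|apply Rmin_l]]).
  assert (tau <= t3) by (eapply Rle_trans; [exact TM|eapply Rle_trans; [apply Rmin_r|apply Rmin_r]]).
  set (Tn := fun i j k l => T i j k l + tau * Te i j k l).
  set (Hn' := fun i j => H i j + tau * He' i j).
  assert (E : teq n (fun i j k l => (T i j k l + kn H idf i j k l)
      + tau * ((T' i j k l + kn H' idf i j k l) + eps * barrier n theta i j k l))
    (fun i j k l => Tn i j k l + kn Hn' idf i j k l)).
  { intros i j k l _ _ _ _; unfold Tn, Te, Hn', He', barrier, kn, c; ring. }
  assert (PN : PIC2 n Tn) by (apply Ht1; lra).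
  assert (SN : is_sym n Hn').
  { intros i j Hi Hj; unfold Hn', He'; rewrite (SH i j), (SH' i j), (idf_sym n i j) by auto.
    reflexivity. }
  split.
  - apply act_ext with (fun i j k l => Tn i j k l + 1 * kn Hn' idf i j k l).
    + intros i j k l Hi Hj Hk Hl; rewrite E by auto; ring.
    + apply act_lin; [apply PN|]; apply act_kn; auto; apply idf_sym.
  - exists Tn, Hn'; split; [apply PN|]; split; [auto|]; split; [|split; [auto|split; [|split]]].
    + apply R0lin; auto; apply R0lin; auto.
    + intros x; change (0 <= bil n (gform n s Hn') x x).
      rewrite (bil_form_ext n _ (fun i j => gform n s H i j + tau * gform n s He' i j)).
      * apply (Ht2 tau); lra.
      * intros; apply gform_lin.
    + unfold Hn', Tn; rewrite tr_lin, scal_lin.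
      replace (tr n H + tau * tr n He' - theta * (scal n T + tau * scal n Te))
        with (f + tau * g) by (unfold f, g; ring).
      apply Ht3; lra.
    + exact E.
Qed.

(** * Closedness of the cones *)

Lemma dist2_nonneg n X Y : 0 <= dist2 n X Y.
Proof. apply sum4_nonneg; intros; apply pow2_ge_0. Qed.

Lemma dist2_entry n X Y i j k l :
  (i < n)%nat -> (j < n)%nat -> (k < n)%nat -> (l < n)%nat ->
  (X i j k l - Y i j k l) ^ 2 <= dist2 n X Y.
Proof.
  intros; apply (sum4_ge_term n (fun i j k l => (X i j k l - Y i j k l) ^ 2)); auto.
  intros; apply pow2_ge_0.
Qed.

Lemma Un_cv_dist2 n (X Y : nat -> Tensor) X' Y' :
  (forall i j k l, (i < n)%nat -> (j < n)%nat -> (k < n)%nat -> (l < n)%nat ->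
     Un_cv (fun m => X m i j k l) (X' i j k l)) ->
  (forall i j k l, (i < n)%nat -> (j < n)%nat -> (k < n)%nat -> (l < n)%nat ->
     Un_cv (fun m => Y m i j k l) (Y' i j k l)) ->
  Un_cv (fun m => dist2 n (X m) (Y m)) (dist2 n X' Y').
Proof.
  intros CX CY; apply (Un_cv_sum4 n (fun m i j k l => (X m i j k l - Y m i j k l) ^ 2)).
  intros; simpl; repeat first [apply CV_mult | apply CV_minus | apply Un_cv_const]; auto.
Qed.

Lemma closure_sequence n F X : closure n F X ->
  exists Y : nat -> Tensor, (forall m, F (Y m)) /\
    forall i j k l, (i < n)%nat -> (j < n)%nat -> (k < n)%nat -> (l < n)%nat ->
      Un_cv (fun m => Y m i j k l) (X i j k l).
Proof.
  intros C.
  destruct (choice (fun m Y => F Y /\ dist2 n X Y < / (INR m + 1))) as [Y HY].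
  { intros m; apply C, Rinv_0_lt_compat; pose proof (pos_INR m); lra. }
  exists Y; split; [apply HY|]; intros i j k l Hi Hj Hk Hl eps He.
  destruct (Un_cv_inv_succ (eps * eps)) as [N HN]; [nra|]; exists N; intros m Hm.
  specialize (HN m Hm); unfold Rdist in *; rewrite Rminus_0_r in HN.
  pose proof (Rle_abs (/ (INR m + 1))); pose proof (proj2 (HY m)).
  pose proof (dist2_entry n X (Y m) i j k l Hi Hj Hk Hl).
  rewrite <- (Rabs_right eps) by lra; apply Rsqr_lt_abs_0; unfold Rsqr; lra.
Qed.

(** For [H] of trace [h], [Y - H . id] is Einstein exactly when [H] is this form, because
    [Ric (H . id) = (n - 2) H + tr H id]. The trace [h] is the only freedom left. *)
Definition trace_part (n : nat) (Y : Tensor) (h : R) : Form :=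
  fun i k => / (INR n - 2) * Ric0 n Y i k + h * / INR n * kdelta i k.

Definition einstein_part (n : nat) (Y : Tensor) (h : R) : Tensor :=
  fun i j k l => Y i j k l + -1 * kn (trace_part n Y h) idf i j k l.

Lemma tr_Ric0 n Y : (0 < n)%nat -> tr n (Ric0 n Y) = 0.
Proof.
  intros Hn; rewrite trE; unfold Ric0; rewrite rsum_minus, rsum_scal_l.
  fold (tr n kdelta); change kdelta with idf; rewrite tr_idf; fold (scal n Y).
  field; apply not_0_INR; lia.
Qed.

Lemma Ric0_sym n Y : is_act n Y -> is_sym n (Ric0 n Y).
Proof.
  intros A i k Hi Hk; unfold Ric0; rewrite (Ric_sym n Y A i k), (kdelta_sym i k) by auto.
  reflexivity.
Qed.

Lemma trace_part_sym n Y h : is_act n Y -> is_sym n (trace_part n Y h).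
Proof.
  intros A i k Hi Hk; unfold trace_part; rewrite (Ric0_sym n Y A i k), (kdelta_sym i k) by auto.
  reflexivity.
Qed.

Lemma tr_trace_part n Y h : (2 < n)%nat -> tr n (trace_part n Y h) = h.
Proof.
  intros Hn; rewrite trE; unfold trace_part; rewrite rsum_plus, !rsum_scal_l.
  fold (tr n (Ric0 n Y)) (tr n kdelta); change kdelta with idf; rewrite tr_idf, tr_Ric0 by lia.
  apply lt_INR in Hn; simpl in Hn; field; lra.
Qed.

Lemma act_einstein_part n Y h : is_act n Y -> is_act n (einstein_part n Y h).
Proof.
  intros A; apply act_lin; auto; apply act_kn; [apply trace_part_sym; auto|apply idf_sym].
Qed.

Lemma scal_einstein_part n Y h : (2 < n)%nat ->
  scal n (einstein_part n Y h) = scal n Y - (2 * INR n - 2) * h.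
Proof.
  intros Hn; unfold einstein_part; rewrite scal_lin, scal_kn, tr_trace_part by auto; ring.
Qed.

Lemma Ric0_einstein_part n Y h i k : (2 < n)%nat -> (i < n)%nat -> (k < n)%nat ->
  Ric0 n (einstein_part n Y h) i k = 0.
Proof.
  intros Hn Hi Hk; unfold Ric0; rewrite scal_einstein_part by auto.
  unfold einstein_part; rewrite Ric_lin, Ric_kn, tr_trace_part by auto.
  unfold trace_part, Ric0; apply lt_INR in Hn; simpl in Hn; field; lra.
Qed.

Lemma scal_nonneg n T : PIC2 n T -> 0 <= scal n T.
Proof.
  intros P; apply rsum_nonneg; intros i Hi; apply rsum_nonneg; intros j Hj.
  rewrite <- (ev_kdelta n T i j i j) by auto; apply ev_sectional_nonneg; auto.
Qed.

Lemma Ccone_ext n s theta X Y : teq n X Y -> Ccone n s theta X -> Ccone n s theta Y.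
Proof.
  intros E [A [T [H [C1 [C2 [C3 [C4 [C5 [C6 C7]]]]]]]]]; split; [apply act_ext with X; auto|].
  exists T, H; repeat split; auto; try apply C2; try apply C1; auto.
  intros i j k l Hi Hj Hk Hl; rewrite <- E; auto.
Qed.

(** Replaces the unknown pair [(T, H)] by one real number [h] in the bounded interval from 0 to
    [scal Y], which makes closedness accessible. The upper bound comes from
    [scal Y = scal T + (2 n - 2) h] with [scal T >= 0]. *)
Lemma Ccone_iff n s theta Y : (2 < n)%nat -> 0 < s ->
  Ccone n s theta Y <-> exists h, is_act n Y /\ 0 <= h /\ h <= scal n Y /\
    (forall x y u v, 0 <= pic2_re n (einstein_part n Y h) x y u v) /\
    psd n (gform n s (trace_part n Y h)) /\ 0 <= h - theta * scal n (einstein_part n Y h).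
Proof.
  intros Hn Hs; assert (N2 : 2 < INR n) by (apply lt_INR in Hn; simpl in Hn; lra); split.
  - intros [A [T [H [_ [PT [RT [S [P [C E]]]]]]]]]; exists (tr n H).
    assert (EY : teq n Y (fun i j k l => T i j k l + 1 * kn H idf i j k l)).
    { intros i j k l Hi Hj Hk Hl; rewrite E by auto; ring. }
    assert (sY : scal n Y = scal n T + (2 * INR n - 2) * tr n H).
    { rewrite (scal_ext n _ _ EY), scal_lin, scal_kn; ring. }
    assert (EH : forall i k, (i < n)%nat -> (k < n)%nat -> H i k = trace_part n Y (tr n H) i k).
    { intros i k Hi Hk; unfold trace_part, Ric0; rewrite sY, (Ric_ext n _ _ i k EY), Ric_lin by auto.
      rewrite Ric_kn by auto; specialize (RT i k Hi Hk); unfold Ric0 in RT.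
      replace (Ric n T i k) with (/ INR n * scal n T * kdelta i k) by lra; field; lra. }
    assert (ET : teq n T (einstein_part n Y (tr n H))).
    { intros i j k l Hi Hj Hk Hl; unfold einstein_part; rewrite E by auto.
      unfold kn; rewrite <- !EH by auto; ring. }
    assert (h0 : 0 <= tr n H).
    { pose proof (tr_nonneg n _ P) as X; change (0 <= tr n (gform n s H)) in X.
      rewrite tr_gform in X; apply Rmult_le_reg_l with (2 * s); lra. }
    pose proof (scal_nonneg n T PT).
    split; [auto|]; split; [auto|]; split; [|split; [|split]].
    + rewrite sY; assert (0 <= (2 * INR n - 3) * tr n H) by (apply Rmult_le_pos; lra); lra.
    + intros x y u v; rewrite <- (pic2_re_ext n _ _ x y u v ET); apply PT.
    + intros x; specialize (P x); erewrite rsum_ext2; [exact P|].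
      intros i j Hi Hj; unfold gform; rewrite tr_trace_part, <- EH by auto; reflexivity.
    + rewrite <- (scal_ext n _ _ ET); auto.
  - intros [h [A [h0 [hs [P [G C]]]]]]; split; auto.
    assert (AE : is_act n (einstein_part n Y h)) by (apply act_einstein_part; auto).
    exists (einstein_part n Y h), (trace_part n Y h); split; [auto|]; split; [|split; [|split;
      [|split; [|split]]]].
    + split; auto; intros; split; [apply pic2_im_act; auto|auto].
    + intros; apply Ric0_einstein_part; auto.
    + apply trace_part_sym; auto.
    + exact G.
    + rewrite tr_trace_part; auto.
    + intros i j k l _ _ _ _; unfold einstein_part; ring.
Qed.

Lemma Un_cv_Ric n (Y : nat -> Tensor) X :
  (forall i j k l, (i < n)%nat -> (j < n)%nat -> (k < n)%nat -> (l < n)%nat ->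
     Un_cv (fun m => Y m i j k l) (X i j k l)) ->
  forall i k, (i < n)%nat -> (k < n)%nat -> Un_cv (fun m => Ric n (Y m) i k) (Ric n X i k).
Proof.
  intros C i k Hi Hk; apply (Un_cv_rsum n (fun m j => Y m i j k j) (fun j => X i j k j)); auto.
Qed.

Lemma Un_cv_scal n (Y : nat -> Tensor) X :
  (forall i j k l, (i < n)%nat -> (j < n)%nat -> (k < n)%nat -> (l < n)%nat ->
     Un_cv (fun m => Y m i j k l) (X i j k l)) ->
  Un_cv (fun m => scal n (Y m)) (scal n X).
Proof.
  intros C; apply (Un_cv_rsum n (fun m i => Ric n (Y m) i i) (fun i => Ric n X i i)).
  intros; apply Un_cv_Ric; auto.
Qed.

Lemma Un_cv_act n (Y : nat -> Tensor) X :
  (forall i j k l, (i < n)%nat -> (j < n)%nat -> (k < n)%nat -> (l < n)%nat ->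
     Un_cv (fun m => Y m i j k l) (X i j k l)) ->
  (forall m, is_act n (Y m)) -> is_act n X.
Proof.
  intros C A i j k l Hi Hj Hk Hl; split; [|split].
  - apply UL_sequence with (fun m => Y m i j k l); auto.
    apply Un_cv_ext with (fun m => - Y m j i k l).
    + intros m; symmetry; apply A; auto.
    + apply (CV_opp (fun m => Y m j i k l)); auto.
  - apply UL_sequence with (fun m => Y m i j k l); auto.
    apply Un_cv_ext with (fun m => Y m k l i j); auto.
    intros m; symmetry; apply A; auto.
  - apply UL_sequence with (fun m => Y m i j k l + Y m j k i l + Y m k i j l).
    + repeat apply CV_plus; auto.
    + apply Un_cv_ext with (fun _ => 0); [|apply Un_cv_const].
      intros m; symmetry; apply A; auto.
Qed.

(** The numbers [h] of an approximating sequence are bounded by its convergent scalar curvatures.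
    Along a subsequence they converge, and every condition, being a weak inequality or an equation
    between continuous quantities, passes to the limit. *)
Lemma Ccone_closed n s theta X : (2 < n)%nat -> 0 < s ->
  closure n (Ccone n s theta) X -> Ccone n s theta X.
Proof.
  intros Hn Hs C; destruct (closure_sequence n _ X C) as [Y [HY CY]].
  destruct (choice (fun m h => is_act n (Y m) /\ 0 <= h /\ h <= scal n (Y m) /\
    (forall x y u v, 0 <= pic2_re n (einstein_part n (Y m) h) x y u v) /\
    psd n (gform n s (trace_part n (Y m) h)) /\
    0 <= h - theta * scal n (einstein_part n (Y m) h))) as [h Hh].
  { intros m; apply Ccone_iff; auto. }
  pose proof (Un_cv_scal n Y X CY) as Cs.
  destruct (maj_by_pos _ (exist _ _ Cs)) as [M [_ HM]].
  destruct (bolzano_weierstrass_real h M) as [phi [h' [I Ch]]].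
  { intros m; destruct (Hh m) as [_ [h0 [hs _]]]; specialize (HM m).
    pose proof (Rle_abs (scal n (Y m))); rewrite Rabs_right; lra. }
  set (Z := fun m => Y (phi m)).
  assert (CZ : forall i j k l, (i < n)%nat -> (j < n)%nat -> (k < n)%nat -> (l < n)%nat ->
     Un_cv (fun m => Z m i j k l) (X i j k l)).
  { intros; apply (Un_cv_subseq (fun m => Y m i j k l)); auto. }
  pose proof (Un_cv_scal n Z X CZ) as Csz.
  assert (CH : forall i k, (i < n)%nat -> (k < n)%nat ->
    Un_cv (fun m => trace_part n (Z m) (h (phi m)) i k) (trace_part n X h' i k)).
  { intros i k Hi Hk; unfold trace_part, Ric0.
    repeat first [exact Ch | exact Csz | apply Un_cv_const | apply Un_cv_Ric; assumption
      | apply CV_minus | apply CV_plus | apply CV_mult]. }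
  assert (CE : forall i j k l, (i < n)%nat -> (j < n)%nat -> (k < n)%nat -> (l < n)%nat ->
    Un_cv (fun m => einstein_part n (Z m) (h (phi m)) i j k l) (einstein_part n X h' i j k l)).
  { intros; unfold einstein_part, kn.
    repeat first [apply CZ; assumption | apply CH; assumption | apply Un_cv_const
      | apply CV_minus | apply CV_plus | apply CV_mult]. }
  apply Ccone_iff; auto; exists h'; split; [|split; [|split; [|split; [|split]]]].
  - apply (Un_cv_act n Z); auto; intros m; apply Hh.
  - apply (Un_cv_le (fun _ => 0) (fun m => h (phi m))); auto; [|apply Un_cv_const].
    intros m; apply Hh.
  - apply (Un_cv_le (fun m => h (phi m)) (fun m => scal n (Z m))); auto; intros m; apply Hh.
  - intros x y u v.
    apply (Un_cv_le (fun _ => 0) (fun m => pic2_re n (einstein_part n (Z m) (h (phi m))) x y u v)).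
    + intros m; apply Hh.
    + apply Un_cv_const.
    + apply (Un_cv_pic2_re n (fun m => einstein_part n (Z m) (h (phi m)))); auto;
        intros; apply Un_cv_const.
  - intros e; change (0 <= bil n (gform n s (trace_part n X h')) e e).
    apply (Un_cv_le (fun _ => 0) (fun m => bil n (gform n s (trace_part n (Z m) (h (phi m)))) e e)).
    + intros m; apply (Hh (phi m)).
    + apply Un_cv_const.
    + apply (Un_cv_bil n (fun m => gform n s (trace_part n (Z m) (h (phi m)))) _ (fun _ => e));
        [|intros; apply Un_cv_const].
      intros i j Hi Hj; unfold gform; rewrite tr_trace_part by auto.
      apply Un_cv_ext with (fun m => h (phi m) * idf i j
        - (INR n - 2 * s) * trace_part n (Z m) (h (phi m)) i j).
      * intros m; rewrite tr_trace_part; auto.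
      * repeat first [exact Ch | apply CH; assumption | apply Un_cv_const
          | apply CV_minus | apply CV_mult].
  - apply (Un_cv_le (fun _ => 0)
      (fun m => h (phi m) - theta * scal n (einstein_part n (Z m) (h (phi m))))).
    + intros m; apply Hh.
    + apply Un_cv_const.
    + apply (CV_minus (fun m => h (phi m))); auto.
      apply (CV_mult (fun _ => theta)); [apply Un_cv_const|].
      apply (Un_cv_scal n (fun m => einstein_part n (Z m) (h (phi m)))); auto.
Qed.

(** * Invariance of closed sets under the Hamilton ODE *)

(** Comparison with [eps * exp ((L + 1) t)] for every [eps > 0]. A one-sided Dini bound is used
    since a distance function need not be differentiable, and it is asked only at [0 < t], where a
    solution is known to have a derivative. *)
Lemma dini_gronwall (d : R -> R) t1 L : 0 <= t1 -> 0 <= L -> d 0 = 0 ->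
  (forall t eps, 0 <= t <= t1 -> 0 < eps -> exists delta, 0 < delta /\
     forall s, 0 <= s <= t1 -> Rabs (s - t) < delta -> Rabs (d s - d t) < eps) ->
  (forall t eps, 0 < t < t1 -> 0 < eps -> exists delta, 0 < delta /\
     forall h, 0 < h < delta -> t + h <= t1 -> d (t + h) <= d t + h * (L * d t + eps)) ->
  forall t, 0 <= t <= t1 -> d t <= 0.
Proof.
  intros H1 HL D0 Cont Dini.
  assert (main : forall eps, 0 < eps -> forall t, 0 <= t <= t1 -> d t <= eps * exp ((L + 1) * t)).
  { intros eps He.
    set (phi := fun t => eps * exp ((L + 1) * t)).
    assert (mono : forall s t, s <= t -> phi s <= phi t).
    { intros s t Hst; apply Rmult_le_compat_l; [lra|].
      destruct (Req_dec s t) as [->|N]; [lra|]; left; apply exp_increasing.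
      apply Rmult_lt_compat_l; lra. }
    assert (phipos : forall t, 0 < phi t) by (intros; apply Rmult_lt_0_compat; auto; apply exp_pos).
    set (E := fun t => 0 <= t <= t1 /\ forall s, 0 <= s <= t -> d s <= phi s).
    assert (E0 : E 0).
    { split; [lra|]; intros s Hs; replace s with 0 by lra; rewrite D0; left; apply phipos. }
    destruct (completeness E) as [ts [ub lub]].
    - exists t1; intros t [Ht _]; lra.
    - exists 0; auto.
    - assert (ts0 : 0 <= ts) by (apply ub; auto).
      assert (ts1 : ts <= t1) by (apply lub; intros t [Ht _]; lra).
      assert (near : forall del, 0 < del -> exists t, E t /\ ts - del < t <= ts).
      { intros del Hd; apply NNPP; intros N.
        assert (ts <= ts - del); [|lra].
        apply lub; intros t Et; apply Rnot_lt_le; intros Lt; apply N; exists t; auto. }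
      assert (at_ts : d ts <= phi ts).
      { apply Rnot_lt_le; intros Lt.
        destruct (Cont ts (d ts - phi ts) (conj ts0 ts1)) as [del [dp Hd]]; [lra|].
        destruct (near del dp) as [t [[Ht Et] [N1 N2]]].
        specialize (Et t ltac:(lra)); specialize (mono t ts N2).
        assert (X : Rabs (t - ts) < del) by (apply Rabs_def1; lra).
        specialize (Hd t Ht X); apply Rabs_def2 in Hd; lra. }
      assert (upto : forall s, 0 <= s <= ts -> d s <= phi s).
      { intros s Hs; destruct (Req_dec s ts) as [->|N]; auto.
        destruct (near (ts - s)) as [t [[Ht Et] Nt]]; [lra|]; apply Et; lra. }
      assert (ts = t1) as ->; [|exact (fun t Ht => upto t Ht)].
      apply Rle_antisym; auto; apply Rnot_lt_le; intros Lt.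
      assert (ext : exists del, 0 < del /\ forall h, 0 < h < del -> ts + h <= t1 ->
        d (ts + h) <= phi (ts + h)).
      { destruct at_ts as [less|eq].
        - destruct (Cont ts (phi ts - d ts) (conj ts0 ts1)) as [del [dp Hd]]; [lra|].
          exists del; split; auto; intros h Hh Hl.
          assert (X : Rabs (ts + h - ts) < del) by (apply Rabs_def1; lra).
          specialize (Hd (ts + h) ltac:(lra) X); apply Rabs_def2 in Hd.
          specialize (mono ts (ts + h) ltac:(lra)); lra.
        (* Equality excludes [ts = 0], where [d] vanishes. The Dini bound with error [phi ts] then
           compares with [phi] through [1 + (L + 1) h <= exp ((L + 1) h)]. *)
        - assert (0 < ts).
          { destruct ts0 as [|Z]; auto; exfalso; rewrite <- Z, D0 in eq.
            pose proof (phipos 0); lra. }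
          destruct (Dini ts (phi ts) ltac:(lra) (phipos ts)) as [del [dp Hd]].
          exists del; split; auto; intros h Hh Hl; specialize (Hd h Hh Hl); rewrite eq in Hd.
          eapply Rle_trans; [exact Hd|].
          assert (split_exp : phi (ts + h) = phi ts * exp ((L + 1) * h)).
          { unfold phi; rewrite Rmult_plus_distr_l, exp_plus; ring. }
          rewrite split_exp; pose proof (exp_ineq1_le ((L + 1) * h)).
          replace (phi ts + h * (L * phi ts + phi ts)) with (phi ts * (1 + (L + 1) * h)) by ring.
          apply Rmult_le_compat_l; [left; apply phipos|auto]. }
      destruct ext as [del [dp Hd]].
      set (r := Rmin (del / 2) (t1 - ts)).
      assert (r1 : r <= del / 2) by apply Rmin_l.
      assert (r2 : r <= t1 - ts) by apply Rmin_r.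
      assert (r0 : 0 < r) by (apply Rmin_pos; lra).
      assert (E (ts + r)).
      { split; [lra|]; intros s Hs; destruct (Rle_lt_dec s ts) as [Hle|Hlt]; [apply upto; lra|].
        replace s with (ts + (s - ts)) by ring; apply Hd; lra. }
      specialize (ub (ts + r) H); lra. }
  intros t Ht; apply Rnot_lt_le; intros Pos.
  pose proof (exp_pos ((L + 1) * t)) as ep.
  (* With this [eps] the bound at [t] reads [d t <= d t / 2]. *)
  specialize (main (d t / 2 / exp ((L + 1) * t))).
  assert (0 < d t / 2 / exp ((L + 1) * t)) by (apply Rdiv_lt_0_compat; lra).
  specialize (main H t Ht).
  replace (d t / 2 / exp ((L + 1) * t) * exp ((L + 1) * t)) with (d t / 2) in main by (field; lra).
  lra.
Qed.

(** A minimising sequence has bounded entries, so a subsequence converges entrywise, and the limit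
    lies in [F] by closedness. *)
Lemma closest_point n (F : Tensor -> Prop) : (exists P, F P) ->
  (forall X, closure n F X -> F X) ->
  forall X, exists P, F P /\ forall Y, F Y -> dist2 n X P <= dist2 n X Y.
Proof.
  intros NE Cl X.
  destruct (sup_attaining_sequence Tensor F (fun Y => - dist2 n X Y) 0 NE) as [u [s [Fu [Cu Su]]]].
  { intros; pose proof (dist2_nonneg n X x); lra. }
  destruct (maj_by_pos _ (exist _ _ Cu)) as [M [M0 HM]].
  set (idx := list_prod (list_prod (seq 0 n) (seq 0 n)) (list_prod (seq 0 n) (seq 0 n))).
  set (coord := fun (T : Tensor) (a : (nat * nat) * (nat * nat)) =>
    T (fst (fst a)) (snd (fst a)) (fst (snd a)) (snd (snd a))).
  assert (Hidx : forall i j k l, (i < n)%nat -> (j < n)%nat -> (k < n)%nat -> (l < n)%nat ->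
    In ((i, j), (k, l)) idx).
  { intros; unfold idx; repeat apply in_prod; apply in_seq; lia. }
  (* The entries of [u m - X] have squares at most [M], hence absolute values at most [M + 1]. *)
  destruct (bolzano_weierstrass _ idx (fun m a => coord (u m) a - coord X a) (M + 1)) as [phi [l [I C]]].
  { intros m [[i j] [k l]] Ha; unfold idx in Ha.
    apply in_prod_iff in Ha; destruct Ha as [Ha Hb].
    apply in_prod_iff in Ha; apply in_prod_iff in Hb; rewrite !in_seq in Ha, Hb.
    unfold coord; simpl.
    pose proof (dist2_entry n X (u m) i j k l ltac:(lia) ltac:(lia) ltac:(lia) ltac:(lia)) as De.
    specialize (HM m); rewrite Rabs_Ropp, Rabs_right in HM by (apply Rle_ge, dist2_nonneg).
    apply Rabs_le; nra. }
  set (P := fun i j k m => X i j k m + l ((i, j), (k, m))).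
  assert (CP : forall i j k l, (i < n)%nat -> (j < n)%nat -> (k < n)%nat -> (l < n)%nat ->
    Un_cv (fun m => u (phi m) i j k l) (P i j k l)).
  { intros i j k m Hi Hj Hk Hm; unfold P.
    apply Un_cv_ext with (fun q => X i j k m + (u (phi q) i j k m - X i j k m)).
    - intros; ring.
    - apply CV_plus; [apply Un_cv_const|].
      apply (C ((i, j), (k, m))); apply Hidx; auto. }
  exists P; split.
  - apply Cl; intros eps He.
    pose proof (Un_cv_dist2 n (fun _ => P) (fun m => u (phi m)) P P
      (fun i j k l _ _ _ _ => Un_cv_const (P i j k l)) CP) as CD.
    replace (dist2 n P P) with 0 in CD.
    + destruct (CD eps He) as [N HN]; exists (u (phi N)); split; auto.
      specialize (HN N (le_n N)); unfold Rdist in HN; rewrite Rminus_0_r in HN.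
      pose proof (Rle_abs (dist2 n P (u (phi N)))); lra.
    + symmetry; unfold dist2; rewrite (sum4_ext n _ (fun i j k l => 0 * 0)).
      * rewrite sum4_scal; ring.
      * intros; ring.
  - intros Y FY.
    pose proof (Un_cv_dist2 n (fun _ => X) (fun m => u (phi m)) X P
      (fun i j k l _ _ _ _ => Un_cv_const (X i j k l)) CP) as CD.
    apply (Un_cv_subseq _ _ phi I) in Cu.
    apply CV_opp in Cu; unfold opp_seq in Cu.
    assert (E : dist2 n X P = - s).
    { apply UL_sequence with (fun m => dist2 n X (u (phi m))); auto.
      apply Un_cv_ext with (fun m => - - dist2 n X (u (phi m))); auto; intros; ring. }
    specialize (Su Y FY); lra.
Qed.

Lemma finite_uniform n (Pr : nat -> R -> Prop) :
  (forall i, (i < n)%nat -> exists delta, 0 < delta /\ forall h, 0 < h < delta -> Pr i h) ->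
  exists delta, 0 < delta /\ forall h, 0 < h < delta -> forall i, (i < n)%nat -> Pr i h.
Proof.
  induction n as [|n IH]; intros H.
  - exists 1; split; [lra|]; intros; lia.
  - destruct IH as [d1 [p1 H1]]; [auto with arith|].
    destruct (H n) as [d2 [p2 H2]]; [lia|].
    exists (Rmin d1 d2); split; [apply Rmin_pos; auto|]; intros h Hh i Hi.
    pose proof (Rmin_l d1 d2); pose proof (Rmin_r d1 d2).
    destruct (Nat.eq_dec i n) as [->|N]; [apply H2; lra|apply H1; [lra|lia]].
Qed.

Lemma finite_uniform4 n (Pr : nat -> nat -> nat -> nat -> R -> Prop) :
  (forall i j k l, (i < n)%nat -> (j < n)%nat -> (k < n)%nat -> (l < n)%nat ->
     exists delta, 0 < delta /\ forall h, 0 < h < delta -> Pr i j k l h) ->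
  exists delta, 0 < delta /\ forall h, 0 < h < delta ->
    forall i j k l, (i < n)%nat -> (j < n)%nat -> (k < n)%nat -> (l < n)%nat -> Pr i j k l h.
Proof.
  intros H.
  destruct (finite_uniform n (fun i h => forall j, (j < n)%nat -> forall k, (k < n)%nat ->
    forall l, (l < n)%nat -> Pr i j k l h)) as [d [p Hd]].
  - intros i Hi; apply (finite_uniform n (fun j h => forall k, (k < n)%nat ->
      forall l, (l < n)%nat -> Pr i j k l h)); intros j Hj.
    apply (finite_uniform n (fun k h => forall l, (l < n)%nat -> Pr i j k l h)); intros k Hk.
    apply (finite_uniform n (fun l h => Pr i j k l h)); auto.
  - exists d; split; auto; intros; apply Hd; auto.
Qed.

Lemma Qop_one_sided_lipschitz n M : 0 <= M -> exists L, 0 <= L /\ forall X Y,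
  (forall i j k l, (i < n)%nat -> (j < n)%nat -> (k < n)%nat -> (l < n)%nat ->
     Rabs (X i j k l) <= M /\ Rabs (Y i j k l) <= M) ->
  2 * sum4 n (fun i j k l => (X i j k l - Y i j k l) * (Qop n X i j k l - Qop n Y i j k l))
    <= L * dist2 n X Y.
Proof.
  intros HM; pose proof (pos_INR n) as N0.
  set (N2 := INR n * (INR n * 1)).
  assert (N20 : 0 <= N2) by (unfold N2; repeat apply Rmult_le_pos; lra).
  (* Each entry of [Q X - Q Y] sums [n^2] terms made of five differences of products, each at most
     [2 M r], which gives [10 n^2 M r]. The outer factor 2 and the number of entries give the
     rest. *)
  exists (20 * N2 * M * sum4 n (fun _ _ _ _ => 1)); split.
  { repeat apply Rmult_le_pos; try lra; apply sum4_nonneg; intros; lra. }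
  intros X Y B.
  set (r := sqrt (dist2 n X Y)).
  assert (r0 : 0 <= r) by apply sqrt_pos.
  assert (rr : r * r = dist2 n X Y) by (apply sqrt_sqrt, dist2_nonneg).
  assert (Nb : forall i j k l, (i < n)%nat -> (j < n)%nat -> (k < n)%nat -> (l < n)%nat ->
    Rabs (X i j k l - Y i j k l) <= r).
  { intros i j k l Hi Hj Hk Hl; pose proof (dist2_entry n X Y i j k l Hi Hj Hk Hl).
    apply Rabs_le; nra. }
  assert (Pb : forall i j k l i' j' k' l',
    (i < n)%nat -> (j < n)%nat -> (k < n)%nat -> (l < n)%nat ->
    (i' < n)%nat -> (j' < n)%nat -> (k' < n)%nat -> (l' < n)%nat ->
    Rabs (X i j k l * X i' j' k' l' - Y i j k l * Y i' j' k' l') <= 2 * M * r).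
  { intros i j k l i' j' k' l'; intros.
    replace (X i j k l * X i' j' k' l' - Y i j k l * Y i' j' k' l') with
      (X i j k l * (X i' j' k' l' - Y i' j' k' l') + Y i' j' k' l' * (X i j k l - Y i j k l)) by ring.
    eapply Rle_trans; [apply Rabs_triang|]; rewrite !Rabs_mult.
    replace (2 * M * r) with (M * r + M * r) by ring.
    apply Rplus_le_compat; apply Rmult_le_compat; try apply Rabs_pos; auto; apply B; auto. }
  assert (Qb : forall i j k l, (i < n)%nat -> (j < n)%nat -> (k < n)%nat -> (l < n)%nat ->
    Rabs (Qop n X i j k l - Qop n Y i j k l) <= 10 * N2 * M * r).
  { intros i j k l Hi Hj Hk Hl.
    assert (E : Qop n X i j k l - Qop n Y i j k l = rsum n (fun p => rsum n (fun q =>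
      (X i j p q * X k l p q - Y i j p q * Y k l p q)
      + 2 * (X i p k q * X j p l q - Y i p k q * Y j p l q)
      - 2 * (X i p l q * X j p k q - Y i p l q * Y j p k q)))).
    { unfold Qop, Bop; rewrite <- !rsum_scal_l.
      repeat rewrite <- ?rsum_minus, <- ?rsum_plus; apply rsum_ext; intros; rewrite <- !rsum_scal_l.
      repeat rewrite <- ?rsum_minus, <- ?rsum_plus; apply rsum_ext; intros; field. }
    rewrite E.
    replace (10 * N2 * M * r) with (rsum n (fun _ => rsum n (fun _ => 10 * M * r))).
    2: rewrite !rsum_const; unfold N2; ring.
    eapply Rle_trans; [apply rsum_Rabs|]; apply rsum_le; intros p Hp.
    eapply Rle_trans; [apply rsum_Rabs|]; apply rsum_le; intros q Hq.
    pose proof (Pb i j p q k l p q Hi Hj Hp Hq Hk Hl Hp Hq) as B1.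
    pose proof (Pb i p k q j p l q Hi Hp Hk Hq Hj Hp Hl Hq) as B2.
    pose proof (Pb i p l q j p k q Hi Hp Hl Hq Hj Hp Hk Hq) as B3.
    set (a := X i j p q * X k l p q - Y i j p q * Y k l p q) in *.
    set (b := X i p k q * X j p l q - Y i p k q * Y j p l q) in *.
    set (c := X i p l q * X j p k q - Y i p l q * Y j p k q) in *.
    revert B1 B2 B3; unfold Rabs.
    destruct (Rcase_abs a), (Rcase_abs b), (Rcase_abs c), (Rcase_abs (a + 2 * b - 2 * c)); intros; lra. }
  assert (T : sum4 n (fun i j k l =>
      (X i j k l - Y i j k l) * (Qop n X i j k l - Qop n Y i j k l))
    <= sum4 n (fun i j k l => (10 * N2 * M * (r * r)) * 1)).
  { apply sum4_le; intros i j k l Hi Hj Hk Hl.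
    eapply Rle_trans; [apply Rle_abs|]; rewrite Rabs_mult.
    replace (10 * N2 * M * (r * r) * 1) with (r * (10 * N2 * M * r)) by ring.
    apply Rmult_le_compat; try apply Rabs_pos; auto. }
  rewrite sum4_scal, rr in T; lra.
Qed.

Lemma dist2_sym n X Y : dist2 n X Y = dist2 n Y X.
Proof. apply sum4_ext; intros; ring. Qed.

(** Squared distances obey no triangle inequality. This weighted form avoids square roots; it is
    sharp enough when [kap] is small and [dist2 n X Y] much smaller still. *)
Lemma dist2_weak_triangle n kap X Y Z : 0 < kap ->
  dist2 n X Z <= (1 + kap) * dist2 n Y Z + (1 + / kap) * dist2 n X Y.
Proof.
  intros Hk; unfold dist2; rewrite <- !sum4_scal, <- sum4_plus; apply sum4_le.
  intros i j k l _ _ _ _.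
  set (a := Y i j k l - Z i j k l); set (b := X i j k l - Y i j k l).
  replace (X i j k l - Z i j k l) with (a + b) by (unfold a, b; ring).
  assert (E : (1 + kap) * a ^ 2 + (1 + / kap) * b ^ 2 - (a + b) ^ 2 = / kap * (kap * a - b) ^ 2)
    by (field; lra).
  assert (0 <= / kap * (kap * a - b) ^ 2).
  { apply Rmult_le_pos; [left; apply Rinv_0_lt_compat; auto|apply pow2_ge_0]. }
  lra.
Qed.

(** The squared distance [d] from [X = R(t)] to [F] is tested against a step [Y + h (Q Y + e W)]
    from a closest point [Y], which stays in [F]. This bounds the growth rate of [d] by
    [2 <X - Y, Q X - Q Y>] plus a small error, and the Lipschitz bound turns the scalar product into
    [L d]. The error being arbitrary, Gronwall's argument gives [d = 0]. *)
Theorem nagumo n (F : Tensor -> Prop) (W : Tensor) :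
  (forall X, closure n F X -> F X) ->
  (forall P eps, F P -> 0 < eps -> exists tau0, 0 < tau0 /\ forall tau, 0 < tau <= tau0 ->
     F (fun i j k l => P i j k l + tau * (Qop n P i j k l + eps * W i j k l))) ->
  ode_invariant n F.
Proof.
  intros Cl Tan T Rt HT [Der Con] F0 t1 Ht1.
  assert (NE : exists P, F P) by (exists (Rt 0); auto).
  destruct (choice _ (closest_point n F NE Cl)) as [P HP].
  assert (PF : forall X, F (P X)) by (intros; apply HP).
  assert (Pmin : forall X Y, F Y -> dist2 n X (P X) <= dist2 n X Y) by (intros; apply HP; auto).
  set (d := fun t => dist2 n (Rt t) (P (Rt t))).
  assert (d0 : forall t, 0 <= d t) by (intros; apply dist2_nonneg).
  assert (self : forall X, dist2 n X X = 0).
  { intros; unfold dist2; rewrite (sum4_ext n _ (fun i j k l => 0 * 0)) by (intros; ring).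
    rewrite sum4_scal; ring. }
  assert (Seq : forall (u : nat -> R) t, (forall m, 0 <= u m < T) -> 0 <= t < T -> Un_cv u t ->
    forall i j k l, (i < n)%nat -> (j < n)%nat -> (k < n)%nat -> (l < n)%nat ->
      Un_cv (fun m => Rt (u m) i j k l) (Rt t i j k l)).
  { intros u t Hu Ht Cu i j k l Hi Hj Hk Hl eps He.
    destruct (Con t Ht i j k l Hi Hj Hk Hl eps He) as [del [dp Hd]].
    destruct (Cu del dp) as [N HN]; exists N; intros m Hm; apply Hd; auto; apply HN; auto. }
  assert (Cdist : forall t eps, 0 <= t < T -> 0 < eps -> exists delta, 0 < delta /\
     forall s, 0 <= s < T -> Rabs (s - t) < delta -> dist2 n (Rt s) (Rt t) < eps).
  { intros t eps Ht He; apply NNPP; intros Neg.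
    assert (bad : forall m : nat, exists s, 0 <= s < T /\ Rabs (s - t) < / (INR m + 1) /\
      eps <= dist2 n (Rt s) (Rt t)).
    { intros m; apply NNPP; intros N; apply Neg; exists (/ (INR m + 1)); split.
      - apply Rinv_0_lt_compat; pose proof (pos_INR m); lra.
      - intros s Hs Hst; apply Rnot_le_lt; intros L; apply N; exists s; auto. }
    apply choice in bad; destruct bad as [u Hu].
    assert (Cu : Un_cv u t).
    { intros e Hpe; destruct (Un_cv_inv_succ e Hpe) as [N HN]; exists N; intros m Hm.
      specialize (HN m Hm); destruct (Hu m) as [_ [Um _]]; unfold Rdist in *.
      rewrite Rminus_0_r in HN; pose proof (Rle_abs (/ (INR m + 1))); lra. }
    pose proof (Un_cv_dist2 n (fun m => Rt (u m)) (fun _ => Rt t) _ _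
      (Seq u t (fun m => proj1 (Hu m)) Ht Cu) (fun i j k l _ _ _ _ => Un_cv_const _)) as CD.
    rewrite self in CD.
    assert (eps <= 0); [|lra].
    apply (Un_cv_le (fun _ => eps) (fun m => dist2 n (Rt (u m)) (Rt t))); auto.
    - intros m; apply Hu.
    - apply Un_cv_const. }
  set (nrm := fun X => dist2 n X (fun _ _ _ _ => 0)).
  (* Otherwise times with norm above [m] would accumulate at some [t] of the interval, where
     continuity bounds the norm. *)
  assert (bounded : exists K, forall t, 0 <= t <= t1 -> nrm (Rt t) <= K).
  { apply NNPP; intros Neg.
    assert (bad : forall m : nat, exists s, 0 <= s <= t1 /\ INR m < nrm (Rt s)).
    { intros m; apply NNPP; intros N; apply Neg; exists (INR m); intros t Ht.
      apply Rnot_lt_le; intros L; apply N; exists t; auto. }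
    apply choice in bad; destruct bad as [u Hu].
    destruct (bolzano_weierstrass_real u t1) as [phi [t [I Ct]]].
    { intros m; destruct (Hu m) as [Um _]; rewrite Rabs_right; lra. }
    assert (Ht : 0 <= t <= t1).
    { split; [apply (Un_cv_le (fun _ => 0) (fun m => u (phi m)))|
        apply (Un_cv_le (fun m => u (phi m)) (fun _ => t1))]; auto; try apply Un_cv_const;
        intros m; apply Hu. }
    pose proof (Un_cv_dist2 n (fun m => Rt (u (phi m))) (fun _ _ _ _ _ => 0) _ _
      (Seq (fun m => u (phi m)) t (fun m => ltac:(destruct (Hu (phi m)); lra)) ltac:(lra) Ct)
      (fun i j k l _ _ _ _ => Un_cv_const _)) as CD.
    destruct (maj_by_pos _ (exist _ _ CD)) as [B [_ HB]].
    destruct (INR_unbounded B) as [m Hm].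
    specialize (HB m); destruct (Hu (phi m)) as [_ Hn].
    pose proof (le_INR _ _ (strictly_increasing_ge phi I m)); unfold nrm in Hn.
    pose proof (Rle_abs (dist2 n (Rt (u (phi m))) (fun _ _ _ _ => 0))); lra. }
  destruct bounded as [K HK].
  assert (entry : forall X i j k l, (i < n)%nat -> (j < n)%nat -> (k < n)%nat -> (l < n)%nat ->
    Rabs (X i j k l) <= nrm X + 1).
  { intros X i j k l Hi Hj Hk Hl.
    pose proof (dist2_entry n X (fun _ _ _ _ => 0) i j k l Hi Hj Hk Hl) as De; simpl in De.
    unfold nrm; apply Rabs_le; nra. }
  assert (K0 : 0 <= K).
  { pose proof (HK 0 ltac:(lra)); pose proof (dist2_nonneg n (Rt 0) (fun _ _ _ _ => 0)).
    unfold nrm in *; lra. }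
  (* [Rt 0] lies in [F] and so bounds the distance to a closest point; this keeps the closest points
     in the ball where the Lipschitz constant is taken. *)
  assert (dB : forall t, 0 <= t <= t1 -> d t <= 4 * K).
  { intros t Ht; eapply Rle_trans; [apply (Pmin (Rt t) (Rt 0) F0)|].
    pose proof (dist2_weak_triangle n 1 (Rt t) (fun _ _ _ _ => 0) (Rt 0) ltac:(lra)) as X.
    pose proof (HK t Ht); pose proof (HK 0 ltac:(lra)); unfold nrm in *.
    rewrite (dist2_sym n (fun _ _ _ _ => 0)), Rinv_1 in X; lra. }
  assert (PB : forall t, 0 <= t <= t1 -> nrm (P (Rt t)) <= 10 * K).
  { intros t Ht.
    pose proof (dist2_weak_triangle n 1 (P (Rt t)) (Rt t) (fun _ _ _ _ => 0) ltac:(lra)) as X.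
    rewrite (dist2_sym n (P (Rt t)) (Rt t)), Rinv_1 in X.
    pose proof (HK t Ht); pose proof (dB t Ht); unfold nrm, d in *; lra. }
  destruct (Qop_one_sided_lipschitz n (10 * K + 1) ltac:(lra)) as [L [L0 HL]].
  assert (Z : d t1 <= 0).
  { apply (dini_gronwall d t1 L); auto; try lra.
    - apply Rle_antisym; auto; pose proof (Pmin (Rt 0) (Rt 0) F0) as X; rewrite self in X; exact X.
    - intros t eps Ht He.
      (* Half of [eps] pays for [kap d], through the a priori bound [d <= 4 K]; the other half is
         met by taking [s] close to [t]. *)
      set (kap := eps / (8 * K + 2)).
      assert (kp : 0 < kap) by (apply Rdiv_lt_0_compat; lra).
      assert (kk : kap * (4 * K) < eps / 2).
      { replace (eps / 2) with (kap * (4 * K + 1)) by (unfold kap; field; lra).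
        apply Rmult_lt_compat_l; lra. }
      pose proof (Rinv_0_lt_compat _ kp) as ik.
      destruct (Cdist t (eps / 2 / (1 + / kap))) as [del [dp Hd]]; [lra|
        apply Rdiv_lt_0_compat; lra|].
      exists del; split; auto; intros s Hs Hst; specialize (Hd s ltac:(lra) Hst).
      assert (Hd' : (1 + / kap) * dist2 n (Rt s) (Rt t) < eps / 2).
      { replace (eps / 2) with ((1 + / kap) * (eps / 2 / (1 + / kap))) by (field; lra).
        apply Rmult_lt_compat_l; lra. }
      assert (A1 : d s <= (1 + kap) * d t + (1 + / kap) * dist2 n (Rt s) (Rt t)).
      { eapply Rle_trans; [apply (Pmin (Rt s) (P (Rt t)) (PF _))|].
        apply dist2_weak_triangle; auto. }
      assert (A2 : d t <= (1 + kap) * d s + (1 + / kap) * dist2 n (Rt s) (Rt t)).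
      { eapply Rle_trans; [apply (Pmin (Rt t) (P (Rt s)) (PF _))|].
        rewrite (dist2_sym n (Rt s) (Rt t)); apply dist2_weak_triangle; auto. }
      assert (kap * d t <= kap * (4 * K)) by (apply Rmult_le_compat_l; [lra|apply dB; lra]).
      assert (kap * d s <= kap * (4 * K)) by (apply Rmult_le_compat_l; [lra|apply dB; lra]).
      apply Rabs_def1; lra.
    - intros t eps Ht He.
      set (X := Rt t); set (Y := P X).
      set (w := nrm W); set (N4 := sum4 n (fun _ _ _ _ => 1)).
      assert (w0 : 0 <= w) by apply dist2_nonneg.
      assert (N40 : 0 <= N4) by (apply sum4_nonneg; intros; lra).
      assert (dt0 : 0 <= d t) by auto.
      (* [e] bounds both the error of the difference quotient and the weight of [W], so that the
         errors of first order in [h] cost at most [h eps / 2]. The terms in [h^2], measured by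
         [KK], cost the other half. *)
      set (e := Rmin 1 (eps / 2 / (2 * d t + w + N4 + 1))).
      assert (e0 : 0 < e).
      { apply Rmin_pos; [lra|]; apply Rdiv_lt_0_compat; lra. }
      assert (e1 : e <= 1) by apply Rmin_l.
      assert (e2 : e * (2 * d t + w + N4) <= eps / 2).
      { apply Rle_trans with (eps / 2 / (2 * d t + w + N4 + 1) * (2 * d t + w + N4 + 1)).
        - apply Rmult_le_compat; try lra; apply Rmin_r.
        - right; field; lra. }
      set (B := fun i j k l => Qop n X i j k l - Qop n Y i j k l).
      set (KK := sum4 n (fun i j k l => (Rabs (B i j k l) + Rabs (W i j k l) + 1) ^ 2)).
      assert (KK0 : 0 <= KK) by (apply sum4_nonneg; intros; apply pow2_ge_0).
      destruct (Tan Y e (PF X) e0) as [tau0 [tp Htau]].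
      destruct (finite_uniform4 n (fun i j k l h =>
        Rabs ((Rt (t + h) i j k l - X i j k l) / h - Qop n X i j k l) < e)) as [del [dp Hdel]].
      { intros i j k l Hi Hj Hk Hl.
        destruct (Der t ltac:(lra) i j k l Hi Hj Hk Hl e e0) as [dl Hdl].
        exists dl; split; [apply cond_pos|]; intros h Hh.
        apply Hdl; [lra|]; rewrite Rabs_right; lra. }
      exists (Rmin del (Rmin tau0 (eps / 2 / (KK + 1)))).
      assert (kp : 0 < eps / 2 / (KK + 1)) by (apply Rdiv_lt_0_compat; lra).
      split; [repeat apply Rmin_pos; auto|]; intros h [h0 Hh] _.
      pose proof (Rmin_l del (Rmin tau0 (eps / 2 / (KK + 1)))).
      pose proof (Rmin_r del (Rmin tau0 (eps / 2 / (KK + 1)))).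
      pose proof (Rmin_l tau0 (eps / 2 / (KK + 1))).
      pose proof (Rmin_r tau0 (eps / 2 / (KK + 1))).
      assert (hk : h * KK <= eps / 2).
      { apply Rle_trans with (eps / 2 / (KK + 1) * (KK + 1)).
        - apply Rmult_le_compat; lra.
        - right; field; lra. }
      specialize (Hdel h ltac:(lra)); specialize (Htau h ltac:(lra)).
      eapply Rle_trans; [apply (Pmin (Rt (t + h)) _ Htau)|].
      assert (Q2 : 2 * sum4 n (fun i j k l => (X i j k l - Y i j k l) * B i j k l) <= L * d t).
      { apply HL; intros i j k l Hi Hj Hk Hl; split.
        - eapply Rle_trans; [apply entry; auto|]; pose proof (HK t ltac:(lra)); unfold X; lra.
        - eapply Rle_trans; [apply entry; auto|]; pose proof (PB t ltac:(lra)); unfold Y, X; lra. }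
      apply Rle_trans with (sum4 n (fun i j k l => (X i j k l - Y i j k l) ^ 2
        + (2 * h * ((X i j k l - Y i j k l) * B i j k l)
        + (h * e * (2 * (X i j k l - Y i j k l) ^ 2 + ((W i j k l - 0) ^ 2 + 1))
        + h * h * (Rabs (B i j k l) + Rabs (W i j k l) + 1) ^ 2)))).
      + apply sum4_le; intros i j k l Hi Hj Hk Hl.
        specialize (Hdel i j k l Hi Hj Hk Hl).
        set (rho := (Rt (t + h) i j k l - X i j k l) / h - Qop n X i j k l) in *.
        set (N := X i j k l - Y i j k l); set (b := B i j k l); set (ww := W i j k l).
        assert (E : Rt (t + h) i j k l - (Y i j k l + h * (Qop n Y i j k l + e * ww)) =
          N + h * (b + (rho - e * ww))).
        { unfold N, b, B, rho; field; lra. }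
        rewrite E; apply Rabs_def2 in Hdel; destruct Hdel as [R1 R2].
        assert (C1 : 2 * (N * (rho - e * ww)) <= e * (2 * N ^ 2 + ((ww - 0) ^ 2 + 1))).
        { assert (2 * (N * rho) <= e * (N ^ 2 + 1)).
          { pose proof (pow2_ge_0 (N - 1)); pose proof (pow2_ge_0 (N + 1)).
            destruct (Rle_lt_dec 0 N).
            - assert (N * rho <= N * e) by (apply Rmult_le_compat_l; lra); nra.
            - assert (- N * (- rho) <= - N * e) by (apply Rmult_le_compat_l; lra); nra. }
          assert (0 <= e * (N + ww) ^ 2) by (apply Rmult_le_pos; [lra|apply pow2_ge_0]).
          lra. }
        assert (C2 : (b + (rho - e * ww)) ^ 2 <= (Rabs b + Rabs ww + 1) ^ 2).
        { assert (Ab : Rabs (b + (rho - e * ww)) <= Rabs b + Rabs ww + 1).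
          { eapply Rle_trans; [apply Rabs_triang|].
            assert (Rabs (rho - e * ww) <= 1 + Rabs ww); [|lra].
            eapply Rle_trans; [apply Rabs_triang|]; rewrite Rabs_Ropp, Rabs_mult.
            rewrite (Rabs_right e) by lra.
            assert (Rabs rho <= 1) by (apply Rabs_le; lra).
            assert (e * Rabs ww <= 1 * Rabs ww) by (apply Rmult_le_compat_r; [apply Rabs_pos|lra]).
            lra. }
          rewrite <- (pow2_abs (b + (rho - e * ww))).
          apply pow_incr; split; [apply Rabs_pos|auto]. }
        replace ((N + h * (b + (rho - e * ww))) ^ 2) with
          (N ^ 2 + (2 * h * (N * b) + (h * (2 * (N * (rho - e * ww)))
            + h * h * (b + (rho - e * ww)) ^ 2))) by ring.
        apply Rplus_le_compat_l, Rplus_le_compat_l, Rplus_le_compat.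
        * rewrite Rmult_assoc; apply Rmult_le_compat_l; [lra|exact C1].
        * apply Rmult_le_compat_l; [nra|exact C2].
      + rewrite sum4_plus, sum4_plus, sum4_plus, !sum4_scal, sum4_plus, sum4_plus, sum4_scal.
        fold (dist2 n X Y) (dist2 n W (fun _ _ _ _ => 0)) KK N4.
        change (dist2 n X Y) with (d t); fold (nrm W) w.
        assert (h * e * (2 * d t + (w + N4)) <= h * (eps / 2)).
        { rewrite Rmult_assoc; apply Rmult_le_compat_l; lra. }
        assert (h * h * KK <= h * (eps / 2)).
        { rewrite Rmult_assoc; apply Rmult_le_compat_l; lra. }
        assert (h * (2 * sum4 n (fun i j k l => (X i j k l - Y i j k l) * B i j k l))
          <= h * (L * d t)) by (apply Rmult_le_compat_l; lra).
        lra. }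
  apply Cl; intros eps He; exists (P (Rt t1)); split; auto; unfold d in Z; lra.
Qed.

(* All sectional curvatures vanish, so [T] is antisymmetric in its first and third index, hence
   in its first three, and Bianchi's identity reads [3 T = 0]. *)
Lemma PIC2_scal_zero n T : PIC2 n T ->
  (forall i k, (i < n)%nat -> (k < n)%nat -> Ric n T i k = 0) -> is_zero n T.
Proof.
  intros PT R0; assert (A : is_act n T) by apply PT.
  assert (Z : forall x j l, (j < n)%nat -> (l < n)%nat -> m13 n T x x j l = 0).
  { intros x j l; apply (psd_trace_zero n (m13 n T x x)).
    - intros p q Hp Hq; apply m13_sym; auto.
    - intros u; pose proof (ev_sectional_nonneg n T x u PT) as E; rewrite ev_m13 in E; exact E.
    - unfold tr, m13; rewrite rsum_swap; apply rsum_0; intros i Hi.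
      rewrite rsum_swap; apply rsum_0; intros k Hk.
      transitivity (Ric n T i k * (x i * x k)); [|rewrite R0 by auto; ring].
      unfold Ric; rewrite <- rsum_scal_r; apply rsum_ext; intros; ring. }
  assert (E : forall i j k l, (i < n)%nat -> (j < n)%nat -> (k < n)%nat -> (l < n)%nat ->
    T i j k l = - T k j i l).
  { intros i j k l Hi Hj Hk Hl.
    set (C := fun a b => T a j b l).
    assert (ZC : forall x, bil n C x x = 0) by (intros x; apply (Z x j l); auto).
    pose proof (ZC (fun a => kdelta i a + 1 * kdelta k a)) as X.
    rewrite bil_lin, !bil_lin_r, !ZC, !bil_kdelta in X by auto; unfold C in X; lra. }
  intros i j k l Hi Hj Hk Hl.
  pose proof (act_bianchi n T i j k l A Hi Hj Hk Hl) as B.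
  rewrite (E j k i l), (act_anti12 n T i k j l), (act_anti12 n T k i j l), (E i k j l),
    (E j k i l), (act_anti12 n T i k j l) in B by auto.
  pose proof (E i j k l Hi Hj Hk Hl); pose proof (E j k i l Hj Hk Hi Hl).
  pose proof (act_anti12 n T i j k l A Hi Hj Hk Hl).
  pose proof (act_anti12 n T k j i l A Hk Hj Hi Hl).
  pose proof (act_anti12 n T k i j l A Hk Hi Hj Hl).
  pose proof (E k i j l Hk Hi Hj Hl); lra.
Qed.

(** A positive semidefinite form of trace zero vanishes, so [tr H = 0] gives [H = 0]. As
    [theta > 0], it also gives [scal T = 0], hence [T = 0]. *)
Lemma Ccone_not_zero n s theta T H : 2 * s < INR n -> 0 < s -> 0 < theta ->
  PIC2 n T -> (forall i k, (i < n)%nat -> (k < n)%nat -> Ric0 n T i k = 0) ->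
  is_sym n H -> psd n (gform n s H) -> 0 <= tr n H - theta * scal n T ->
  ~ is_zero n (fun i j k l => T i j k l + kn H idf i j k l) -> 0 < tr n H.
Proof.
  intros Hs s0 Hth PT RT SH PH C NZ.
  assert (h0 : 0 <= tr n H).
  { pose proof (tr_nonneg n _ PH) as X; rewrite tr_gform in X.
    apply Rmult_le_reg_l with (2 * s); lra. }
  destruct h0 as [|h0]; auto; exfalso; apply NZ.
  assert (ZH : forall i j, (i < n)%nat -> (j < n)%nat -> H i j = 0).
  { intros i j Hi Hj.
    pose proof (psd_trace_zero n _ i j (gform_sym n s H SH) PH) as X.
    rewrite tr_gform, <- h0 in X; specialize (X ltac:(ring) Hi Hj).
    unfold gform in X; rewrite <- h0 in X.
    apply Rmult_eq_reg_l with (INR n - 2 * s); lra. }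
  pose proof (scal_nonneg n T PT) as s1.
  assert (sz : scal n T = 0) by nra.
  assert (ZT : is_zero n T).
  { apply PIC2_scal_zero; auto; intros i k Hi Hk.
    rewrite (Ric0_zero_einstein n T i k) by auto; rewrite sz; unfold Rdiv; ring. }
  intros i j k l Hi Hj Hk Hl; rewrite ZT by auto; unfold kn; rewrite !ZH by auto; ring.
Qed.

(** * Size estimates for a small perturbation *)

Lemma Rabs_le_bounds x b : Rabs x <= b -> - b <= x <= b.
Proof. unfold Rabs; destruct Rcase_abs; lra. Qed.

Lemma pic2_re_bound n T b x y u v : unitary n x y u v ->
  (forall i j k l, (i < n)%nat -> (j < n)%nat -> (k < n)%nat -> (l < n)%nat ->
     Rabs (T i j k l) <= b) ->
  Rabs (pic2_re n T x y u v) <= 8 * sum4 n (fun _ _ _ _ => 1) * b.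
Proof.
  intros [N1 [N2 _]] B.
  pose proof (dot_nonneg n x); pose proof (dot_nonneg n y).
  pose proof (dot_nonneg n u); pose proof (dot_nonneg n v).
  assert (X : forall i, (i < n)%nat -> Rabs (x i) <= 1) by
    (intros; apply (dot_bounds_entry n); auto; lra).
  assert (Y : forall i, (i < n)%nat -> Rabs (y i) <= 1) by
    (intros; apply (dot_bounds_entry n); auto; lra).
  assert (U : forall i, (i < n)%nat -> Rabs (u i) <= 1) by
    (intros; apply (dot_bounds_entry n); auto; lra).
  assert (V : forall i, (i < n)%nat -> Rabs (v i) <= 1) by
    (intros; apply (dot_bounds_entry n); auto; lra).
  assert (prod : forall p q, Rabs p <= 1 -> Rabs q <= 1 -> Rabs (p * q) <= 1).
  { intros p q Hp Hq; rewrite Rabs_mult; pose proof (Rabs_pos p); pose proof (Rabs_pos q); nra. }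
  assert (pair : forall p q, Rabs p <= 1 -> Rabs q <= 1 -> Rabs (p + q) <= 2).
  { intros p q Hp Hq; eapply Rle_trans; [apply Rabs_triang|lra]. }
  assert (pairm : forall p q, Rabs p <= 1 -> Rabs q <= 1 -> Rabs (p - q) <= 2).
  { intros p q Hp Hq; apply pair; auto; rewrite Rabs_Ropp; auto. }
  assert (entry : forall i j k l, (i < n)%nat -> (j < n)%nat -> (k < n)%nat -> (l < n)%nat ->
    Rabs (T i j k l * ((x i * x k + y i * y k) * (u j * u l + v j * v l)
      - (y i * x k - x i * y k) * (v j * u l - u j * v l))) <= (8 * b) * 1).
  { intros i j k l Hi Hj Hk Hl; rewrite Rabs_mult, Rmult_1_r, (Rmult_comm 8).
    apply Rmult_le_compat; try apply Rabs_pos; auto.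
    eapply Rle_trans; [apply Rabs_triang|]; rewrite Rabs_Ropp, !Rabs_mult.
    pose proof (pair _ _ (prod _ _ (X i Hi) (X k Hk)) (prod _ _ (Y i Hi) (Y k Hk))).
    pose proof (pair _ _ (prod _ _ (U j Hj) (U l Hl)) (prod _ _ (V j Hj) (V l Hl))).
    pose proof (pairm _ _ (prod _ _ (Y i Hi) (X k Hk)) (prod _ _ (X i Hi) (Y k Hk))).
    pose proof (pairm _ _ (prod _ _ (V j Hj) (U l Hl)) (prod _ _ (U j Hj) (V l Hl))).
    replace 8 with (2 * 2 + 2 * 2) by ring.
    apply Rplus_le_compat; apply Rmult_le_compat; auto; apply Rabs_pos. }
  replace (8 * sum4 n (fun _ _ _ _ => 1) * b) with ((8 * b) * sum4 n (fun _ _ _ _ => 1)) by ring.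
  rewrite <- sum4_scal; apply Rabs_le; split.
  - match goal with |- - ?s <= _ => replace (- s) with (-1 * s) by ring end.
    rewrite <- sum4_scal; apply sum4_le; intros i j k l Hi Hj Hk Hl.
    specialize (entry i j k l Hi Hj Hk Hl); unfold Rabs in entry; destruct Rcase_abs in entry; lra.
  - apply sum4_le; intros; eapply Rle_trans; [apply Rle_abs|auto].
Qed.

Lemma bil_entry_bound n A b e : dot n e e = 1 ->
  (forall i j, (i < n)%nat -> (j < n)%nat -> Rabs (A i j) <= b) ->
  Rabs (bil n A e e) <= INR n * INR n * b.
Proof.
  intros D B; replace (INR n * INR n * b) with (rsum n (fun _ => rsum n (fun _ => b)))
    by (rewrite !rsum_const; ring).
  eapply Rle_trans; [apply rsum_Rabs|]; apply rsum_le; intros i Hi.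
  eapply Rle_trans; [apply rsum_Rabs|]; apply rsum_le; intros j Hj.
  rewrite !Rabs_mult.
  pose proof (dot_bounds_entry n e i ltac:(lra) Hi); pose proof (dot_bounds_entry n e j ltac:(lra) Hj).
  pose proof (Rabs_pos (A i j)); pose proof (Rabs_pos (e i)); pose proof (Rabs_pos (e j)).
  specialize (B i j Hi Hj).
  assert (Rabs (e i) * Rabs (e j) <= 1) by nra.
  replace b with (b * 1) by ring; rewrite Rmult_assoc; apply Rmult_le_compat; auto.
  apply Rmult_le_pos; auto.
Qed.

Lemma Ric_bound n D b i k : (forall i j k l, (i < n)%nat -> (j < n)%nat -> (k < n)%nat ->
    (l < n)%nat -> Rabs (D i j k l) <= b) -> (i < n)%nat -> (k < n)%nat ->
  Rabs (Ric n D i k) <= INR n * b.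
Proof.
  intros B Hi Hk; rewrite <- rsum_const; eapply Rle_trans; [apply rsum_Rabs|].
  apply rsum_le; auto.
Qed.

Lemma scal_bound n D b : (forall i j k l, (i < n)%nat -> (j < n)%nat -> (k < n)%nat ->
    (l < n)%nat -> Rabs (D i j k l) <= b) -> Rabs (scal n D) <= INR n * (INR n * b).
Proof.
  intros B; rewrite <- rsum_const; eapply Rle_trans; [apply rsum_Rabs|].
  apply rsum_le; intros; apply Ric_bound; auto.
Qed.

Lemma kdelta_bound i j : Rabs (kdelta i j) <= 1.
Proof.
  unfold kdelta; destruct (Nat.eqb i j); [rewrite Rabs_R1|rewrite Rabs_R0]; lra.
Qed.

(** With [h = 0] the trace part of a perturbation is traceless, so that its scalar curvature goes
    entirely into the Einstein part. *)
Lemma trace_part_bound n D b i k : (5 <= n)%nat ->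
  (forall i j k l, (i < n)%nat -> (j < n)%nat -> (k < n)%nat -> (l < n)%nat ->
     Rabs (D i j k l) <= b) -> (i < n)%nat -> (k < n)%nat ->
  Rabs (trace_part n D 0 i k) <= 2 * INR n * b.
Proof.
  intros Hn B Hi Hk; pose proof (INR_ge_5 n Hn) as N5.
  unfold trace_part, Ric0; rewrite !Rmult_0_l, Rplus_0_r, Rabs_mult.
  assert (i1 : 0 < / (INR n - 2) <= 1).
  { split; [apply Rinv_0_lt_compat; lra|]; rewrite <- Rinv_1; apply Rinv_le_contravar; lra. }
  rewrite (Rabs_right (/ (INR n - 2))) by lra.
  pose proof (Ric_bound n D b i k B Hi Hk) as R1.
  pose proof (scal_bound n D b B) as R2.
  assert (R3 : Rabs (/ INR n * scal n D * kdelta i k) <= INR n * b).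
  { rewrite !Rabs_mult.
    pose proof (kdelta_bound i k); pose proof (Rabs_pos (kdelta i k)); pose proof (Rabs_pos (scal n D)).
    assert (i2 : 0 < / INR n) by (apply Rinv_0_lt_compat; lra).
    rewrite (Rabs_right (/ INR n)) by lra.
    assert (E : / INR n * Rabs (scal n D) <= INR n * b).
    { replace (INR n * b) with (/ INR n * (INR n * (INR n * b))) by (field; lra).
      apply Rmult_le_compat_l; lra. }
    assert (0 <= / INR n * Rabs (scal n D)) by (apply Rmult_le_pos; lra).
    replace (INR n * b) with (INR n * b * 1) by ring; apply Rmult_le_compat; lra. }
  assert (R4 : Rabs (Ric n D i k - / INR n * scal n D * kdelta i k) <= 2 * INR n * b).
  { eapply Rle_trans; [apply Rabs_triang|]; rewrite Rabs_Ropp; lra. }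
  pose proof (Rabs_pos (Ric n D i k - / INR n * scal n D * kdelta i k)).
  replace (2 * INR n * b) with (1 * (2 * INR n * b)) by ring; apply Rmult_le_compat; lra.
Qed.

Lemma einstein_part_bound n D b i j k l : (5 <= n)%nat ->
  (forall i j k l, (i < n)%nat -> (j < n)%nat -> (k < n)%nat -> (l < n)%nat ->
     Rabs (D i j k l) <= b) -> (i < n)%nat -> (j < n)%nat -> (k < n)%nat -> (l < n)%nat ->
  Rabs (einstein_part n D 0 i j k l) <= (1 + 8 * INR n) * b.
Proof.
  intros Hn B Hi Hj Hk Hl.
  assert (P : forall i k j l, (i < n)%nat -> (k < n)%nat ->
    Rabs (trace_part n D 0 i k * idf j l) <= 2 * INR n * b).
  { intros i' k' j' l' Hi' Hk'; rewrite Rabs_mult.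
    pose proof (trace_part_bound n D b i' k' Hn B Hi' Hk'); pose proof (kdelta_bound j' l').
    pose proof (Rabs_pos (trace_part n D 0 i' k')); pose proof (Rabs_pos (idf j' l')).
    replace (2 * INR n * b) with (2 * INR n * b * 1) by ring; apply Rmult_le_compat; auto. }
  unfold einstein_part, kn.
  pose proof (P i k j l Hi Hk) as Q1; pose proof (P i l j k Hi Hl) as Q2.
  pose proof (P j k i l Hj Hk) as Q3; pose proof (P j l i k Hj Hl) as Q4.
  pose proof (B i j k l Hi Hj Hk Hl) as Q5.
  set (q1 := trace_part n D 0 i k * idf j l) in *.
  set (q2 := trace_part n D 0 i l * idf j k) in *.
  set (q3 := trace_part n D 0 j k * idf i l) in *.
  set (q4 := trace_part n D 0 j l * idf i k) in *.
  apply Rabs_le_bounds in Q1, Q2, Q3, Q4, Q5; apply Rabs_le; lra.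
Qed.

(** * The bound on [theta], and tangency and transversality of the cones *)

Definition theta_bound (n : nat) : R := 2 / (INR n * growth n).

Lemma growth_ge n : (5 <= n)%nat -> 1 <= growth n.
Proof.
  intros Hn; pose proof (INR_ge_5 n Hn); unfold growth; pose proof (pow2_ge_0 (INR n)); lra.
Qed.

Lemma theta_bound_pos n : (5 <= n)%nat -> 0 < theta_bound n <= 1.
Proof.
  intros Hn; pose proof (INR_ge_5 n Hn); pose proof (growth_ge n Hn).
  assert (5 * 1 <= INR n * growth n) by (apply Rmult_le_compat; lra).
  unfold theta_bound; split; [apply Rdiv_lt_0_compat; lra|].
  apply Rmult_le_reg_r with (INR n * growth n); [lra|].
  unfold Rdiv; rewrite Rmult_assoc, Rinv_l by lra; lra.
Qed.

(** When [h = theta scal T = theta n lam], the lower bound in the last estimate of [tangent_data]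
    becomes [theta n lam^2 (2 - growth * n * theta)]; [theta_bound] is the zero of the last
    factor. *)
Lemma theta_bound_mul n theta : (5 <= n)%nat ->
  (theta <= theta_bound n -> 0 <= 2 - growth n * INR n * theta) /\
  (theta < theta_bound n -> 0 < 2 - growth n * INR n * theta).
Proof.
  intros Hn; pose proof (INR_ge_5 n Hn); pose proof (growth_ge n Hn).
  assert (P : 5 * 1 <= INR n * growth n) by (apply Rmult_le_compat; lra).
  assert (E : growth n * INR n * theta_bound n = 2) by (unfold theta_bound; field; lra).
  split; intros L.
  - assert (growth n * INR n * theta <= growth n * INR n * theta_bound n)
      by (apply Rmult_le_compat_l; lra); lra.
  - assert (growth n * INR n * theta < growth n * INR n * theta_bound n)
      by (apply Rmult_lt_compat_l; lra); lra.
Qed.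

Lemma Ccone_tangent n s theta P eps : (5 <= n)%nat -> 0 < s <= 2 ->
  0 <= theta <= theta_bound n -> Ccone n s theta P -> 0 < eps ->
  exists tau0, 0 < tau0 /\ forall tau, 0 < tau <= tau0 ->
    Ccone n s theta
      (fun i j k l => P i j k l + tau * (Qop n P i j k l + eps * barrier n theta i j k l)).
Proof.
  intros Hn Hs Hth [A [T [H [_ [PT [RT [SH [PH [C E]]]]]]]]] He.
  pose proof (theta_bound_pos n Hn) as tb; pose proof (INR_ge_5 n Hn) as N5.
  pose proof (proj1 (theta_bound_mul n theta Hn) (proj2 Hth)) as tm.
  set (lam := scal n T / INR n).
  assert (El : scal n T = INR n * lam) by (unfold lam; field; lra).
  assert (l0 : 0 <= lam).
  { apply Rmult_le_reg_l with (INR n); [lra|]; rewrite <- El, Rmult_0_r; apply scal_nonneg; auto. }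
  (* With [c = 0] both inequalities between [c] and [s] are trivial, so the exceptional values of
     [s] are included. *)
  destruct (tangent_data n s 0 T H lam Hn Hs (Rle_refl 0)) as
    [T' [H' [EQ [AT' [RT' [SH' [D1 [D2 D3]]]]]]]]; auto.
  { rewrite Rmult_0_r, Rmult_0_l; apply pow2_ge_0. }
  { rewrite Rmult_0_r, Rmult_0_l; apply pow2_ge_0. }
  { intros i k Hi Hk; apply Ric0_zero_einstein; auto. }
  destruct (tangent_criterion n s theta eps T H T' H') as [tau0 [tp Htau]]; auto; try lra; try lia.
  - intros x y u v _ Z; specialize (D1 x y u v Z); lra.
  - intros e De Z; specialize (D2 e De Z); lra.
  - intros Eh; specialize (D3 theta ltac:(lra)); rewrite Eh, El in D3.
    assert (X : 0 <= theta * INR n * lam ^ 2 * (2 - growth n * INR n * theta)).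
    { apply Rmult_le_pos; auto; apply Rmult_le_pos; [|apply pow2_ge_0].
      apply Rmult_le_pos; lra. }
    lra.
  - exists tau0; split; auto; intros tau Ht; eapply Ccone_ext; [|apply (Htau tau Ht)].
    intros i j k l Hi Hj Hk Hl; rewrite (E i j k l), (Qop_ext n _ _ E i j k l), (EQ i j k l) by auto.
    reflexivity.
Qed.

(** Strict inequalities from [tangent_data] leave room for every [Y] near [Q X]: its deviation is
    split between [T'] and [H'], and [tangent_criterion] applies to the perturbed data. *)
Lemma Ccone_transversal n s theta : (5 <= n)%nat -> 0 < s < 2 -> s <> 1 ->
  0 < theta < theta_bound n -> transversally_invariant n (Ccone n s theta).
Proof.
  intros Hn Hs Hs1 Hth X [AX [CX _]] NZ.
  assert (CC : Ccone n s theta X) by (apply Ccone_closed; auto; try lra; lia).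
  destruct CC as [_ [T [H [_ [PT [RT [SH [PH [C E]]]]]]]]].
  pose proof (theta_bound_pos n Hn) as tb; pose proof (INR_ge_5 n Hn) as N5.
  pose proof (proj2 (theta_bound_mul n theta Hn) (proj2 Hth)) as tm.
  set (lam := scal n T / INR n).
  assert (El : scal n T = INR n * lam) by (unfold lam; field; lra).
  assert (h0 : 0 < tr n H).
  { apply (Ccone_not_zero n s theta T H); auto; try lra.
    intros Z; apply NZ; intros i j k l Hi Hj Hk Hl; rewrite E by auto; apply Z; auto. }
  assert (q1 : 0 < (1 - s) ^ 2).
  { rewrite <- Rsqr_pow2; apply Rsqr_pos_lt; lra. }
  assert (q2 : 0 < (1 - s / 2) ^ 2).
  { rewrite <- Rsqr_pow2; apply Rsqr_pos_lt; lra. }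
  assert (s2 : 0 < s ^ 2) by (apply pow_lt; lra).
  (* This leads to the largest [c] allowed by both inequalities of [tangent_data], positive since
     [s] is neither 1 nor 2. *)
  set (m := Rmin ((1 - s) ^ 2) ((1 - s / 2) ^ 2)).
  assert (m0 : 0 < m) by (apply Rmin_pos; auto).
  set (c := m / (2 * s ^ 2)).
  assert (c0 : 0 < c) by (apply Rdiv_lt_0_compat; lra).
  assert (Ec : 2 * c * s ^ 2 = m) by (unfold c; field; lra).
  destruct (tangent_data n s c T H lam Hn ltac:(lra) ltac:(lra)) as
    [T' [H' [EQ [AT' [RT' [SH' [D1 [D2 D3]]]]]]]]; auto.
  { rewrite Ec; apply Rmin_l. }
  { rewrite Ec; apply Rmin_r. }
  { intros i k Hi Hk; apply Ric0_zero_einstein; auto. }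
  set (t := 2 * s * tr n H / (INR n - 2 * s)) in *.
  assert (t0 : 0 < t).
  { apply Rdiv_lt_0_compat; [repeat apply Rmult_lt_0_compat|]; lra. }
  assert (t2 : 0 < t ^ 2) by (apply pow_lt; auto).
  assert (ct : 0 < c * t ^ 2) by (apply Rmult_lt_0_compat; auto).
  assert (sct : 0 < 2 * s * c * t ^ 2).
  { rewrite (Rmult_assoc (2 * s)); apply Rmult_lt_0_compat; lra. }
  (* The third condition has to hold only where [tr H = theta scal T]; there [tr H > 0] forces
     [lam > 0]. Elsewhere the value 1 is an arbitrary default. *)
  assert (slack : exists sl, 0 < sl /\
    (tr n H = theta * scal n T -> sl <= tr n H' - theta * scal n T')).
  { destruct (Req_dec (tr n H) (theta * scal n T)) as [Eh|Nh]; [|exists 1; split; [lra|tauto]].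
    assert (l0 : 0 < lam).
    { apply Rmult_lt_reg_l with (theta * INR n); [apply Rmult_lt_0_compat; lra|].
      rewrite Rmult_0_r, Rmult_assoc, <- El, <- Eh; auto. }
    exists (theta * INR n * lam ^ 2 * (2 - growth n * INR n * theta)); split.
    - apply Rmult_lt_0_compat; auto; apply Rmult_lt_0_compat; [|apply pow_lt; auto].
      apply Rmult_lt_0_compat; lra.
    - intros _; specialize (D3 theta ltac:(lra)); rewrite Eh, El in D3; lra. }
  destruct slack as [sl [sl0 Hsl]].
  (* [K1 b], [K2 b] and [K3 b] bound the effect on the three conditions of a perturbation whose
     entries are at most [b]. *)
  set (K1 := 8 * sum4 n (fun _ _ _ _ => 1) * (1 + 8 * INR n)).
  set (K2 := INR n * INR n * (INR n * (2 * INR n))).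
  set (K3 := INR n * INR n).
  assert (k1 : 0 <= K1).
  { apply Rmult_le_pos; [|lra]; apply Rmult_le_pos; [lra|]; apply sum4_nonneg; intros; lra. }
  assert (k2 : 0 <= K2) by (unfold K2; repeat apply Rmult_le_pos; lra).
  assert (k3 : 0 <= K3) by (apply Rmult_le_pos; lra).
  set (v := Rmin (2 * (c * t ^ 2)) (Rmin (2 * s * c * t ^ 2) sl)).
  assert (v0 : 0 < v) by (repeat apply Rmin_pos; lra).
  assert (v1 : v <= 2 * (c * t ^ 2)) by apply Rmin_l.
  assert (v2 : v <= 2 * s * c * t ^ 2) by (eapply Rle_trans; [apply Rmin_r|apply Rmin_l]).
  assert (v3 : v <= sl) by (eapply Rle_trans; [apply Rmin_r|apply Rmin_r]).
  set (b := v / (K1 + K2 + K3 + 1)).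
  assert (b0 : 0 < b) by (apply Rdiv_lt_0_compat; lra).
  assert (Eb : b * (K1 + K2 + K3 + 1) = v) by (unfold b; field; lra).
  assert (b1 : K1 * b <= v) by nra.
  assert (b2 : K2 * b <= v) by nra.
  assert (b3 : K3 * b <= v) by nra.
  exists (b * b); split; [nra|]; intros Y AY HY.
  set (D := fun i j k l => Y i j k l + -1 * Qop n X i j k l).
  assert (AD : is_act n D) by (apply act_lin; auto; apply act_Qop; auto).
  assert (BD : forall i j k l, (i < n)%nat -> (j < n)%nat -> (k < n)%nat -> (l < n)%nat ->
     Rabs (D i j k l) <= b).
  { intros i j k l Hi Hj Hk Hl; pose proof (dist2_entry n (Qop n X) Y i j k l Hi Hj Hk Hl).
    unfold D; apply Rabs_le; nra. }
  set (T2 := fun i j k l => T' i j k l + 1 * einstein_part n D 0 i j k l).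
  set (H2 := fun i j => H' i j + 1 * trace_part n D 0 i j).
  assert (trD : tr n (trace_part n D 0) = 0) by (apply tr_trace_part; lia).
  assert (EY : teq n Y (fun i j k l => T2 i j k l + kn H2 idf i j k l)).
  { intros i j k l Hi Hj Hk Hl.
    transitivity (Qop n X i j k l + D i j k l); [unfold D; ring|].
    rewrite (Qop_ext n _ _ E i j k l), (EQ i j k l) by auto.
    unfold T2, H2, einstein_part, kn; ring. }
  split; auto; intros e0 He0.
  set (nb := sum4 n (fun i j k l => (barrier n theta i j k l) ^ 2)).
  assert (nb0 : 0 <= nb) by (apply sum4_nonneg; intros; apply pow2_ge_0).
  (* Since [eps <= 1], this gives [eps^2 nb <= eps nb < e0], so the barrier term stays within the
     tolerance of the closure. *)
  set (eps := Rmin 1 (e0 / (nb + 1))).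
  assert (ep0 : 0 < eps) by (apply Rmin_pos; [lra|apply Rdiv_lt_0_compat; lra]).
  assert (ep1 : eps <= 1) by apply Rmin_l.
  assert (ep2 : eps * (nb + 1) <= e0).
  { apply Rle_trans with (e0 / (nb + 1) * (nb + 1)).
    - apply Rmult_le_compat_r; [lra|apply Rmin_r].
    - right; field; lra. }
  destruct (tangent_criterion n s theta eps T H T2 H2) as [tau0 [tp Htau]]; auto; try lra; try lia.
  - apply act_lin; auto; apply act_einstein_part; auto.
  - intros i k Hi Hk; specialize (RT' i k Hi Hk).
    pose proof (Ric0_einstein_part n D 0 i k ltac:(lia) Hi Hk) as RD.
    unfold Ric0 in *; unfold T2; rewrite Ric_lin, scal_lin; lra.
  - intros i j Hi Hj; unfold H2; rewrite (SH' i j), (trace_part_sym n D 0 AD i j) by auto.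
    reflexivity.
  - intros x y u w U Z; specialize (D1 x y u w Z); rewrite pic2_re_idf_unitary in D1 by auto.
    unfold T2; rewrite pic2_re_lin.
    pose proof (pic2_re_bound n (einstein_part n D 0) ((1 + 8 * INR n) * b) x y u w U
      (fun i j k l => einstein_part_bound n D b i j k l Hn BD)) as B1.
    apply Rabs_le_bounds in B1; unfold K1 in b1; lra.
  - intros e De Z; specialize (D2 e De Z).
    assert (EG : bil n (gform n s H2) e e = bil n (gform n s H') e e
      + - (INR n - 2 * s) * bil n (trace_part n D 0) e e).
    { rewrite !bil_gform; unfold H2; rewrite tr_lin, bil_form_lin, trD; ring. }
    rewrite EG.
    pose proof (bil_entry_bound n (trace_part n D 0) (2 * INR n * b) e De
      (fun i j => trace_part_bound n D b i j Hn BD)) as B1.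
    assert (B2 : (INR n - 2 * s) * bil n (trace_part n D 0) e e <= K2 * b).
    { replace (K2 * b) with (INR n * (INR n * INR n * (2 * INR n * b))) by (unfold K2; ring).
      pose proof (Rle_abs (bil n (trace_part n D 0) e e)).
      pose proof (Rabs_pos (bil n (trace_part n D 0) e e)).
      apply Rle_trans with ((INR n - 2 * s) * Rabs (bil n (trace_part n D 0) e e)).
      - apply Rmult_le_compat_l; lra.
      - apply Rmult_le_compat; lra. }
    lra.
  - intros Eh; specialize (Hsl Eh); unfold H2, T2; rewrite tr_lin, scal_lin, trD.
    rewrite scal_einstein_part by lia.
    pose proof (scal_bound n D b BD) as B1; apply Rabs_le_bounds in B1.
    assert (theta * scal n D <= K3 * b); [|lra].
    apply Rle_trans with (theta * (INR n * (INR n * b))).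
    + apply Rmult_le_compat_l; lra.
    + unfold K3; replace (INR n * INR n * b) with (1 * (INR n * (INR n * b))) by ring.
      apply Rmult_le_compat_r; [|lra]; apply Rmult_le_pos; [lra|]; apply Rmult_le_pos; lra.
  - specialize (Htau tau0 ltac:(lra)).
    match type of Htau with Ccone _ _ _ ?S0 => set (S := S0) in * end.
    (* The difference quotient of the step of length [tau0] is exactly [Y] plus [eps] times the
       barrier. *)
    exists (fun i j k l => / tau0 * (S i j k l - X i j k l)); split.
    + exists S, (/ tau0); split; [exact Htau|]; split.
      * left; apply Rinv_0_lt_compat; auto.
      * intros i j k l _ _ _ _; reflexivity.
    + assert (ED : dist2 n Y (fun i j k l => / tau0 * (S i j k l - X i j k l)) = eps ^ 2 * nb).
      { unfold dist2, nb; rewrite <- sum4_scal; apply sum4_ext; intros i j k l Hi Hj Hk Hl.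
        rewrite (EY i j k l), (E i j k l) by auto; unfold S; field; lra. }
      rewrite ED; apply Rle_lt_trans with (eps * nb); [|lra].
      apply Rmult_le_compat_r; auto; nra.
Qed.

Theorem theorem2p5 (n : nat) (hn : (5 <= n)%nat) :
  exists thetabar : R, 0 < thetabar /\
    (forall sigma theta, 0 < sigma <= 2 -> 0 <= theta <= thetabar ->
       ode_invariant n (Ccone n sigma theta)) /\
    (forall sigma theta, 0 < sigma < 2 -> sigma <> 1 -> 0 < theta < thetabar ->
       transversally_invariant n (Ccone n sigma theta)).
Proof.
  exists (theta_bound n); split; [apply theta_bound_pos; auto|]; split.
  - intros sigma theta Hs Hth; apply nagumo with (barrier n theta).
    + intros X; apply Ccone_closed; [lia|lra].
    + intros P eps HP He; apply Ccone_tangent; auto.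
  - intros sigma theta Hs Hs1 Hth; apply Ccone_transversal; auto.
Qed.
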